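(* Let $\alpha>1$ and $f\in L^2(\mathbb{P})$. The following statements are equivalent: (1) There exists $C>0$ such that for every $t>0$, $$\mathbb{E}[(f_t)^2]\le\frac{C}{t^\alpha}.$$ (2) There exists $C>0$ such that for every $\delta>0$, $$\int_{[0,\delta]}\frac1\lambda\,\mathrm{d}e_f(\lambda)\le C\,\delta^{\alpha-1}.$$
   Context: Let $d\ge 1$. Two points $x,y\in\mathbb{Z}^d$ are neighbours ($x\sim y$) iff $\|x-y\|_2=1$; $\mathbb{B}^d$ is the set of unoriented edges between neighbours. $\Omega=(0,+\infty)^{\mathbb{B}^d}$; for $\omega\in\Omega$, $\omega_{x,y}=\omega_{y,x}=\omega_e$ for $e=(x,y)$. Translations act by $(\theta_x\,\omega)_{y,z}=\omega_{x+y,x+z}$. For fixed $\omega$, $(X_t)_{t\ge0}$ is the continuous-time Markov process on $\mathbb{Z}^d$ with jump rate $\omega_{x,y}$ between neighbours $x,y$; $\mathbf{P}^\omega_x$ is its law started from $x$ and $\mathbf{E}^\omega_x$ the corresponding expectation. $\mathbb{P}$ is a probability law on $\Omega$ (expectation $\mathbb{E}$), invariant under all $\theta_x$, $x\in\mathbb{Z}^d$, and such that $\omega_e\ge 1$ almost surely for every edge $e$; the walk is assumed to be well defined for all times (no explosion), almost surely. The environment viewed by the particle is $\omega(t)=\theta_{X_t}\,\omega$; it is a Markov process reversible with respect to $\mathbb{P}$, with self-adjoint generator on $L^2(\mathbb{P})$ given by $\mathcal{L}f(\omega)=\sum_{|z|=1}\omega_{0,z}(f(\theta_z\,\omega)-f(\omega))$.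 One sets $f_t(\omega)=\mathbf{E}^\omega_0[f(\omega(t))]$, i.e. $f_t=e^{t\mathcal{L}}f$. For $f\in L^2(\mathbb{P})$, $e_f$ is the spectral measure of $-\mathcal{L}$ projected on $f$: for every bounded continuous $\Psi:[0,+\infty)\to\mathbb{R}$, $\mathbb{E}[\Psi(-\mathcal{L})(f)(\omega)\,f(\omega)]=\int\Psi(\lambda)\,\mathrm{d}e_f(\lambda)$. The convention $1/0=+\infty$ is used in the integral. *)

(* Defs.v *)
From HB Require Import structures.
From mathcomp Require Import all_boot all_order all_algebra.
From mathcomp Require Import all_classical all_reals all_analysis.

Set Implicit Arguments.
Unset Strict Implicit.
Unset Printing Implicit Defensive.

Import Order.TTheory GRing.Theory Num.Theory.
Import numFieldNormedType.Exports.

Local Open Scope classical_set_scope.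
Local Open Scope ring_scope.

Notation Zd d := 'rV[int]_d.

Definition nbr d (x y : Zd d) : bool :=
  \sum_(i < d) (x 0 i - y 0 i) ^+ 2 == 1.

Lemma nbrC d (x y : Zd d) : nbr x y = nbr y x.
Proof.
by rewrite /nbr; congr (_ == _); apply: eq_bigr => i _; rewrite -sqrrN opprB.
Qed.

Lemma nbrD2l d (z x y : Zd d) : nbr (z + x) (z + y) = nbr x y.
Proof.
rewrite /nbr; congr (_ == _); apply: eq_bigr => i _.
by rewrite !mxE opprD addrACA subrr add0r.
Qed.

(* An element of (0, +oo)^(B^d): the value on the unoriented edge {x, y} is
   read off at both (x, y) and (y, x), and pairs which are not edges carry 0. *)
Record env (R : realType) (d : nat) := Env {
  rate :> Zd d -> Zd d -> R ;
  rateC : forall x y, rate x y = rate y x ;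
  rate_gt0 : forall x y, nbr x y -> 0 < rate x y ;
  rate_eq0 : forall x y, ~~ nbr x y -> rate x y = 0 }.

Section environments.
Variables (R : realType) (d : nat).
Notation env := (env R d).

Definition unit_rate (x y : Zd d) : R := (nbr x y)%:R.

Lemma unit_rateC x y : unit_rate x y = unit_rate y x.
Proof. by rewrite /unit_rate nbrC. Qed.

Lemma unit_rate_gt0 x y : nbr x y -> 0 < unit_rate x y.
Proof. by rewrite /unit_rate => ->. Qed.

Lemma unit_rate_eq0 x y : ~~ nbr x y -> unit_rate x y = 0.
Proof. by rewrite /unit_rate => /negbTE ->. Qed.

HB.instance Definition _ := gen_eqMixin env.
HB.instance Definition _ := gen_choiceMixin env.
HB.instance Definition _ :=
  isPointed.Build env (Env unit_rateC unit_rate_gt0 unit_rate_eq0).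

Definition cylinders : set (set env) :=
  [set A | exists x y (B : set R),
     measurable B /\ A = [set w : env | B (w x y)]].

(* Omega with its product sigma-algebra *)
Definition Omega := g_sigma_algebraType cylinders.
HB.instance Definition _ := Measurable.on Omega.

Section shift.
Variables (x : Zd d) (w : env).

Let r y z := w (x + y) (x + z).

Lemma shift_rateC y z : r y z = r z y.
Proof. exact: rateC. Qed.

Lemma shift_rate_gt0 y z : nbr y z -> 0 < r y z.
Proof. by move=> yz; apply: rate_gt0; rewrite nbrD2l. Qed.

Lemma shift_rate_eq0 y z : ~~ nbr y z -> r y z = 0.
Proof. by move=> yz; apply: rate_eq0; rewrite nbrD2l. Qed.

Definition shift : env := Env shift_rateC shift_rate_gt0 shift_rate_eq0.
End shift.

Definition exit_rate (w : env) (x : Zd d) : R :=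
  \sum_(y \in [set y | nbr x y]) w x y.

Definition shift_invariant (P : probability Omega R) :=
  forall (x : Zd d) (A : set Omega), measurable A ->
    P (shift x @^-1` A) = P A.

(* The random walk is described by its skeleton: Y n is the position after n
   jumps and S n the time spent there. *)
Section walk.
Context dT (T : measurableType dT).
Variables (Y : nat -> T -> Zd d) (S : nat -> T -> R).

Definition skeleton_measurable :=
  (forall n y, measurable (Y n @^-1` [set y])) /\
  (forall n, measurable_fun setT (S n)).

(* Q is the law of the continuous-time Markov chain with jump rates w started
   from x: Y is a Markov chain with Y 0 = x which jumps from y to z with
   probability w y z / exit_rate w y and, given Y, the holding times S n are
   independent and exponential with parameters exit_rate w (Y n). *)
Definition walk_law (w : env) (x : Zd d) (Q : probability T R) :=
  forall n (y : nat -> Zd d) (s : nat -> R), (forall i, 0 <= s i) ->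
    Q [set u | forall i, (i <= n)%N -> Y i u = y i /\ s i < S i u] =
    ((y 0%N == x)%:R *
     (\prod_(i < n) (w (y i) (y i.+1) / exit_rate w (y i))) *
     \prod_(i < n.+1) expR (- (exit_rate w (y i) * s i)))%:E.

Definition jump_time n (u : T) : R := \sum_(i < n) S i u.

(* The position at time t; after an explosion it is given the junk value
   Y 0 u. *)
Definition walk (t : R) (u : T) : Zd d :=
  Y (xget 0%N [set n | jump_time n u <= t < jump_time n.+1 u]) u.

Definition no_explosion (Q : probability T R) :=
  {ae Q, forall u, jump_time n u @[n --> \oo] --> +oo}.

Variable Pw : env -> Zd d -> probability T R.

(* f_t, that is, E_0^w [f (w(t))] with w(t) = theta_(X_t) w *)
Definition evolve (t : R) (f : Omega -> R) : Omega -> R :=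
  fun w => \int[Pw w 0]_u f (shift (walk t u) w).

End walk.

Definition gen (f : Omega -> R) : Omega -> R := fun w =>
  \sum_(z \in [set z | nbr 0 z]) w 0 z * (f (shift z w) - f w).

Section operators.
Variables (P : probability Omega R) (semi : R -> (Omega -> R) -> Omega -> R).

Local Notation L2 := (Lfun P 2%:E).

(* Domain of gen as the infinitesimal generator in L^2(P) of the semigroup
   semi. *)
Definition gen_dom (f : Omega -> R) :=
  [/\ f \in L2, gen f \in L2 &
    (\int[P]_w (((semi t f w - f w) / t - gen f w) ^+ 2)%:E)%E
      @[t --> 0^'+] --> 0%E].

Definition bounded_continuous (psi : R -> R) :=
  {within `[0, +oo[, continuous psi} /\
  exists M : R, forall l : R, 0 <= l -> `|psi l| <= M.

(* Phi psi is psi(- gen), for psi bounded and continuous on [0, +oo[.  The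
   bounded continuous functional calculus of the self-adjoint operator - gen
   is the only homomorphism of unital algebras, with values in the symmetric
   operators on L^2(P), which maps l |-> 1 / (1 + l) to the resolvent
   (1 - gen)^-1: it is determined on C([0, +oo]) by the Stone-Weierstrass
   theorem, and then everywhere because the resolvent has a dense range. *)
Record functional_calculus (Phi : (R -> R) -> (Omega -> R) -> Omega -> R) :
    Prop := {
  fc_L2 : forall psi f, bounded_continuous psi -> f \in L2 ->
    Phi psi f \in L2 ;
  fc_ext : forall psi phi f g,
    bounded_continuous psi -> bounded_continuous phi ->
    (forall l : R, 0 <= l -> psi l = phi l) ->
    f \in L2 -> g \in L2 -> f = g %[ae P] ->
    Phi psi f = Phi phi g %[ae P] ;
  fc_linear : forall psi (a : R) f g, bounded_continuous psi ->
    f \in L2 -> g \in L2 ->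
    Phi psi (fun w => a * f w + g w) =
      (fun w => a * Phi psi f w + Phi psi g w) %[ae P] ;
  fc_sym : forall psi f g, bounded_continuous psi ->
    f \in L2 -> g \in L2 ->
    \int[P]_w (Phi psi f w * g w) = \int[P]_w (f w * Phi psi g w) ;
  fc_lincomb : forall (a : R) psi phi f,
    bounded_continuous psi -> bounded_continuous phi -> f \in L2 ->
    Phi (fun l : R => a * psi l + phi l) f =
      (fun w => a * Phi psi f w + Phi phi f w) %[ae P] ;
  fc_mul : forall psi phi f,
    bounded_continuous psi -> bounded_continuous phi -> f \in L2 ->
    Phi (fun l : R => psi l * phi l) f = Phi psi (Phi phi f) %[ae P] ;
  fc_one : forall f, f \in L2 -> Phi (fun=> 1) f = f %[ae P] ;
  fc_resolvent_r : forall g, g \in L2 ->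
    let h := Phi (fun l : R => (1 + l)^-1) g in
    gen_dom h /\ (fun w => h w - gen h w) = g %[ae P] ;
  fc_resolvent_l : forall h, gen_dom h ->
    Phi (fun l : R => (1 + l)^-1) (fun w => h w - gen h w) = h %[ae P] }.

(* A measure on [0, +oo[ is represented by a measure on R which is only ever
   used on [0, +oo[. *)
Definition spectral_measure (Phi : (R -> R) -> (Omega -> R) -> Omega -> R)
    (f : Omega -> R) (e : {measure set (measurableTypeR R) -> \bar R}) :=
  forall psi, bounded_continuous psi ->
    (\int[P]_w (Phi psi f w * f w)%:E = \int[e]_(l in `[0%R, +oo[) (psi l)%:E)%E.

End operators.
End environments.

(* Main.v *)
Require Import Defs.
From HB Require Import structures.
From mathcomp Require Import all_boot all_order all_algebra.
From mathcomp Require Import all_classical all_reals all_analysis.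
From mathcomp Require Import measurable_realfun.
From mathcomp Require Import ring lra zify.

Set Implicit Arguments.
Unset Strict Implicit.
Unset Printing Implicit Defensive.

Import Order.TTheory GRing.Theory Num.Theory.
Import numFieldNormedType.Exports.

Local Open Scope classical_set_scope.
Local Open Scope ring_scope.

(* If E(t) denotes the second moment of f_t, then f_t = exp(t gen) f gives
   E(t) = \int exp(-2 t l) de_f(l), and both statements are equivalent to
   e_f([0, delta]) <= K delta^alpha: for the first one compare exp(-2 t l) with
   indicators of [0, (k + 1) / t], for the second one compare 1 / l with
   indicators of the dyadic intervals [0, delta / 2^k], whose weighted masses
   are summable since alpha > 1.
   The identification f_t = exp(t gen) f rests on the Markov property.  The
   probability that the walk makes n jumps and sits at y at time t is a power
   series in t, solution of the backward equation; linear differential equations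
   then give its symmetry and the Chapman-Kolmogorov equations, hence (with
   stationarity) that f |-> f_t is a contraction semigroup of L^2(P).  The
   functional calculus provides the resolvent of gen, and a contraction
   semigroup is determined by its resolvent. *)

(** * Power series and linear differential equations *)

(** The functional calculus is tied to [gen] only through the resolvent, and the domain of [gen] is
    itself defined by difference quotients of [evolve]. So [evolve] must be shown to be a
    contraction semigroup from the law of the skeleton alone. The jump rates of a fixed environment
    may be unbounded over the lattice, so exp(t gen) cannot be expanded as a whole. Sorting
    trajectories by their number n of jumps removes this obstacle: n jumps from x reach finitely
    many sites, and each resulting series in t is entire. Algebraic identities are proved at fixed
    n, with finite sums; only nonnegative terms are ever summed over n. Measurability is the second
    obstacle: [walk] and [evolve] are given pointwise, and are replaced by measurable versions that
    agree with them almost everywhere. Identities in L^2(P) are therefore stated as the vanishing of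
    a seminorm. The comparison of the two semigroups takes place on the range of the squared
    resolvent, because (1 + l)^-2 (exp(- r l) - 1 + r l) is at most r^2 uniformly in l. *)

Section exponential_generating_function.
Variable R : realType.
Implicit Types (a b : nat -> R) (t K : R).

(** A single constant stands for both C and K in a bound [C * K ^+ m]. Division by m! then makes
    [egf a] entire, and closure under shifts makes its derivatives of the same kind. *)
Definition geo_bounded a := exists2 K : R, 0 <= K & forall m, `|a m| <= K ^+ m.+1.

Definition egf a t : R := limn (pseries (fun m => a m / m`!%:R) t).


Lemma geo_boundedP a : geo_bounded a <->
  exists C K : R, [/\ 0 <= C, 0 <= K & forall m, `|a m| <= C * K ^+ m].
Proof.
split=> [[K K0 aK]|[C [K [C0 K0 aK]]]].
  by exists K, K; split=> // m; rewrite -exprS.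
exists (C + K) => [|m]; first exact: addr_ge0.
apply: (le_trans (aK m)); rewrite exprS ler_pM ?exprn_ge0 ?lerDl//.
by apply: lerXn2r; rewrite ?nnegrE ?addr_ge0 ?lerDr.
Qed.

Lemma geo_bounded_shift a : geo_bounded a -> geo_bounded (fun m => a m.+1).
Proof.
move=> /geo_boundedP[C [K [C0 K0 aK]]]; apply/geo_boundedP.
exists (C * K), K; split=> //; first exact: mulr_ge0.
by move=> m; rewrite -mulrA -exprS.
Qed.

Lemma is_cvg_egf a t : geo_bounded a ->
  cvgn (pseries (fun m => a m / m`!%:R) t).
Proof.
move=> /geo_boundedP[C [K [C0 K0 aK]]].
apply: normed_cvg; apply: (@series_le_cvg _ _ (C *: exp_coeff (K * `|t|))).
- by move=> n; exact: normr_ge0.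
- by move=> n; rewrite /= mulr_ge0// exp_coeff_ge0// mulr_ge0.
- move=> n; rewrite /exp_coeff -[leRHS]/(C * ((K * `|t|) ^+ n / n`!%:R)) /=.
  rewrite exprMn normrM normf_div normrX [X in _ / X]ger0_norm// mulrAC.
  by rewrite !mulrA ler_wpM2r ?invr_ge0// ler_wpM2r ?exprn_ge0.
- exact/is_cvg_seriesZ/is_cvg_series_exp_coeff.
Qed.

(** Division by m! turns differentiation into a shift of the coefficients, so recursions on
    coefficients become differential equations. *)
Lemma egf_is_derive a t : geo_bounded a ->
  is_derive t 1 (egf a) (egf (fun m => a m.+1) t).
Proof.
move=> ga; have shE b : pseries_diffs (fun m => b m / m`!%:R) =
    (fun m => b m.+1 / m`!%:R).
  apply/funext => m; rewrite /pseries_diffs factS natrM invfM mulrCA.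
  by rewrite mulVKf.
rewrite /egf -shE; apply: (@pseries_snd_diffs _ _ (`|t| + 1)).
- exact: is_cvg_egf.
- by rewrite shE; apply: (@is_cvg_egf (fun m => a m.+1)); exact: geo_bounded_shift.
- rewrite shE (shE (fun m => a m.+1)); apply: (@is_cvg_egf (fun m => a m.+2)).
  exact/(@geo_bounded_shift (fun m => a m.+1))/geo_bounded_shift.
- by rewrite [ltRHS]ger0_norm ?addr_ge0// ltrDl.
Qed.

Lemma egf0 a : egf a 0 = a 0%N.
Proof.
apply: cvg_lim => //; apply: (@cvg_trans _ ((fun=> a 0%N) @ \oo)); last first.
  exact: cvg_cst.
apply: near_eq_cvg; near=> n.
have : (0 < n)%N by near: n; exact: nbhs_infty_gt.
move=> /prednK <-; rewrite /pseries /series /= big_nat_recl// big1 ?addr0.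
  by rewrite expr0 mulr1 fact0 divr1.
by move=> i _; rewrite expr0n mulr0.
Unshelve. all: by end_near. Qed.

Lemma geo_boundedZ c a : geo_bounded a -> geo_bounded (fun m => c * a m).
Proof.
move=> /geo_boundedP[C [K [C0 K0 aK]]]; apply/geo_boundedP.
exists (`|c| * C), K; split=> [||m]; rewrite ?mulr_ge0//.
by rewrite normrM -mulrA ler_wpM2l.
Qed.

Lemma geo_boundedD a b : geo_bounded a -> geo_bounded b ->
  geo_bounded (fun m => a m + b m).
Proof.
move=> [K K0 aK] [L L0 bL]; apply/geo_boundedP.
exists (K + L), (K + L); split=> [||m]; rewrite ?addr_ge0//.
rewrite (le_trans (ler_normD _ _))// mulrDl lerD//.
  rewrite (le_trans (aK _))// exprS ler_wpM2l// lerXn2r// ?nnegrE ?addr_ge0//.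
  by rewrite lerDl.
rewrite (le_trans (bL _))// exprS ler_wpM2l// lerXn2r// ?nnegrE ?addr_ge0//.
by rewrite lerDr.
Qed.

Lemma egfZ c a t : geo_bounded a -> egf (fun m => c * a m) t = c * egf a t.
Proof.
move=> ga; rewrite /egf; apply: cvg_lim => //.
rewrite (_ : pseries _ t = c *: pseries (fun m => a m / m`!%:R) t).
  by apply: cvgZr; exact: is_cvg_egf.
rewrite /pseries -seriesZ; congr series.
by apply/funext => m /=; rewrite -[RHS]/(c * _) !mulrA.
Qed.

Lemma egfD a b t : geo_bounded a -> geo_bounded b ->
  egf (fun m => a m + b m) t = egf a t + egf b t.
Proof.
move=> ga gb; rewrite /egf; apply: cvg_lim => //.
rewrite (_ : pseries _ t = pseries (fun m => a m / m`!%:R) t +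
  pseries (fun m => b m / m`!%:R) t).
  by apply: cvgD; exact: is_cvg_egf.
rewrite /pseries -seriesD; congr series.
by apply/funext => m /=; rewrite -[RHS]/(_ * _ + _ * _) !mulrDl.
Qed.

Lemma geo_bounded0 : geo_bounded (fun=> 0).
Proof. by exists 0 => // m; rewrite normr0 exprn_ge0. Qed.

Lemma geo_bounded_sum (I : Type) (s : seq I) (c : I -> R) (a : I -> nat -> R) :
  (forall i, geo_bounded (a i)) ->
  geo_bounded (fun m => \sum_(i <- s) c i * a i m).
Proof.
move=> ga; elim: s => [|i s ih].
  by under eq_fun do rewrite big_nil; exact: geo_bounded0.
under eq_fun do rewrite big_cons.
by apply: geo_boundedD => //; exact: geo_boundedZ.
Qed.

Lemma egf_sum (I : Type) (s : seq I) (c : I -> R) (a : I -> nat -> R) t :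
  (forall i, geo_bounded (a i)) ->
  egf (fun m => \sum_(i <- s) c i * a i m) t = \sum_(i <- s) c i * egf (a i) t.
Proof.
move=> ga; elim: s => [|i s ih].
  under eq_fun do rewrite big_nil.
  rewrite big_nil (_ : (fun=> 0) = fun m : nat => 0 * ((fun=> 0) m : R)).
    by rewrite egfZ ?mul0r//; exact: geo_bounded0.
  by apply/funext => m; rewrite mul0r.
under eq_fun do rewrite big_cons.
rewrite egfD ?egfZ ?ih ?big_cons//; first exact: geo_boundedZ.
exact: geo_bounded_sum.
Qed.

(** The integrating factor exp(- c t) makes the product with F constant, and it vanishes at 0. *)
Lemma linear_ode_unique (F : R -> R) c : F 0 = 0 ->
  (forall t, is_derive t 1 F (c * F t)) -> forall t, F t = 0.
Proof.
move=> F0 dF t; pose E t : R := expR (- c * t) * F t.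
suff : E t = E 0.
  rewrite /E F0 mulr0 => /eqP; rewrite mulf_eq0 => /orP[|/eqP//].
  by rewrite gt_eqF// expR_gt0.
apply: is_derive_0_is_cst => s; rewrite /E.
have dc : is_derive s 1 (fun t : R => - c * t) (- c).
  have d := is_deriveM (is_derive_cst (- c) s 1) (is_derive_id s 1).
  apply: (is_derive_eq d).
  by rewrite /GRing.scale /=; lra.
have de := is_derive1_comp (is_derive_expR (- c * s)) dc.
have d := is_deriveM de (dF s); apply: (is_derive_eq d).
by rewrite /GRing.scale /=; lra.
Qed.

End exponential_generating_function.

Lemma geo_bounded_rec (R : realType) (u v : nat -> R) c :
  (forall m, u m.+1 = c * u m + v m) -> geo_bounded v -> geo_bounded u.
Proof.
move=> uE [K K0 vK]; exists (`|c| + K + `|u 0%N| + 1); first by rewrite !addr_ge0.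
set L := (_ + 1); have L1 : 1 <= L by rewrite lerDr !addr_ge0.
have L0 : 0 <= L by exact: le_trans L1.
elim=> [|m ih]; first by rewrite expr1 /L; have := normr_ge0 c; lra.
rewrite uE (le_trans (ler_normD _ _))// normrM [leRHS]exprS.
have KL : K <= L.
  by rewrite /L; have := normr_ge0 c; have := normr_ge0 (u 0%N); lra.
have vL : `|v m| <= K * L ^+ m.+1.
  rewrite (le_trans (vK _))// exprS ler_wpM2l//.
  by rewrite (@le_trans _ _ (L ^+ m))// ?lerXn2r ?nnegrE// exprS ler_peMl ?exprn_ge0.
have := ler_wpM2l (normr_ge0 c) ih.
have : 0 <= (`|u 0%N| + 1) * L ^+ m.+1 by rewrite mulr_ge0 ?addr_ge0 ?exprn_ge0.
rewrite /L; lra.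
Qed.

(** * Solutions of the backward equation sorted by number of jumps *)

Section jump_series.
Variables (R : realType) (I : choiceType) (nb : I -> seq I).
Variables (q : I -> I -> R) (lam : I -> R).
Implicit Types (b : nat -> I -> R) (g h : I -> R) (n m : nat) (t s : R) (x y z : I).

(* [jcoef b n] are the coefficients of the solution of the backward equation
   u_n' = - lam u_n + q u_(n-1), u_n(0) = 0, when [b] are those of u_0. *)
Fixpoint jcoef b n m x {struct m} : R :=
  match n, m with
  | 0, _ => b m x
  | _.+1, 0 => 0
  | n'.+1, m'.+1 =>
    - lam x * jcoef b n m' x + \sum_(z <- nb x) q x z * jcoef b n' m' z
  end.

Definition jseries b n t x := egf (fun m => jcoef b n m x) t.

Definition base_bounded b := forall x, geo_bounded (b ^~ x).

Lemma jcoef0 b m x : jcoef b 0 m x = b m x. Proof. by case: m. Qed.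

Lemma jcoefSS b n m x : jcoef b n.+1 m.+1 x =
  - lam x * jcoef b n.+1 m x + \sum_(z <- nb x) q x z * jcoef b n m z.
Proof. by []. Qed.

Lemma jcoef_bounded b n x : base_bounded b -> geo_bounded (fun m => jcoef b n m x).
Proof.
move=> bb; elim: n x => [x|n ih x].
  by under eq_fun do rewrite jcoef0.
apply: geo_bounded_rec; first by move=> m; exact: jcoefSS.
exact: geo_bounded_sum.
Qed.

Lemma jseries_derive b n t x : base_bounded b ->
  is_derive t 1 (fun t : R => jseries b n.+1 t x)
    (- lam x * jseries b n.+1 t x + \sum_(z <- nb x) q x z * jseries b n t z).
Proof.
move=> bb; have d := egf_is_derive t (jcoef_bounded n.+1 x bb).
apply: (is_derive_eq d).
under eq_fun do rewrite jcoefSS.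
have jb k z : geo_bounded (fun m => jcoef b k m z) by exact: jcoef_bounded.
rewrite egfD ?egfZ ?egf_sum//; first exact: geo_boundedZ.
exact: geo_bounded_sum.
Qed.

Lemma jseries_at0 b n x : jseries b n.+1 0 x = 0.
Proof. by rewrite /jseries egf0. Qed.

Lemma jcoef_comb (J : Type) (s : seq J) (c : J -> R) (b : J -> nat -> I -> R) n m x :
  jcoef (fun m x => \sum_(j <- s) c j * b j m x) n m x =
  \sum_(j <- s) c j * jcoef (b j) n m x.
Proof.
elim: m n x => [|m ih] [|n] x //; first by rewrite /= big1// => j; rewrite mulr0.
rewrite jcoefSS ih mulr_sumr.
rewrite (eq_bigr (fun z => \sum_(j <- s) c j * (q x z * jcoef (b j) n m z))).
  rewrite exchange_big -big_split/=; apply: eq_bigr => j _.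
  by rewrite -mulr_sumr mulrCA mulrDr.
by move=> z _; rewrite ih mulr_sumr; apply: eq_bigr => j _; rewrite mulrCA.
Qed.

(** Coefficients of exp(- lam x t) g x, the contribution of trajectories without jump. With this
    base, [jseries] at n is the expectation of g at time t restricted to exactly n jumps. *)
Definition expb g m x := (- lam x) ^+ m * g x.

Lemma expb_bounded g : base_bounded (expb g).
Proof.
move=> x; apply/geo_boundedP; exists `|g x|, `|lam x|; split=> // m.
by rewrite normrM normrX normrN mulrC.
Qed.

Lemma eq_jcoef b b' n m x : b =2 b' -> jcoef b n m x = jcoef b' n m x.
Proof. by move=> bb; rewrite (_ : b = b')//; apply/funext => k; apply/funext. Qed.

Lemma jcoef_expb_comb (J : Type) (s : seq J) (c : J -> R) (g : J -> I -> R) n m x :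
  jcoef (expb (fun x => \sum_(j <- s) c j * g j x)) n m x =
  \sum_(j <- s) c j * jcoef (expb (g j)) n m x.
Proof.
rewrite -jcoef_comb; apply: eq_jcoef => k z; rewrite /expb mulr_sumr.
by apply: eq_bigr => j _; rewrite mulrCA.
Qed.

Lemma jseries_expb_derive g n t x :
  is_derive t 1 (fun t : R => jseries (expb g) n t x)
    (- lam x * jseries (expb g) n t x +
     (if n is n'.+1 then \sum_(z <- nb x) q x z * jseries (expb g) n' t z
      else 0)).
Proof.
case: n => [|n]; last exact/jseries_derive/expb_bounded.
have eb := expb_bounded g.
have d := egf_is_derive t (jcoef_bounded 0 x eb).
apply: (is_derive_eq d); rewrite addr0 -egfZ; last exact: jcoef_bounded.
by congr egf; apply/funext => m; rewrite !jcoef0 /expb exprS mulrA.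
Qed.

Lemma jseries_expb_at0 g n x : jseries (expb g) n 0 x = (n == 0%N)%:R * g x.
Proof.
case: n => [|n]; last by rewrite jseries_at0 mul0r.
by rewrite /jseries egf0 jcoef0 /expb expr0.
Qed.

(* The matrix exponential of a bidiagonal generator: both sides solve the same
   triangular system of linear equations in t. *)
Lemma jseries_semigroup g n t s x :
  jseries (expb g) n (t + s) x =
  \sum_(k < n.+1) jseries (expb (jseries (expb g) (n - k) s)) k t x.
Proof.
apply/eqP; rewrite -subr_eq0; apply/eqP.
move: n x t; elim=> [|n ih] x; apply: (@linear_ode_unique _ _ (- lam x)) => [|t].
- rewrite add0r big_ord_recl big_ord0 jseries_expb_at0 /= mul1r addr0 subn0.
  by rewrite subrr.
- under eq_fun do rewrite big_ord_recl big_ord0 addr0 /=.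
  have da := is_deriveD (is_derive_id t 1) (is_derive_cst s t (1:R)).
  have d1 := @is_derive1_comp _ (fun u : R => jseries (expb g) 0 u x)
    (id + cst s) t _ _ (jseries_expb_derive g 0 (t + s) x) da.
  have d2 := jseries_expb_derive (jseries (expb g) (0 - 0) s) 0 t x.
  have d := is_deriveB d1 d2.
  apply: (is_derive_eq d).
  by rewrite big_ord_recl big_ord0 /=; lra.
- rewrite add0r big_ord_recl jseries_expb_at0 /= mul1r subn0 big1 ?addr0 ?subrr//.
  by move=> i _; rewrite jseries_at0.
- have da := is_deriveD (is_derive_id t 1) (is_derive_cst s t (1:R)).
  have d1 := @is_derive1_comp _ (fun u : R => jseries (expb g) n.+1 u x)
    (id + cst s) t _ _ (jseries_expb_derive g n.+1 (t + s) x) da.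
  have d2 := is_derive_sum (fun k : 'I_n.+2 =>
    jseries_expb_derive (jseries (expb g) (n.+1 - k) s) k t x).
  have d := is_deriveB d1 d2.
  rewrite (_ : (fun _ => _) = (fun u => jseries (expb g) n.+1 u x) \o (id + cst s) -
    \sum_(k < n.+2) (fun u => jseries (expb (jseries (expb g) (n.+1 - k) s)) k u x)).
    apply: (is_derive_eq d).
    rewrite big_split/= -mulr_sumr addr0 mulr1.
    (* Only the q-terms are left to compare: the summand k = 0 has none, and the induction
       hypothesis at each neighbour z matches the others. *)
    rewrite [X in _ - (_ + X)](_ : _ =
      \sum_(z <- nb x) q x z * jseries (expb g) n (t + s) z); first by rewrite -/(t + s); lra.
    rewrite big_ord_recl/= add0r exchange_big/=; apply: eq_bigr => z _.
    rewrite -mulr_sumr; congr (_ * _).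
    by move: (ih z t) => /eqP; rewrite subr_eq0 => /eqP ->.
  by apply/funext => u /=; rewrite !fctE fct_sumE.
Qed.

End jump_series.

(** * Kernels with a fixed number of jumps: finite range and symmetry *)

Section jump_kernel.
Variables (R : realType) (I : choiceType) (nb : I -> seq I).
Variables (q : I -> I -> R) (lam : I -> R).
Implicit Types (g h : I -> R) (n m : nat) (t s : R) (x y z : I).

Local Notation jcoef := (jcoef nb q lam).
Local Notation jseries := (jseries nb q lam).
Local Notation expb := (expb lam).

Definition dirac_fun y x : R := (x == y)%:R.

Definition jkernel n t x y := jseries (expb (dirac_fun y)) n t x.

(** Endpoints of paths of n steps from x, with repetitions. They carry the kernel with n jumps, so
    that every sum over sites at fixed n is finite. *)
Fixpoint jball n x : seq I :=
  if n is n'.+1 then flatten [seq jball n' z | z <- nb x] else [:: x].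

Lemma jcoef_local g h n m x : {in jball n x, g =1 h} ->
  jcoef (expb g) n m x = jcoef (expb h) n m x.
Proof.
elim: m n x => [|m ih] [|n] x // gh; rewrite ?jcoef0 ?jcoefSS.
- by rewrite /expb gh ?inE.
- by rewrite /expb gh ?inE.
- rewrite ih//; congr (_ + _); apply: eq_big_seq => z znb; rewrite ih// => y yz.
  by apply: gh; apply/flattenP; exists (jball n z) => //; exact: map_f.
Qed.

Lemma jcoef_dirac_out n m x y : y \notin jball n x ->
  jcoef (expb (dirac_fun y)) n m x = 0.
Proof.
move=> yx; rewrite (@jcoef_local _ (fun=> 0)).
  (* The zero function is the empty linear combination, so linearity in g gives the value 0. *)
  transitivity (\sum_(j <- [::] : seq nat) 0 * jcoef (expb (fun=> 0)) n m x).
    2: by rewrite big_nil.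
  by rewrite -jcoef_expb_comb; apply: eq_jcoef => k u; rewrite /expb big_nil.
move=> z zx; rewrite /dirac_fun; case: eqP => // zy.
by move: yx; rewrite -zy zx.
Qed.

Lemma jcoef_expand g n m x (s : seq I) : uniq s -> {subset jball n x <= s} ->
  jcoef (expb g) n m x = \sum_(y <- s) g y * jcoef (expb (dirac_fun y)) n m x.
Proof.
move=> us xs; rewrite -jcoef_expb_comb; apply: jcoef_local => z zx.
rewrite (bigD1_seq z) ?xs//= big1; first by rewrite /dirac_fun eqxx mulr1 addr0.
by move=> y /negPf yz; rewrite /dirac_fun eq_sym yz mulr0.
Qed.

Lemma jkernel_out n t x y : y \notin jball n x -> jkernel n t x y = 0.
Proof.
move=> yx; rewrite /jkernel (_ : 0 = 0 * egf (fun=> 0 : R) t); last by rewrite mul0r.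
rewrite -egfZ; last exact: geo_bounded0.
by congr egf; apply/funext => m; rewrite jcoef_dirac_out// mul0r.
Qed.

Lemma jseries_expand g n t x : jseries (expb g) n t x =
  \sum_(y <- undup (jball n x)) g y * jkernel n t x y.
Proof.
rewrite -egf_sum => [|y]; last by apply: jcoef_bounded; exact: expb_bounded.
congr egf; apply/funext => m; apply: jcoef_expand; first exact: undup_uniq.
by move=> y; rewrite mem_undup.
Qed.

(** The definition of [jcoef] expands the first factor of a product of bidiagonal matrices;
    expanding the last one instead gives the forward equation, where the generator acts on g. *)
Lemma jcoef_right g n m x : jcoef (expb g) n.+1 m.+1 x =
  jcoef (expb (fun y => - lam y * g y)) n.+1 m x +
  jcoef (expb (fun y => \sum_(z <- nb y) q y z * g z)) n m x.
Proof.
elim: m n x => [|m ih] n x.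
  rewrite jcoefSS/= mulr0 !add0r; case: n => [|n] /=.
    rewrite /expb expr0 mul1r; apply: eq_bigr => z _.
    by rewrite ?jcoef0 expr0 mul1r.
  by rewrite big1// => z _; rewrite mulr0.
rewrite jcoefSS ih mulrDr [in RHS]jcoefSS -!addrA; congr (_ + _).
case: n => [|n].
  rewrite !jcoef0 addrC; congr (_ + _); last by rewrite /expb exprS mulrA.
  by apply: eq_bigr => z _; rewrite !jcoef0 /expb exprSr -mulrA.
rewrite [in RHS]jcoefSS addrCA; congr (_ + _).
by rewrite -big_split; apply: eq_bigr => z _; rewrite ih mulrDr.
Qed.

Lemma jkernel_at0 n x y : jkernel n 0 x y = ((n == 0%N) && (x == y))%:R.
Proof. by rewrite /jkernel jseries_expb_at0 /dirac_fun; case: eqP; rewrite ?mul1r ?mul0r. Qed.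

Lemma jkernel_CK n t s x y : jkernel n (t + s) x y =
  \sum_(k < n.+1) \sum_(z <- undup (jball k x))
    jkernel k t x z * jkernel (n - k) s z y.
Proof.
rewrite /jkernel jseries_semigroup; apply: eq_bigr => k _.
by rewrite jseries_expand; apply: eq_bigr => z _; rewrite mulrC.
Qed.

Hypothesis nb_uniq : forall x, uniq (nb x).
Hypothesis nb_sym : forall x y, (y \in nb x) = (x \in nb y).
Hypothesis q_sym : forall x y, q x y = q y x.

(** The forward recursion for (x, y) is the backward recursion for (y, x), because q is symmetric
    and the diagonal part at y is the same in both. *)
Lemma jcoef_sym n m x y :
  jcoef (expb (dirac_fun y)) n m x = jcoef (expb (dirac_fun x)) n m y.
Proof.
elim: m n x y => [|m ih] [|n] x y //; rewrite ?jcoef0.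
- by rewrite /expb !expr0 /dirac_fun eq_sym.
- by rewrite /expb /dirac_fun eq_sym; case: eqP => [->|]; rewrite ?mulr0.
rewrite jcoef_right [RHS]jcoefSS -ih; congr (_ + _).
  have := @jcoef_expb_comb R I nb q lam nat [:: 0%N] (fun=> - lam y)
    (fun _ => dirac_fun y) n.+1 m x.
  rewrite big_seq1 => <-; apply: eq_jcoef => k z; rewrite /expb big_seq1.
  by rewrite /dirac_fun; case: eqP => [->|]; rewrite ?mulr0.
rewrite (eq_bigr (fun z => q y z * jcoef (expb (dirac_fun z)) n m x)) => [|z _].
  rewrite -jcoef_expb_comb; congr (jcoef (expb _) _ _ _); apply/funext => z.
  have sumE u v : \sum_(w <- nb u) q u w * dirac_fun v w = (v \in nb u)%:R * q u v.
    case: (boolP (v \in nb u)) => vu.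
      rewrite (bigD1_seq v)//= big1 /dirac_fun ?eqxx ?addr0 ?mulr1 ?mul1r//.
      by move=> w /negPf ->; rewrite mulr0.
    rewrite mul0r big_seq big1// => w wu; rewrite /dirac_fun; case: eqP => [wv|].
      by move: vu; rewrite -wv wu.
    by rewrite mulr0.
  rewrite sumE nb_sym q_sym -sumE; apply: eq_bigr => w _.
  by rewrite /dirac_fun eq_sym.
by rewrite ih.
Qed.

Lemma jkernel_sym n t x y : jkernel n t x y = jkernel n t y x.
Proof. by congr egf; apply/funext => m; rewrite jcoef_sym. Qed.

End jump_kernel.

(** * Uniqueness of contraction semigroups *)

(* In a seminormed space, a contraction semigroup T whose generator has the
   resolvent J coincides with any contraction semigroup U commuting with J which
   is uniformly differentiable on the range of J^2. The first step is that T
   commutes with J, because J y is the only k with T' k = k - y. *)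
Section semigroup_uniqueness.
Variables (R : realType) (V : lmodType R) (n : V -> R).
Hypothesis n_tri : forall x y, n (x + y) <= n x + n y.
Hypothesis n_hom : forall a x, n (a *: x) = `|a| * n x.

(** Equality modulo null vectors: in the intended space the vectors are functions, and the
    identities hold only almost everywhere. *)
Let eqv x y := n (x - y) = 0.
Local Notation "x ~~ y" := (eqv x y) (at level 70).

Lemma seminorm0 : n 0 = 0. Proof. by rewrite -(scale0r (0 : V)) n_hom normr0 mul0r. Qed.

Lemma seminormN x : n (- x) = n x.
Proof. by rewrite -scaleN1r n_hom normrN normr1 mul1r. Qed.

Lemma seminorm_ge0 x : 0 <= n x.
Proof. by have := n_tri x (- x); rewrite subrr seminorm0 seminormN; lra. Qed.

Lemma seminormB_le x y : n x <= n (x - y) + n y.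
Proof. by rewrite -{1}(subrK y x). Qed.

Lemma eqv_refl x : x ~~ x. Proof. by rewrite /eqv subrr seminorm0. Qed.

Lemma eqv_sym x y : x ~~ y -> y ~~ x.
Proof. by rewrite /eqv -seminormN opprB. Qed.

Lemma eqv_trans y x z : x ~~ y -> y ~~ z -> x ~~ z.
Proof.
rewrite /eqv => xy yz; apply/eqP; rewrite eq_le seminorm_ge0 andbT.
by have := n_tri (x - y) (y - z); rewrite addrA subrK xy yz addr0.
Qed.

Lemma eqvD x y x' y' : x ~~ x' -> y ~~ y' -> (x + y) ~~ (x' + y').
Proof.
rewrite /eqv => xx yy; apply/eqP; rewrite eq_le seminorm_ge0 andbT opprD addrACA.
by rewrite (le_trans (n_tri _ _))// xx yy addr0.
Qed.

Lemma eqvN x x' : x ~~ x' -> (- x) ~~ (- x').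
Proof. by rewrite /eqv -opprD seminormN. Qed.

Lemma eqvB x y x' y' : x ~~ x' -> y ~~ y' -> (x - y) ~~ (x' - y').
Proof. by move=> ? ?; apply: eqvD => //; exact: eqvN. Qed.

Lemma eqvZ a x x' : x ~~ x' -> (a *: x) ~~ (a *: x').
Proof. by rewrite /eqv -scalerBr n_hom => ->; rewrite mulr0. Qed.

Lemma eqv_seminorm x y : x ~~ y -> n x = n y.
Proof.
move=> xy; have yx := eqv_sym xy; apply/eqP; rewrite eq_le.
by have := seminormB_le x y; have := seminormB_le y x; rewrite xy yx !add0r => -> ->.
Qed.

Definition contractive_map (A : V -> V) :=
  (forall a x y, A (a *: x + y) ~~ (a *: A x + A y)) /\ (forall x, n (A x) <= n x).

Section contractive_map.
Variables (A : V -> V) (cA : contractive_map A).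

Lemma cmap0 : A 0 ~~ 0.
Proof.
rewrite /eqv subr0; apply/eqP; rewrite eq_le seminorm_ge0 andbT -seminorm0.
by have [_ ->] := cA.
Qed.

Lemma cmapD x y : A (x + y) ~~ (A x + A y).
Proof. by have [/(_ 1 x y) + _] := cA; rewrite !scale1r. Qed.

Lemma cmapZ a x : A (a *: x) ~~ (a *: A x).
Proof.
have [/(_ a x 0) + _] := cA; rewrite addr0 => /eqv_trans; apply.
by rewrite -[X in _ ~~ X]addr0; apply: eqvD; [exact: eqv_refl|exact: cmap0].
Qed.

Lemma cmapB x y : A (x - y) ~~ (A x - A y).
Proof.
apply: (eqv_trans (cmapD _ _)); apply: eqvD; first exact: eqv_refl.
by rewrite -(scaleN1r y) -(scaleN1r (A y)); exact: cmapZ.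
Qed.

Lemma cmap_eqv x y : x ~~ y -> A x ~~ A y.
Proof.
move=> xy; rewrite /eqv -(eqv_seminorm (cmapB x y)); apply/eqP; rewrite eq_le seminorm_ge0 andbT.
by rewrite -[leRHS]xy; have [_ ->] := cA.
Qed.

Lemma cmap_diff z x y r : A (z - x - r *: (x - y)) ~~ (A z - A x - r *: (A x - A y)).
Proof.
apply: (eqv_trans (cmapB _ _)); apply: eqvB; first exact: cmapB.
by apply: (eqv_trans (cmapZ _ _)); apply: eqvZ; exact: cmapB.
Qed.

End contractive_map.

Variables (T U : R -> V -> V) (J : V -> V) (C : R).
Hypothesis cT : forall t, 0 <= t -> contractive_map (T t).
Hypothesis cU : forall t, 0 <= t -> contractive_map (U t).
Hypothesis cJ : contractive_map J.
Hypothesis T0 : forall x, T 0 x ~~ x.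
Hypothesis U0 : forall x, U 0 x ~~ x.
Hypothesis TD : forall t s x, 0 <= t -> 0 <= s -> T (t + s) x ~~ T t (T s x).
Hypothesis UD : forall t s x, 0 <= t -> 0 <= s -> U (t + s) x ~~ U t (U s x).
Hypothesis UJ : forall t x, 0 <= t -> U t (J x) ~~ J (U t x).
Hypothesis T_gen : forall y e, 0 < e -> exists2 r0, 0 < r0 &
  forall r, 0 < r < r0 -> n (T r (J y) - J y - r *: (J y - y)) <= e * r.
Hypothesis U_gen : forall y r, 0 <= r ->
  n (U r (J (J y)) - J (J y) - r *: (J (J y) - J y)) <= C * r ^+ 2 * n y.

Lemma ge0_small_eq0 (a b : R) : 0 <= a -> (forall e, 0 < e -> a <= b * e) -> a = 0.
Proof.
move=> a0 H; apply/eqP; rewrite eq_le a0 andbT leNgt; apply/negP => apos.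
have b0 : 0 < b.
  by have := H 1 ltr01; rewrite mulr1; apply: lt_le_trans.
have := H (a / b / 2) (divr_gt0 (divr_gt0 apos b0) (ltr0Sn _ _)).
rewrite mulrA [b * _]mulrC divfK ?gt_eqF//; lra.
Qed.

(** If J x is null, so is T r (J x) - J x for every r, although its quotient by r approaches J x -
    x; hence J x - x is null too. *)
Lemma resolvent_inj x : n (J x) = 0 -> n x = 0.
Proof.
move=> Jx0; suff Jx : x ~~ J x by rewrite (eqv_seminorm Jx).
apply: eqv_sym; apply: (@ge0_small_eq0 _ 1) => [|e e0]; first exact: seminorm_ge0.
have [r0 r00 H] := T_gen x e0; have r20 : 0 < r0 / 2 by rewrite divr_gt0.
have := H (r0 / 2); rewrite r20 ltr_pdivrMr// ltr_pMr// ltr1n => /(_ isT).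
set r := r0 / 2 in r20 *.
have Tr0 : n (T r (J x) - J x) = 0.
  apply/eqP; rewrite eq_le seminorm_ge0 andbT (le_trans (n_tri _ _))// seminormN Jx0 addr0 -Jx0.
  by have [_ ->] := cT (ltW r20).
have := seminormB_le (r *: (J x - x)) (T r (J x) - J x).
rewrite Tr0 addr0 -[X in _ <= X]seminormN opprB n_hom gtr0_norm// => h1 h2.
by rewrite mul1r -(ler_pM2l r20) [leRHS]mulrC (le_trans h1).
Qed.

(** T s commutes with T r and contracts, so the first-order estimate at J y travels along the orbit
    with the same error. *)
Lemma semigroup_diff_shift s y e r : 0 <= s -> 0 <= r ->
  n (T r (J y) - J y - r *: (J y - y)) <= e * r ->
  n (T r (T s (J y)) - T s (J y) - r *: (T s (J y) - T s y)) <= e * r.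
Proof.
move=> s0 r0 H; apply: le_trans H.
have -> : n (T r (T s (J y)) - T s (J y) - r *: (T s (J y) - T s y)) =
    n (T s (T r (J y) - J y - r *: (J y - y))).
  apply: eqv_seminorm; apply: eqv_sym; apply: (eqv_trans (cmap_diff (cT s0) _ _ _ _)).
  apply: eqvB; last exact: eqv_refl.
  apply: eqvB; last exact: eqv_refl.
  apply: (@eqv_trans (T (s + r) (J y))); first exact/eqv_sym/TD.
  by rewrite addrC; exact: TD.
by have [_ ->] := cT s0.
Qed.

Lemma semigroup_resolventC s y : 0 <= s -> T s (J y) ~~ J (T s y).
Proof.
move=> s0; apply: eqv_sym; set k := T s (J y); set k' := J (T s y).
apply: (@ge0_small_eq0 _ 2) => [|e e0]; first exact: seminorm_ge0.
have [r1 r10 H1] := T_gen y e0; have [r2 r20 H2] := T_gen (T s y) e0.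
pose r := Num.min r1 r2 / 2.
have rm : 0 < Num.min r1 r2 by rewrite lt_min r10.
have r0 : 0 < r by rewrite divr_gt0.
have rlt : r < Num.min r1 r2 by rewrite ltr_pdivrMr// ltr_pMr// ltr1n.
have {}H1 := H1 r; have {}H2 := H2 r; move: rlt; rewrite lt_min => /andP[rr1 rr2].
rewrite r0 rr1 /= in H1; rewrite r0 rr2 /= in H2.
have := semigroup_diff_shift s0 (ltW r0) (H1 isT); rewrite -/k => {}H1.
have {}H2 := H2 isT; rewrite -/k' in H2.
have Hq : n (T r (k' - k) - (k' - k) - r *: (k' - k)) <= 2 * e * r.
  have -> : n (T r (k' - k) - (k' - k) - r *: (k' - k)) =
    n ((T r k' - k' - r *: (k' - T s y)) - (T r k - k - r *: (k - T s y))).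
    apply: eqv_seminorm; apply: (@eqv_trans (T r k' - T r k - (k' - k) - r *: (k' - k))).
      apply: eqvB; last exact: eqv_refl.
      apply: eqvB; last exact: eqv_refl.
      exact: (cmapB (cT (ltW r0))).
    rewrite (_ : r *: (k' - k) = r *: (k' - T s y) - r *: (k - T s y)).
      have ACA (a b c d : V) : a - b - (c - d) = a - c - (b - d).
        by rewrite !opprD !opprK addrACA.
      by rewrite (ACA (T r k')) (ACA (T r k' - k')); exact: eqv_refl.
    by rewrite -scalerBr opprB addrA subrK.
  by rewrite (le_trans (n_tri _ _))// seminormN; lra.
have Tq : n (T r (k' - k)) <= n (k' - k) by have [_ ->] := cT (ltW r0).
(* Growth against contraction: with q = k' - k, (1 + r) n q <= n (T r q) + 2 e r <= n q + 2 e r,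
   whence n q <= 2 e. *)
have := seminormB_le ((1 + r) *: (k' - k)) (T r (k' - k)).
have -> : n ((1 + r) *: (k' - k) - T r (k' - k)) =
    n (T r (k' - k) - (k' - k) - r *: (k' - k)).
  by rewrite -seminormN opprB scalerDl scale1r opprD addrA.
rewrite n_hom gtr0_norm ?addr_gt0// mulrDl mul1r => h.
by rewrite -(ler_pM2l r0); lra.
Qed.

(** Both semigroups have the same first-order term at the orbit point T k (J (J y)). Commutation
    with J rewrites this point as J (J (T k y)), where [U_gen] applies with a bound uniform in k
    since n (T k y) <= n y. *)
Lemma semigroup_diff_step k y e r : 0 <= k -> 0 <= r ->
  n (T r (J (J y)) - J (J y) - r *: (J (J y) - J y)) <= e * r ->
  n (T r (T k (J (J y))) - U r (T k (J (J y)))) <= e * r + `|C| * r ^+ 2 * n y.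
Proof.
move=> k0 r0 /(semigroup_diff_shift k0 r0); set z := T k (J (J y)); set w := r *: _ => H1.
have H2 : n (U r z - z - w) <= `|C| * r ^+ 2 * n y.
  have zJ : z ~~ J (J (T k y)).
    apply: (eqv_trans (semigroup_resolventC _ k0)); apply: (cmap_eqv cJ); exact: semigroup_resolventC.
  have -> : n (U r z - z - w) = n (U r (J (J (T k y))) - J (J (T k y)) -
      r *: (J (J (T k y)) - J (T k y))).
    apply: eqv_seminorm; apply: eqvB.
      by apply: eqvB => //; exact: (cmap_eqv (cU r0)).
    by apply/eqvZ/eqvB => //; exact: semigroup_resolventC.
  apply: (le_trans (U_gen _ r0)).
  apply: (@le_trans _ _ (`|C| * r ^+ 2 * n (T k y))).
    by rewrite ler_wpM2r ?seminorm_ge0// ler_wpM2r ?exprn_ge0// ler_norm.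
  by rewrite ler_wpM2l ?mulr_ge0 ?exprn_ge0//; have [_ ->] := cT k0.
have -> : T r z - U r z = (T r z - z - w) - (U r z - z - w).
  by rewrite -!(addrA _ (- z) (- w)) opprD addrACA subrr addr0.
by rewrite (le_trans (n_tri _ _))// seminormN; lra.
Qed.

Lemma semigroup_eq_J_sq t y : 0 < t -> T t (J (J y)) ~~ U t (J (J y)).
Proof.
move=> t0; apply: (@ge0_small_eq0 _ (t + t)) => [|e e0]; first exact: seminorm_ge0.
have [r0 r00 H] := T_gen (J y) e0.
pose K := `|C| * n y; have K0 : 0 <= K by rewrite mulr_ge0 ?seminorm_ge0.
(* The first term puts the mesh r = t / m below r0, the second makes r K at most e. The m local
   errors e r + K r ^ 2 then add up to t (e + r K) <= 2 t e. *)
pose m := (Num.truncn (t / r0) + Num.truncn (t * K / e)).+1.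
have m0 : 0 < m%:R :> R by rewrite ltr0Sn.
pose r := t / m%:R; have rpos : 0 < r by rewrite divr_gt0.
have mr : m%:R * r = t by rewrite /r mulrCA divff ?mulr1// gt_eqF.
have rr0 : r < r0.
  have tm : t / r0 < m%:R.
    by apply: (lt_le_trans (truncnS_gt _)); rewrite ler_nat /m ltnS leq_addr.
  by rewrite /r ltr_pdivrMr// mulrC -ltr_pdivrMr.
have rK : r * K <= e.
  have tm : t * K / e <= m%:R.
    by apply: (le_trans (ltW (truncnS_gt _))); rewrite ler_nat /m ltnS leq_addl.
  by rewrite /r mulrAC ler_pdivrMr// [leRHS]mulrC -ler_pdivrMr.
have {}H := H r; rewrite rpos rr0 in H; have {}H := H isT.
have step k : n (T (k%:R * r) (J (J y)) - U (k%:R * r) (J (J y))) <=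
    k%:R * (e * r + `|C| * r ^+ 2 * n y).
  elim: k => [|k ih].
    rewrite !mul0r (_ : n _ = 0)//; apply: (eqv_trans (T0 _)); exact/eqv_sym/U0.
  have kr0 : 0 <= k%:R * r by rewrite mulr_ge0// ltW.
  have rge0 := ltW rpos.
  have H' := semigroup_diff_step kr0 rge0 H.
  rewrite -addn1 natrD mulrDl mul1r.
  (* Telescoping: T^(k+1) - U^(k+1) = (T - U) T^k + U (T^k - U^k), where the last U contracts the
     error already made. *)
  have -> : n (T (k%:R * r + r) (J (J y)) - U (k%:R * r + r) (J (J y))) =
    n ((T r (T (k%:R * r) (J (J y))) - U r (T (k%:R * r) (J (J y)))) +
       U r (T (k%:R * r) (J (J y)) - U (k%:R * r) (J (J y)))).
    apply: eqv_seminorm.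
    apply: (@eqv_trans (T r (T (k%:R * r) (J (J y))) - U r (U (k%:R * r) (J (J y))))).
      by apply: eqvB; rewrite addrC; [exact: TD|exact: UD].
    rewrite -[X in X - U r (U _ _)](subrK (U r (T (k%:R * r) (J (J y))))) -addrA.
    apply: eqvD; first exact: eqv_refl.
    exact/eqv_sym/(cmapB (cU rge0)).
  rewrite [leRHS]mulrDl mul1r (le_trans (n_tri _ _))// [leRHS]addrC lerD//.
  by apply: le_trans ih; have [_ ->] := cU rge0.
have := step m; rewrite mr => /le_trans; apply.
rewrite (_ : m%:R * _ = m%:R * r * (e + r * K)); last by rewrite /K; ring.
by rewrite mr; nra.
Qed.

(** Both semigroups commute with J, so J (J (T t y - U t y)) is null; injectivity of J, used twice,
    takes the place of a density argument. *)
Lemma semigroup_eq t y : 0 < t -> T t y ~~ U t y.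
Proof.
move=> t0; apply: resolvent_inj; apply: resolvent_inj.
have h A : contractive_map A -> (forall x, A (J x) ~~ J (A x)) ->
    forall x, A (J (J x)) ~~ J (J (A x)).
  by move=> cA AJ x; apply: (eqv_trans (AJ _)); exact: (cmap_eqv cJ).
have hT := h _ (cT (ltW t0)) (fun x => semigroup_resolventC x (ltW t0)) y.
have hU := h _ (cU (ltW t0)) (fun x => UJ x (ltW t0)) y.
have JB : J (J (T t y - U t y)) ~~ (J (J (T t y)) - J (J (U t y))).
  by apply: (eqv_trans (cmap_eqv cJ (cmapB cJ _ _))); exact: (cmapB cJ).
rewrite (eqv_seminorm JB); apply: (eqv_trans (eqv_sym hT)); apply: (eqv_trans _ hU).
exact: semigroup_eq_J_sq.
Qed.

End semigroup_uniqueness.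

(** * Integrals and countable sums *)

Section esum_countable.
Local Open Scope ereal_scope.
Variable R : realType.

Lemma esum_seq (I : choiceType) (s : seq I) (a : I -> \bar R) : uniq s ->
  (forall i, 0 <= a i) -> (forall i, i \notin s -> a i = 0) ->
  \esum_(i in [set: I]) a i = \sum_(i <- s) a i.
Proof.
move=> us a0 as0; rewrite (fsbig_seq _ _ us) -esum_fset//.
rewrite [RHS]esum_mkcond; apply: eq_esum => i _; case: ifPn => // /negP is'.
by rewrite as0//; apply/negP => si; apply: is'; rewrite inE.
Qed.

Lemma esum_swap (I J : choiceType) (a : I -> J -> \bar R) :
  (forall i j, 0 <= a i j) ->
  \esum_(i in [set: I]) \esum_(j in [set: J]) a i j =
  \esum_(j in [set: J]) \esum_(i in [set: I]) a i j.
Proof.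
move=> a0; rewrite !esum_esum//.
rewrite (reindex_esum ([set: J] `*`` (fun=> [set: I])) _ (fun x => (x.2, x.1)))//.
split=> //=; first by move=> [i1 i2] [j1 j2] /= _ _ [] -> ->.
by move=> [i j] _; exists (j, i).
Qed.

Lemma esum_bij (I J : choiceType) (e : I -> J) (a : J -> \bar R) : bijective e ->
  \esum_(j in [set: J]) a j = \esum_(i in [set: I]) a (e i).
Proof.
move=> [f ef fe]; apply: reindex_esum; split=> //.
- by move=> i j _ _ /(congr1 f); rewrite !ef.
- by move=> j _; exists (f j).
Qed.

Lemma esum_cauchy (a : nat -> nat -> \bar R) : (forall k m, 0 <= a k m) ->
  \esum_(n in [set: nat]) \sum_(k < n.+1) a k (n - k)%N =
  \esum_(k in [set: nat]) \esum_(m in [set: nat]) a k m.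
Proof.
move=> a0; rewrite esum_esum//.
transitivity (\esum_(n in [set: nat]) \esum_(k in [set k | (k <= n)%N]) a k (n - k)%N).
  apply: eq_esum => n _; rewrite -(big_mkord xpredT (fun k => a k (n - k)%N)).
  rewrite (fsbig_seq _ _ (iota_uniq _ _)) -esum_fset//.
  rewrite subn0; congr esum; apply/seteqP.
  by split=> k /=; have /= -> := mem_iota 0 n.+1 k; rewrite add0n ltnS.
rewrite esum_esum => [|n k _ _]; last exact: a0.
rewrite (reindex_esum ([set: nat] `*`` (fun=> [set: nat])) _
  (fun x => ((x.1 + x.2)%N, x.1))) => [|].
  by apply: eq_esum => -[k m] _ /=; rewrite addKn.
split=> //=.
- by move=> [k m] _ /=; split=> //; exact: leq_addr.
- by move=> [k m] [k' m'] _ _ [/[swap] <- /addnI <-].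
- by move=> [n k] [_ /= kn]; exists (k, (n - k)%N) => //=; rewrite subnKC.
Qed.

Variable I : countType.

(** Passing to a series over nat gives access to measurability and monotone convergence; integers
    that code no element contribute 0. *)
Lemma esum_nneseries (a : I -> \bar R) : (forall i, 0 <= a i) ->
  \esum_(i in [set: I]) a i =
  \sum_(k <oo) (if pickle_inv k is Some i then a i else 0).
Proof.
move=> a0; rewrite nneseries_esumT => [|k]; last by case: pickle_inv.
pose c k := if pickle_inv k is Some i then a i else 0.
transitivity (\esum_(k in [set pickle i | i in [set: I]]) c k).
  rewrite esum_image; last by move=> i j _ _; exact: (pcan_inj (@pickleK_inv I)).
  by apply: eq_esum => i _; rewrite /c pickleK_inv.
rewrite esum_mkcond; apply: eq_esum => k _; rewrite /c; case: ifPn => // /negP.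
case E : (pickle_inv k) => [i|] // [].
by rewrite inE; exists i => //; have := @pickle_invK I k; rewrite E.
Qed.

Lemma esumZl (c : \bar R) (a : I -> \bar R) : (forall i, 0 <= a i) -> 0 <= c ->
  \esum_(i in [set: I]) c * a i = c * \esum_(i in [set: I]) a i.
Proof.
move=> a0 c0; rewrite !esum_nneseries// => [|i]; last exact: mule_ge0.
case: c c0 => [c| |] //= c0.
- rewrite -nneseriesZl; last by move=> k _; case: pickle_inv.
  by apply: eq_eseriesr => k _; case: pickle_inv => // ; rewrite mule0.
(* For c = +oo both sides are +oo as soon as one term is nonzero, and 0 otherwise. *)
- have [[i ai]|no] := pselect (exists i, a i != 0); last first.
    rewrite !eseries0 ?mule0// => k _ _; case: pickle_inv => // i.
      by apply: contrapT => /eqP ai; apply: no; exists i.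
    rewrite (_ : a i = 0) ?mule0//.
    by apply: contrapT => /eqP ai; apply: no; exists i.
  have ai0 : 0 < a i by rewrite lt0e ai a0.
  have le1 : +oo <= \sum_(k <oo) (if pickle_inv k is Some i then +oo * a i else 0).
    rewrite -esum_nneseries => [|j]; last exact: mule_ge0.
    apply: esum_ge; exists [set i]; first by split.
    by rewrite fsbig_set1 gt0_mulye.
  rewrite gt0_mulye; first by apply/eqP; rewrite eq_le leey.
  apply: (lt_le_trans ai0); rewrite -esum_nneseries//.
  by apply: esum_ge; exists [set i]; rewrite ?fsbig_set1.
Qed.

Section measure.
Context d (T : measurableType d).

Lemma emeasurable_esum (F : I -> T -> \bar R) :
  (forall i, measurable_fun setT (F i)) -> (forall i x, 0 <= F i x) ->
  measurable_fun setT (fun x => \esum_(i in [set: I]) F i x).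
Proof.
move=> mF F0; under eq_fun do rewrite esum_nneseries//.
apply: ge0_emeasurable_sum => [k x _ _|k _]; first by case: pickle_inv.
by case: (pickle_inv k) => [i|] //; exact: measurable_cst.
Qed.

Lemma ge0_integral_esum (mu : {measure set T -> \bar R}) (F : I -> T -> \bar R) :
  (forall i, measurable_fun setT (F i)) -> (forall i x, 0 <= F i x) ->
  \int[mu]_x (\esum_(i in [set: I]) F i x) = \esum_(i in [set: I]) \int[mu]_x F i x.
Proof.
move=> mF F0; under eq_integral do rewrite esum_nneseries//.
rewrite integral_nneseries//; last 2 first.
- by move=> k; case: (pickle_inv k) => [i|] //; exact: measurable_cst.
- by move=> k x _; case: pickle_inv.
rewrite esum_nneseries => [|i]; last exact: integral_ge0.
by apply: eq_eseriesr => k _; case: pickle_inv => // ; rewrite integral0.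
Qed.

Lemma measure_esum (mu : {measure set T -> \bar R}) (F : I -> set T) :
  (forall i, measurable (F i)) -> (forall i j x, F i x -> F j x -> i = j) ->
  mu (\bigcup_i F i) = \esum_(i in [set: I]) mu (F i).
Proof.
move=> mF dF.
pose G k := if pickle_inv k is Some i then F i else set0.
have -> : \bigcup_i F i = \bigcup_k G k.
  apply/seteqP; split=> x [i _ Fi].
    by exists (pickle i) => //; rewrite /G pickleK_inv.
  by move: Fi; rewrite /G; case: (pickle_inv i) => // j Fj; exists j.
rewrite measure_bigcup//; last 2 first.
- by move=> k _; rewrite /G; case: (pickle_inv k).
- move=> k l _ _ [x []]; rewrite /G.
  have := @pickle_invK I k; have := @pickle_invK I l.
  case: (pickle_inv k) => // i; case: (pickle_inv l) => // j /= <- <- Fi Fj.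
  by rewrite (dF _ _ _ Fi Fj).
rewrite esum_nneseries//; under eq_eseriesl do rewrite in_setT.
by apply: eq_eseriesr => k _; rewrite /G; case: pickle_inv.
Qed.

Lemma integral_discrete (mu : {measure set T -> \bar R}) (X : T -> I) (F : I -> \bar R) :
  (forall i, measurable (X @^-1` [set i])) -> (forall i, 0 <= F i) ->
  \int[mu]_x F (X x) = \esum_(i in [set: I]) F i * mu (X @^-1` [set i]).
Proof.
move=> mX F0.
have FE x : F (X x) = \esum_(i in [set: I]) F i * (\1_(X @^-1` [set i]) x)%:E.
  rewrite (@esum_seq _ [:: X x])//.
  - by rewrite big_seq1 indicE mem_set// mule1.
  - by move=> i; rewrite mule_ge0.
  - move=> i; rewrite inE => /eqP iX; rewrite indicE memNset ?mule0//.
    by move=> /esym.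
under eq_integral do rewrite FE.
have m1 i : measurable_fun setT (fun x => (\1_(X @^-1` [set i]) x)%:E : \bar R).
  by apply/measurable_EFinP; exact: measurable_indic.
rewrite ge0_integral_esum => [|i|i x]; last by rewrite mule_ge0.
  apply: eq_esum => i _; rewrite ge0_integralZl// ?integral_indic ?setIT//.
by apply: emeasurable_funM => //; exact: measurable_cst.
Qed.

End measure.
End esum_countable.

Section integral_extras.
Context dT (T : measurableType dT) (R : realType).
Variable mu : {measure set T -> \bar R}.
Local Open Scope ereal_scope.
Import HBNNSimple.

(* No measurability is required of F: the integral of a nonnegative function is
   a supremum over the simple functions below it. *)
Lemma ge0_integral_ae (F G : T -> \bar R) : (forall x, 0 <= F x) ->
  (forall x, 0 <= G x) -> measurable_fun setT G ->
  {ae mu, forall x, F x = G x} -> \int[mu]_x F x = \int[mu]_x G x.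
Proof.
move=> F0 G0 mG [N [mN N0 FG]].
have FGN x : ~ N x -> F x = G x by move=> /(contra_not (@FG x)) /contrapT.
(* [H] is measurable, has the same integral as G, and lies below F everywhere, since it vanishes on
   the null set where F and G may differ. *)
pose H x := G x * (\1_(~` N) x)%:E.
have mH : measurable_fun setT H.
  apply: emeasurable_funM => //; apply/measurable_EFinP/measurable_indic.
  exact: measurableC.
have H0 x : 0 <= H x by rewrite mule_ge0.
have HG x : ~ N x -> H x = G x by move=> Nx; rewrite /H indicE mem_set// mule1.
have HN x : N x -> H x = 0 by move=> Nx; rewrite /H indicE memNset ?mule0// => /(_ Nx).
have GH : \int[mu]_x G x = \int[mu]_x H x.
  apply: ge0_ae_eq_integral => //; exists N; split=> // x /= GHx.
  by apply: contrapT => Nx; apply: GHx => _; rewrite HG.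
apply/eqP; rewrite eq_le; apply/andP; split.
  rewrite (ge0_integralTE mu F0); apply: ge_ereal_sup => _ [h /= hF <-].
  rewrite -integralT_nnsfun GH; apply: ae_ge0_le_integral => //.
  - by move=> x _; rewrite lee_fin.
  - exact/measurable_EFinP.
  - exists N; split=> // x /= hH; apply: contrapT => Nx; apply: hH => _.
    by rewrite HG// -FGN.
rewrite GH !ge0_integralTE//; apply: ge_ereal_sup => _ [h /= hH <-].
apply: ereal_sup_ubound; exists h => // x; apply: (le_trans (hH x)).
have [Nx|Nx] := pselect (N x); first by rewrite HN.
by rewrite HG// -FGN.
Qed.

Lemma integral_ae (F G : T -> \bar R) : measurable_fun setT G ->
  {ae mu, forall x, F x = G x} -> \int[mu]_x F x = \int[mu]_x G x.
Proof.
move=> mG FG; rewrite integralE [RHS]integralE; congr (_ - _).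
  apply: ge0_integral_ae => //; first exact: measurable_funepos.
  by apply: filterS FG => x; rewrite !funeposE => ->.
apply: ge0_integral_ae => //; first exact: measurable_funeneg.
by apply: filterS FG => x; rewrite !funenegE => ->.
Qed.

Lemma Rintegral_ae (f g : T -> R) : measurable_fun setT g ->
  {ae mu, forall x, f x = g x} -> (\int[mu]_x f x = \int[mu]_x g x)%R.
Proof.
move=> mg fg; congr fine; apply: integral_ae; first exact/measurable_EFinP.
by apply: filterS fg => x ->.
Qed.

Definition sqint (f : T -> R) : \bar R := \int[mu]_x (f x ^+ 2)%:E.

Lemma sqint_ae (f g : T -> R) : measurable_fun setT g ->
  {ae mu, forall x, f x = g x} -> sqint f = sqint g.
Proof.
move=> mg fg; apply: integral_ae.
  by apply/measurable_EFinP; exact: measurable_funX.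
by apply: filterS fg => x ->.
Qed.

Lemma Lfun2P (f : T -> R) : f \in Lfun mu 2%:E <->
  measurable_fun setT f /\ sqint f < +oo.
Proof.
have sqE : sqint f = \int[mu]_x (`|(f x)%:E| `^ 2).
  apply: eq_integral => x _; congr EFin.
  by rewrite -[LHS]real_normK ?num_real// -powR_mulrn.
split=> [fL|[mf fi]].
  have := Lfun2_integrable_sqr fL; move: fL; rewrite inE => /andP[/[!inE] mf _].
  move=> /integrableP[_] fi; split=> //; apply: le_lt_trans fi.
  rewrite le_eqVlt; apply/orP; left; apply/eqP; apply: eq_integral => x _.
  by rewrite /= ger0_norm ?sqr_ge0.
rewrite inE; apply/andP; split; rewrite inE//= /finite_norm unlock.
by rewrite poweR_lty// -sqE.
Qed.

End integral_extras.

(** * Square integrable functions as a seminormed space *)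

Section L2_space.
Context dT (T : measurableType dT) (R : realType) (P : probability T R).
Local Notation L2 := (Lfun P 2%:E).

Let le12 : (1 <= 2%:E :> \bar R)%E. Proof. by rewrite lee_fin ler1n. Qed.

Definition L2type := LfunType P le12.
HB.instance Definition _ := GRing.Lmodule.on L2type.
Implicit Types (x y : L2type) (f g : T -> R).

Definition L2fun (x : L2type) : T -> R := x.
(** Functions outside L^2(P) are sent to 0; this makes operators on functions into total maps of the
    module. *)
Definition L2of f : L2type := insubd (0 : LfunType P le12) f.

Lemma L2ofK f : f \in L2 -> L2fun (L2of f) = f.
Proof. exact: insubdK. Qed.

Lemma L2funP x : L2fun x \in L2.
Proof. exact: LfunP. Qed.

Definition L2norm x : R := fine ('N[P]_2%:E [EFin \o L2fun x])%E.

Lemma L2norm_tri x y : L2norm (x + y) <= L2norm x + L2norm y.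
Proof. exact: (@ler_LnormD _ _ _ P _ le12). Qed.

Lemma L2norm_hom (a : R) x : L2norm (a *: x) = `|a| * L2norm x.
Proof.
apply: EFin_inj; rewrite EFinM /L2norm !(@finite_norm_fine _ _ _ P _ le12).
exact: (@LnormZ _ _ _ P _ le12).
Qed.

Lemma L2norm_ge0 x : 0 <= L2norm x.
Proof. by apply: fine_ge0; exact: Lnorm_ge0. Qed.

Lemma L2norm_sq x : ((L2norm x ^+ 2)%:E = sqint P (L2fun x))%E.
Proof.
have e : ('N[P]_2%:E [EFin \o L2fun x])%E = (L2norm x)%:E.
  by rewrite /L2norm (@finite_norm_fine _ _ _ P _ le12).
have := @poweR_Lnorm _ _ _ P (EFin \o L2fun x) 2 (lt0r_neq0 (ltr0Sn _ _)).
rewrite e poweR_EFin powR_mulrn ?L2norm_ge0// => ->.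
apply: eq_integral => w _; congr EFin.
by rewrite powR_mulrn// real_normK ?num_real.
Qed.

Lemma L2norm_le c x y : 0 <= c ->
  (sqint P (L2fun x) <= (c ^+ 2)%:E * sqint P (L2fun y))%E ->
  L2norm x <= c * L2norm y.
Proof.
move=> c0; rewrite -!L2norm_sq -EFinM lee_fin -exprMn => h.
by rewrite -(@ler_pXn2r _ 2)// nnegrE ?mulr_ge0 ?L2norm_ge0.
Qed.

Lemma L2norm_ae x y : {ae P, forall w, L2fun x w = L2fun y w} -> L2norm (x - y) = 0.
Proof.
move=> xy; have : L2norm (x - y) ^+ 2 = 0.
  apply: EFin_inj; rewrite L2norm_sq.
  rewrite (@sqint_ae _ _ _ _ _ (cst 0)).
  - by apply: integral0_eq => w _; rewrite expr0n.
  - exact: measurable_cst.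
  - apply: filterS xy => w xyw; rewrite -[LHS]/(L2fun x w - L2fun y w).
    by rewrite xyw subrr.
by move=> /eqP; rewrite expf_eq0 /= => /eqP.
Qed.

Lemma L2norm_eq0 x y : L2norm (x - y) = 0 ->
  {ae P, forall w, L2fun x w = L2fun y w}.
Proof.
move=> /fine_Lnormr_eq0; apply: filterS => w /(_ I) /eqP.
by rewrite -[X in X == _]/(L2fun x w - L2fun y w) subr_eq0 => /eqP.
Qed.

Definition L2ip f g : R := \int[P]_w (f w * g w).

Lemma L2_measurable f : f \in L2 -> measurable_fun setT f.
Proof. by move=> /Lfun2P[]. Qed.

Lemma L2ip_ae f f' g : f' \in L2 -> g \in L2 -> f = f' %[ae P] ->
  L2ip f g = L2ip f' g.
Proof.
move=> fL gL ff; apply: Rintegral_ae.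
  by apply: measurable_funM; exact: L2_measurable.
by apply: filterS ff => w /(_ I) ->.
Qed.

Lemma L2ip_integrable f g : f \in L2 -> g \in L2 ->
  P.-integrable setT (EFin \o (fun w => f w * g w)).
Proof. by move=> fL gL; apply/Lfun1_integrable; exact: Lfun2_mul_Lfun1. Qed.

Lemma L2ip_linear a f f' g : f \in L2 -> f' \in L2 -> g \in L2 ->
  L2ip (fun w => a * f w + f' w) g = a * L2ip f g + L2ip f' g.
Proof.
move=> fL fL' gL; rewrite /L2ip -RintegralZl//; last exact: L2ip_integrable.
rewrite -RintegralD//; last exact: L2ip_integrable.
  by apply: eq_Rintegral => w _; rewrite mulrDl mulrA.
have := integrableZl measurableT a (L2ip_integrable fL gL).
by congr integrable.
Qed.

Lemma L2ip_sq x : L2ip (L2fun x) (L2fun x) = L2norm x ^+ 2.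
Proof. by rewrite /L2ip /Rintegral -[RHS]/(fine (_)%:E) L2norm_sq. Qed.

End L2_space.

(** * Bounded continuous multipliers *)

Section bounded_continuous.
Variable R : realType.
Implicit Types (psi phi : R -> R) (l t : R).

Lemma bc_lincomb (a : R) psi phi :
  bounded_continuous psi -> bounded_continuous phi ->
  bounded_continuous (fun l => a * psi l + phi l).
Proof.
move=> [cp [M pM]] [cq [N qN]]; split.
  move=> x; apply: cvgD; last exact: cq.
  by apply: cvgM; [exact: cvg_cst|exact: cp].
exists (`|a| * M + N) => l l0; rewrite (le_trans (ler_normD _ _))//.
by rewrite lerD ?qN// normrM ler_wpM2l// pM.
Qed.

Lemma bc_mul psi phi :
  bounded_continuous psi -> bounded_continuous phi ->
  bounded_continuous (fun l => psi l * phi l).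
Proof.
move=> [cp [M pM]] [cq [N qN]]; split.
  by move=> x; apply: cvgM; [exact: cp|exact: cq].
by exists (M * N) => l l0; rewrite normrM ler_pM ?pM ?qN.
Qed.

Lemma bc_cst (a : R) : bounded_continuous (fun=> a : R).
Proof. by split; [exact: cst_continuous|exists `|a|]. Qed.

Lemma bc_exp t : 0 <= t -> bounded_continuous (fun l : R => expR (- (t * l))).
Proof.
move=> t0; split; last first.
  exists 1 => l l0; rewrite ger0_norm ?expR_ge0// expR_le1 oppr_le0.
  exact: mulr_ge0.
apply: continuous_subspaceT => l.
apply: (@continuous_comp _ _ _ (fun l : R => - (t * l)) expR).
  by apply: cvgN; apply: cvgM; [exact: cvg_cst|exact: cvg_id].
exact: continuous_expR.
Qed.

Lemma bc_inv : bounded_continuous (fun l : R => (1 + l)^-1).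
Proof.
split; last first.
  exists 1 => l l0; rewrite ger0_norm ?invr_ge0 ?addr_ge0// invf_le1 ?ltr_wpDr//.
  by rewrite lerDl.
apply: continuous_in_subspaceT => l; rewrite inE/= in_itv/= andbT => l0.
apply: continuousV; first by rewrite gt_eqF// ltr_wpDr.
by apply: cvgD; [exact: cvg_cst|exact: cvg_id].
Qed.

Lemma bc_sqrt psi : bounded_continuous psi ->
  bounded_continuous (fun l => Num.sqrt (psi l)).
Proof.
move=> [cp [M pM]]; split.
  move=> x; apply: (@continuous_comp _ _ _ (psi : subspace _ -> R) Num.sqrt x).
    exact: cp.
  exact: sqrt_continuous.
exists (Num.sqrt M) => l l0; rewrite ger0_norm ?sqrtr_ge0// ler_sqrt.
  by apply: le_trans (pM _ l0); exact: ler_norm.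
by apply: le_trans (pM _ l0).
Qed.

(** From (1 + x) exp(- x) <= 1 comes exp(- x) - 1 + x <= x (1 - exp(- x)), and 1 - exp(- x) <= x. *)
Lemma expRN_taylor (x : R) : 0 <= x -> 0 <= expR (- x) - 1 + x <= x ^+ 2.
Proof.
move=> x0; have h1 := expR_ge1Dx (- x); have h2 := expR_ge1Dx x.
rewrite expRN in h1 *; set E := expR x in h1 h2 *.
have E0 : 0 < E by exact: expR_gt0.
have EV : E * E^-1 = 1 by rewrite divff// gt_eqF.
have V0 : 0 < E^-1 by rewrite invr_gt0.
apply/andP; split; first lra.
have : (1 + x) * E^-1 <= 1 by rewrite -[leRHS]EV ler_wpM2r// ltW.
have := mulr_ge0 x0 (_ : 0 <= E^-1 - (1 - x)); nra.
Qed.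

End bounded_continuous.

(** * Laplace transform and mass near the origin *)

Lemma powRV (R : realType) (x a : R) : 0 < x -> x^-1 `^ a = (x `^ a)^-1.
Proof. by move=> x0; rewrite -powR_inv1 ?ltW// -powRrM mulN1r powRN. Qed.

(** Raise x / a <= exp(x / a) to the power a. *)
Lemma powR_le_expR (R : realType) (a x : R) : 0 < a -> 0 <= x ->
  x `^ a <= a `^ a * expR x.
Proof.
move=> a0 x0; have xa0 : 0 <= x / a by rewrite divr_ge0// ltW.
rewrite -{1}[x](divfK (lt0r_neq0 a0)) mulrC powRM ?(ltW a0)//.
rewrite ler_wpM2l ?powR_ge0// -{2}[x](divfK (lt0r_neq0 a0)) expRM.
apply: ge0_ler_powR; rewrite ?nnegrE ?expR_ge0 ?(ltW a0)//.
by have := expR_ge1Dx (x / a); lra.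
Qed.

Section spectral_shells.
Context dT (T : measurableType dT) (R : realType).
Local Open Scope ereal_scope.
Import HBNNSimple.

(** A simple function below F is below G, so monotonicity holds without any measurability; it
    applies directly to integrands such as 1 / l with its value +oo at 0. *)
Lemma ge0_le_lower_integral (mu : {measure set T -> \bar R}) (D : set T) (F G : T -> \bar R) :
  (forall x, D x -> 0 <= F x) -> (forall x, D x -> F x <= G x) ->
  \int[mu]_(x in D) F x <= \int[mu]_(x in D) G x.
Proof.
move=> F0 FG; rewrite !ge0_integralE//; last first.
  by move=> x Dx; exact: le_trans (F0 _ Dx) (FG _ Dx).
apply: ge_ereal_sup => _ [h /= hF <-]; apply: ereal_sup_ubound; exists h => // x /=.
apply: (le_trans (hF x)); rewrite !patchE; case: ifPn => // /[!inE] Dx.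
exact: FG.
Qed.

Lemma nneseries_geometric_le (u : nat -> \bar R) (M r : R) : (0 <= M)%R ->
  (0 <= r < 1)%R -> (forall k, 0 <= u k <= (M * r ^+ k)%:E) ->
  \sum_(k <oo) u k <= (M / (1 - r))%:E.
Proof.
move=> M0 /andP[r0 r1] uM; have r10 : (0 < 1 - r)%R by rewrite subr_gt0.
have part n : (\sum_(0 <= k < n) M * r ^+ k = M / (1 - r) * (1 - r ^+ n))%R.
  elim: n => [|n ih]; first by rewrite big_geq// expr0 subrr mulr0.
  rewrite big_nat_recr//= ih exprS; field; lra.
apply: lime_le; first by apply: is_cvg_nneseries => k _; have /andP[] := uM k.
apply: nearW => n; apply: (@le_trans _ _ (\sum_(0 <= k < n) (M * r ^+ k)%:E)).
  by apply: lee_sum => k _; have /andP[] := uM k.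
rewrite sumEFin lee_fin part ler_piMr ?divr_ge0 ?(ltW r10)//.
by rewrite lerBlDr lerDl exprn_ge0.
Qed.

End spectral_shells.

Section tauberian.
Variables (R : realType) (e : {measure set (measurableTypeR R) -> \bar R}).
Implicit Types (t l delta : R).
Local Open Scope ereal_scope.

(** Both passages from masses of intervals [0, a] to integrals have this form: dominate the
    integrand by weighted indicators whose weighted masses decay geometrically. *)
Lemma integral_le_shells (D : set R) (F : R -> \bar R) (c a b : nat -> R) (M r : R) :
  measurable (D : set (measurableTypeR R)) ->
  (forall l, D l -> 0 <= F l) -> (forall k, 0 <= c k)%R ->
  (forall l, D l -> F l <= \sum_(k <oo) (c k * \1_(`[0%R, a k]%classic) l)%:E) ->
  (forall k, e `[0%R, a k]%classic <= (b k)%:E) ->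
  (0 <= M)%R -> (0 <= r < 1)%R -> (forall k, c k * b k <= M * r ^+ k)%R ->
  \int[e]_(l in D) F l <= (M / (1 - r))%:E.
Proof.
move=> mD F0 c0 Fle eb M0 r01 cb.
apply: (le_trans (ge0_le_lower_integral e F0 Fle)).
have m1 k : measurable_fun D (fun l => (c k * \1_(`[0%R, a k]%classic) l)%:E).
  apply/measurable_EFinP; apply: measurable_funM; first exact: measurable_cst.
  apply: measurable_funTS; exact: measurable_indic.
rewrite integral_nneseries//; last first.
  by move=> k l _; rewrite lee_fin mulr_ge0.
apply: nneseries_geometric_le => // k; apply/andP; split.
  by apply: integral_ge0 => l _; rewrite lee_fin mulr_ge0.
under eq_integral do rewrite EFinM.
rewrite ge0_integralZl//; last 2 first.
- by apply/measurable_EFinP; apply: measurable_funTS; exact: measurable_indic.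
- by rewrite lee_fin.
rewrite integral_indic//.
apply: (@le_trans _ _ ((c k)%:E * (b k)%:E)); last by rewrite -EFinM lee_fin.
rewrite lee_wpmul2l ?lee_fin//; apply: le_trans (eb k).
by apply: le_measure; rewrite ?inE//; exact: measurableI.
Qed.

Lemma shell_le (F : \bar R) (c a : nat -> R) k l : (forall k, 0 <= c k)%R ->
  (0 <= l <= a k)%R -> F <= (c k)%:E ->
  F <= \sum_(k <oo) (c k * \1_(`[0%R, a k]%classic) l)%:E.
Proof.
move=> c0 lk Fc; apply: (le_trans Fc).
have u0 j : 0 <= (c j * \1_(`[0%R, a j]%classic) l)%:E by rewrite lee_fin mulr_ge0.
apply: (@le_trans _ _ (c k * \1_(`[0%R, a k]%classic) l)%:E).
  by rewrite indicE mem_set ?mulr1//= in_itv.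
rewrite nneseries_esumT//; apply: esum_ge; exists [set k]; first by split.
by rewrite fsbig_set1.
Qed.

(** Markov's inequality: 1 / l >= 1 / delta on [0, delta]. *)
Lemma ball_mass_of_integral (C alpha : R) :
  (forall delta, (0 < delta)%R -> \int[e]_(l in `[0%R, delta]) (l%:E)^-1
     <= (C * delta `^ (alpha - 1))%:E) ->
  forall delta, (0 < delta)%R -> e `[0%R, delta]%classic <= (C * delta `^ alpha)%:E.
Proof.
move=> H delta d0.
have le1 : (delta^-1)%:E * e `[0%R, delta]%classic <= (C * delta `^ (alpha - 1))%:E.
  apply: le_trans (H _ d0); rewrite -integral_cst//.
  apply: ge0_le_lower_integral => l /=; rewrite in_itv/= => /andP[l0 ld].
    by rewrite lee_fin invr_ge0 ltW.
  rewrite inver; case: eqP => [_|/eqP ln0]; first by rewrite leey.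
  by rewrite lee_fin lef_pV2// posrE// lt_neqAle eq_sym ln0.
have : delta%:E * ((delta^-1)%:E * e `[0%R, delta]%classic) <=
    delta%:E * (C * delta `^ (alpha - 1))%:E.
  by rewrite lee_wpmul2l// lee_fin ltW.
rewrite muleA -!EFinM divff ?gt_eqF// mul1e => /le_trans; apply; rewrite lee_fin.
rewrite mulrCA -{1}(powRr1 (ltW d0)) -powRD ?(gt_eqF d0) ?implybT//.
by rewrite addrC subrK.
Qed.

(** At t = 1 / delta the integrand exp(- 2 t l) is at least exp(- 2) on [0, delta]. *)
Lemma ball_mass_of_laplace (C alpha : R) : (0 < C)%R ->
  (forall t, (0 < t)%R ->
    \int[e]_(l in `[0%R, +oo[) (expR (- (t * l)) * expR (- (t * l)))%:E
      <= (C / t `^ alpha)%:E) ->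
  forall delta, (0 < delta)%R ->
    e `[0%R, delta]%classic <= (expR 2 * C * delta `^ alpha)%:E.
Proof.
move=> C0 H delta d0; have t0 : (0 < delta^-1)%R by rewrite invr_gt0.
have le1 : (expR (- 2))%:E * e `[0%R, delta]%classic <= (C / delta^-1 `^ alpha)%:E.
  apply: le_trans (H _ t0); rewrite -integral_cst//.
  rewrite integral_mkcond [leRHS]integral_mkcond.
  apply: ge0_le_lower_integral => l _; rewrite !patchE.
    by case: ifPn => // _; rewrite lee_fin expR_ge0.
  case: ifPn => [|_]; last by case: ifPn => // _; rewrite lee_fin mulr_ge0 ?expR_ge0.
  rewrite inE/= in_itv/= => /andP[l0 ld]; rewrite mem_set/= ?in_itv/= ?l0//.
  rewrite lee_fin -expRD ler_expR -opprD lerN2 -[2%R]/(1 + 1)%R.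
  have dl : (delta^-1 * l <= 1)%R by rewrite mulrC ler_pdivrMr// mul1r.
  by rewrite lerD.
have : (expR 2)%:E * ((expR (- 2))%:E * e `[0%R, delta]%classic) <=
    (expR 2)%:E * (C / delta^-1 `^ alpha)%:E.
  by rewrite lee_wpmul2l// lee_fin expR_ge0.
rewrite muleA -!EFinM -expRD subrr expR0 mul1e => /le_trans; apply; rewrite lee_fin.
by rewrite mulrA powRV// invrK.
Qed.

(* Since [(0%:E)^-1 = +oo], the point 0 is covered by the divergence at 0 of the
   series over the dyadic shells. *)
Lemma integral_of_ball_mass (K alpha : R) : (1 < alpha)%R -> (0 <= K)%R ->
  (forall delta, (0 < delta)%R -> e `[0%R, delta]%classic <= (K * delta `^ alpha)%:E) ->
  forall delta, (0 < delta)%R -> \int[e]_(l in `[0%R, delta]) (l%:E)^-1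
    <= (2 * K * delta `^ (alpha - 1) / (1 - (2 `^ (alpha - 1))^-1))%:E.
Proof.
move=> a1 K0 H delta d0; set s : R := (2 `^ (alpha - 1))%R.
have a0 : (0 < alpha)%R by exact: lt_trans a1.
have s1 : (1 < s)%R.
  have := @gt0_ltr_powR R (alpha - 1)%R _ 1%R 2%R; rewrite powR1; apply.
  - by rewrite subr_gt0.
  - by rewrite nnegrE.
  - by rewrite nnegrE.
  - by rewrite ltr1n.
have s0 : (0 < s)%R by exact: lt_trans s1.
have p2 k : (0 < 2 ^+ k :> R)%R by rewrite exprn_gt0.
have k2 k : (k%:R < 2 ^+ k :> R)%R by rewrite -natrX ltr_nat ltn_expl.
have ex (A : R) : exists k, (A < 2 ^+ k)%R.
  by exists (Num.truncn A).+1; exact: lt_trans (truncnS_gt A) (k2 _).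
(* For delta / 2^(k+1) < l <= delta / 2^k, the weight [c k] is an upper bound of 1 / l. *)
pose c k : R := (2 ^+ k.+1 / delta)%R; pose a k : R := (delta / 2 ^+ k)%R.
have c0 k : (0 <= c k)%R by rewrite divr_ge0 ?exprn_ge0// ltW.
apply: (integral_le_shells (c := c) (a := a) (b := fun k => K * a k `^ alpha)%R).
- exact: measurable_itv.
- by move=> l /=; rewrite in_itv/= => /andP[l0 _]; rewrite inver; case: ifP => // _;
  rewrite lee_fin invr_ge0.
- exact: c0.
- move=> l /=; rewrite in_itv/= => /andP[l0 ld].
  have [->|ln0] := eqVneq l 0%R.
    rewrite inver eqxx leye_eq; apply/eqP/eqyP => A A0.
    have [k Ak] := ex (A * delta)%R; apply: (@le_trans _ _ (c k)%:E).
      rewrite lee_fin ler_pdivlMr// (le_trans (ltW Ak))// exprS.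
      by rewrite ler_peMl ?ler1n// ltW.
    by apply: (@shell_le _ _ _ k) => //; rewrite lexx divr_ge0 ?ltW.
  have lpos : (0 < l)%R by rewrite lt_neqAle eq_sym ln0.
  have exk : exists k, (delta / 2 ^+ k.+1 < l)%R.
    have [k dk] := ex (delta / l)%R; exists k; rewrite ltr_pdivrMr//.
    rewrite mulrC -ltr_pdivrMr//; apply: (lt_le_trans dk).
    by rewrite exprS ler_peMl ?ler1n// ltW.
  (* Minimality of k provides the upper bound l <= delta / 2^k; for k = 0 it is the assumption l <=
     delta. *)
  have [k kl kmin] := ex_minnP exk.
  apply: (@shell_le _ _ _ k) => //.
    rewrite l0 /=; case: k kl kmin => [|k] kl kmin; first by rewrite /a expr0 divr1.
    by rewrite leNgt; apply/negP => /kmin; rewrite ltnn.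
  rewrite inver (negPf ln0) lee_fin /c -[leRHS]invrK lef_pV2 ?posrE//.
    by rewrite invf_div ltW.
  by rewrite invr_gt0 divr_gt0.
- by move=> k; apply: H; rewrite divr_gt0.
- by rewrite !mulr_ge0// powR_ge0.
- by rewrite invr_ge0 (ltW s0)/= invf_lt1.
(* The product of weight and mass is exactly 2 K delta^(alpha - 1) s^(- k); the ratio 1 / s is below
   1 because alpha > 1. *)
- move=> k; rewrite le_eqVlt; apply/orP; left; apply/eqP.
  rewrite /c /a powRM ?invr_ge0 ?(ltW d0) ?(ltW (p2 k))// powRV//.
  have -> : ((2 ^+ k) `^ alpha = (2 `^ alpha) ^+ k :> R)%R.
    by rewrite -powR_mulrn// powRAC powR_mulrn ?powR_ge0.
  rewrite -(mulr_powRB1 (ltW d0) a0) -(mulr_powRB1 (ler0n _ 2) a0) -/s.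
  rewrite exprMn exprS exprVn; field.
  by rewrite !gt_eqF ?exprn_gt0.
Qed.

Lemma laplace_of_ball_mass (K alpha : R) : (0 < alpha)%R -> (0 <= K)%R ->
  (forall delta, (0 < delta)%R -> e `[0%R, delta]%classic <= (K * delta `^ alpha)%:E) ->
  forall t, (0 < t)%R ->
    \int[e]_(l in `[0%R, +oo[) (expR (- (t * l)) * expR (- (t * l)))%:E
      <= (K * alpha `^ alpha * expR 1 / t `^ alpha / (1 - expR (- 1)))%:E.
Proof.
move=> a0 K0 H t t0.
pose c k : R := expR (- (2 * k%:R))%R; pose a k : R := (k.+1%:R / t)%R.
apply: (integral_le_shells (c := c) (a := a) (b := fun k => K * a k `^ alpha)%R).
- exact: measurable_itv.
- by move=> l _; rewrite lee_fin mulr_ge0 ?expR_ge0.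
- by move=> k; exact: expR_ge0.
- move=> l /=; rewrite in_itv/= andbT => l0.
  have tl0 : (0 <= t * l)%R by rewrite mulr_ge0// ltW.
  (* With k the integer part of t l, k <= t l < k + 1: l lies in [0, (k + 1) / t] and exp(- 2 t l)
     <= exp(- 2 k). *)
  apply: (@shell_le _ _ _ (Num.truncn (t * l))) => [k||]; first exact: expR_ge0.
    by rewrite l0 /a ler_pdivlMr// mulrC ltW// truncnS_gt.
  have : ((Num.truncn (t * l))%:R <= t * l)%R by rewrite truncn_le.
  rewrite lee_fin /c -expRD ler_expR; lra.
- by move=> k; apply: H; rewrite divr_gt0.
- by rewrite !mulr_ge0 ?expR_ge0 ?powR_ge0 ?invr_ge0 ?powR_ge0.
- by rewrite expR_ge0 /= expR_lt1 oppr_lt0 ltr01.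
- move=> k; rewrite /c /a powRM ?invr_ge0 ?(ltW t0)// powRV//.
  (* The mass contributes (k + 1)^alpha <= alpha^alpha exp(k + 1); half of the decay exp(- 2 k)
     absorbs it and leaves the ratio exp(- 1). *)
  have := powR_le_expR a0 (ler0n R k.+1) => h.
  have -> : (K * alpha `^ alpha * expR 1 / t `^ alpha * expR (- 1) ^+ k =
    expR (- (2 * k%:R)) * (K * (alpha `^ alpha * expR k.+1%:R / t `^ alpha)))%R.
    rewrite -expRM_natl mulrN1 -[k.+1%:R]natr1 expRD.
    have -> : (- (2 * k%:R) = - k%:R + - k%:R :> R)%R by ring.
    rewrite expRD; have ek : (expR (- k%:R) * expR k%:R = 1 :> R)%R.
      by rewrite -expRD addNr expR0.
    rewrite (_ : (_ * _ * (K * _) = (expR (- k%:R) * expR k%:R) *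
      (K * alpha `^ alpha * expR 1 / t `^ alpha * expR (- k%:R)))%R); last by ring.
    by rewrite ek mul1r.
  apply: ler_wpM2l; first exact: expR_ge0.
  apply: ler_wpM2l => //; apply: ler_wpM2r h.
  by rewrite invr_ge0 powR_ge0.
Qed.

End tauberian.

(** * The environment and the random walk *)

Section lattice.
Variable d : nat.
Implicit Types x y z a : Zd d.

(** A unit vector has its coordinates in {-1, 0, 1}; filtering this finite cube lists the neighbours
    of 0 explicitly, so that sums over neighbours become sums over sequences. *)
Definition unit_steps : seq (Zd d) :=
  undup [seq z <- [seq \row_i ((f i : nat)%:Z - 1) | f : {ffun 'I_d -> 'I_3}] |
    nbr 0 z].

Definition nbrs x : seq (Zd d) := [seq x + z | z <- unit_steps].

Lemma mem_unit_steps z : (z \in unit_steps) = nbr 0 z.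
Proof.
rewrite mem_undup mem_filter; case: (boolP (nbr 0 z)) => //= z1.
have z2 i : z 0 i ^+ 2 <= 1.
  move: z1 => /eqP <-; rewrite (bigD1 i)//= mxE sub0r sqrrN lerDl.
  by apply: sumr_ge0 => j _; exact: sqr_ge0.
have zle i : (-1 <= z 0 i <= 1).
  by rewrite -ler_norml -(@expr_le1 _ 2)// real_normK ?num_real.
have z3 i : (`|(z 0 i + 1)%R| < 3)%N by have := zle i; lia.
apply/mapP; exists [ffun i => Ordinal (z3 i)]; first by rewrite mem_enum.
apply/rowP => i; rewrite !mxE ffunE /=.
by have := zle i; lia.
Qed.

Lemma mem_nbrs x y : (y \in nbrs x) = nbr x y.
Proof.
rewrite -{2}(subrK x y) addrC -{2}(addr0 x) nbrD2l -mem_unit_steps.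
apply/mapP/idP => [[z zs ->]|yx]; first by rewrite addrAC subrr add0r.
by exists (y - x) => //; rewrite addrC subrK.
Qed.

Lemma nbrs_uniq x : uniq (nbrs x).
Proof. by rewrite map_inj_uniq ?undup_uniq//; exact: addrI. Qed.

Lemma nbrs_sym x y : (y \in nbrs x) = (x \in nbrs y).
Proof. by rewrite !mem_nbrs nbrC. Qed.

Lemma nbrsD a x : nbrs (a + x) = [seq a + y | y <- nbrs x].
Proof. by rewrite /nbrs -map_comp; apply: eq_map => z /=; rewrite addrA. Qed.

End lattice.


Local Notation eshift := Defs.shift.

Section environment.
Variables (R : realType) (d : nat).
Implicit Types (w : env R d) (x y z a : Zd d) (n m : nat) (t s : R).

Lemma exit_rateE w x : exit_rate w x = \sum_(y <- nbrs x) w x y.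
Proof.
rewrite /exit_rate (_ : [set y | nbr x y] = [set` nbrs x]).
  by rewrite -fsbig_seq ?nbrs_uniq.
by apply/seteqP; split => y /=; rewrite mem_nbrs.
Qed.

Lemma exit_rate_gt0 w x : (0 < d)%N -> 0 < exit_rate w x.
Proof.
move=> d0; pose i0 := Ordinal d0; pose y := x + delta_mx 0 i0.
have xy : nbr x y.
  rewrite -{1}[x]addr0 nbrD2l /nbr (bigD1 i0)//= big1 => [|i ii0].
    by rewrite !mxE !eqxx.
  by rewrite !mxE (negPf ii0) andbF subrr expr0n.
rewrite exit_rateE (bigD1_seq y) ?nbrs_uniq ?mem_nbrs//=.
rewrite ltr_pwDl ?rate_gt0// big_seq_cond sumr_ge0// => z /andP[].
by rewrite mem_nbrs => xz _; exact/ltW/rate_gt0.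
Qed.

Lemma exit_rate_shift w a x : exit_rate (eshift a w) x = exit_rate w (a + x).
Proof. by rewrite !exit_rateE nbrsD [RHS]big_map. Qed.

Lemma eq_env w w' : rate w =2 rate w' -> w = w'.
Proof.
case: w w' => [r rC r0 rE] [r' rC' r0' rE'] /= rr.
have {}rr : r = r' by apply/funext => u; apply/funext => v; exact: rr.
by subst r'; congr Env; exact: Prop_irrelevance.
Qed.

Lemma shift_comp w a b : eshift a (eshift b w) = eshift (b + a) w.
Proof. by apply: eq_env => x y; rewrite /= !addrA. Qed.

Lemma env_shift0 w : eshift 0 w = w.
Proof. by apply: eq_env => x y; rewrite /= !add0r. Qed.

(** Intended as the probability of n jumps by time t ending at y, which [pr_njump] confirms; the
    analytic definition gives symmetry and the composition rule directly. *)
Definition njump w := @jkernel R (Zd d) (@nbrs d) w (exit_rate w).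

Lemma njump_sym w n t x y : njump w n t x y = njump w n t y x.
Proof.
by apply: jkernel_sym; [exact: nbrs_uniq|exact: nbrs_sym|exact: rateC].
Qed.

Lemma njump_shift w a n t x y :
  njump (eshift a w) n t x y = njump w n t (a + x) (a + y).
Proof.
congr egf; apply/funext => m.
elim: m n x => [|m ih] [|n] x //; rewrite ?jcoef0.
- by rewrite /expb !expr0 /dirac_fun (inj_eq (addrI a)).
- by rewrite /expb /dirac_fun (inj_eq (addrI a)) exit_rate_shift.
rewrite !jcoefSS ih exit_rate_shift nbrsD; congr (_ + _); rewrite [RHS]big_map.
by apply: eq_bigr => z _; rewrite ih.
Qed.

Lemma measurable_rate x y : measurable_fun [set: Omega R d] (fun w => rate w x y).
Proof.
move=> _ B mB; rewrite setTI; apply: sub_sigma_algebra.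
by exists x, y, B; split.
Qed.

Lemma measurable_exit_rate x :
  measurable_fun [set: Omega R d] (fun w => exit_rate w x).
Proof.
under eq_fun do rewrite exit_rateE.
by apply: measurable_sum => y; exact: measurable_rate.
Qed.

Lemma measurable_shift a :
  measurable_fun [set: Omega R d] (eshift a : Omega R d -> Omega R d).
Proof.
have ms := @measurability _ _ (Omega R d) (Omega R d) setT (eshift a) (@cylinders R d).
apply: ms => //.
move=> _ [_ [x [y [B [mB ->]]]] <-]; rewrite setTI.
by apply: sub_sigma_algebra; exists (a + x), (a + y), B.
Qed.

Lemma measurable_njump n t x y :
  measurable_fun [set: Omega R d] (fun w => njump w n t x y).
Proof.
have mc m k z : measurable_fun [set: Omega R d] (fun w : Omega R d =>
    jcoef (@nbrs d) w (exit_rate w) (expb (exit_rate w) (dirac_fun R y)) k m z).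
  elim: m k z => [|m ih] [|k] z.
  - by under eq_fun do rewrite jcoef0 /expb expr0; exact: measurable_cst.
  - exact: measurable_cst.
  - under eq_fun do rewrite jcoef0 /expb; apply: measurable_funM => //.
    by apply: measurable_funX; apply: measurableT_comp => //; exact: measurable_exit_rate.
  - under eq_fun do rewrite jcoefSS; apply: measurable_funD.
      by apply: measurable_funM => //; apply: measurableT_comp => //; exact: measurable_exit_rate.
    by apply: measurable_sum => u; apply: measurable_funM => //; exact: measurable_rate.
apply: (@measurable_fun_cvg _ _ _ _ (fun N (w : Omega R d) =>
   pseries (fun m => jcoef (@nbrs d) w (exit_rate w)
     (expb (exit_rate w) (dirac_fun R y)) n m x / m`!%:R) t N)).
  move=> N; rewrite /pseries /series /=.
  by apply: measurable_sum => m; apply: measurable_funM => //; apply: measurable_funM.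
by move=> w _; apply/is_cvg_egf/jcoef_bounded; exact: expb_bounded.
Qed.

End environment.

(** * Real-valued probabilities of events *)

Section real_probability.
Context dT (T : measurableType dT) (R : realType) (Q : probability T R).
Implicit Types A B E F : set T.

Definition pr A : R := fine (Q A).

Lemma prE A : measurable A -> Q A = (pr A)%:E.
Proof. by move=> mA; rewrite /pr fineK// fin_num_measure. Qed.

Lemma pr_ge0 A : 0 <= pr A. Proof. exact: fine_ge0. Qed.

Lemma le_pr A B : measurable A -> measurable B -> A `<=` B -> pr A <= pr B.
Proof. by move=> mA mB AB; rewrite -lee_fin -!prE// le_measure ?inE. Qed.

Lemma prID A B : measurable A -> measurable B ->
  pr A = pr (A `&` B) + pr (A `&` ~` B).
Proof.
move=> mA mB; have mAB := measurableI _ _ mA mB.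
have mAC : measurable (A `&` ~` B) by rewrite -setDE; exact: measurableD.
by apply/EFin_inj; rewrite EFinD -!prE// -setDE addeC; exact: measureDI.
Qed.

(** This is how null events are discarded below: nonpositive holding times, or a wrong starting
    point. *)
Lemma pr_full E F A : measurable A -> measurable E -> measurable F -> F `<=` E ->
  pr F = pr E -> pr (E `&` A) = pr (F `&` A).
Proof.
move=> mA mE mF FE FEe; rewrite (prID (measurableI _ _ mE mA) mF).
rewrite [X in X + _](_ : _ = pr (F `&` A)); last first.
  by congr pr; rewrite setIAC; congr (_ `&` _); exact: setIidr.
suff : pr (E `&` A `&` ~` F) <= 0.
  by move=> le0; have := pr_ge0 (E `&` A `&` ~` F); lra.
apply: (@le_trans _ _ (pr (E `&` ~` F))).
  apply: le_pr.
  - by apply: measurableI; [exact: measurableI|exact: measurableC].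
  - by apply: measurableI => //; exact: measurableC.
  - by move=> u [[? _] ?].
have := prID mE mF; rewrite (setIidr FE); lra.
Qed.

Lemma pr_bigcup_seq (I : eqType) (s : seq I) (F : I -> set T) E :
  measurable E -> (forall i, measurable (F i)) -> uniq s ->
  (forall i j u, F i u -> F j u -> i = j) ->
  pr (E `&` [set u | exists2 i, i \in s & F i u]) = \sum_(i <- s) pr (E `&` F i).
Proof.
move=> mE mF us dF.
have mU (r : seq I) : measurable [set u | exists2 i, i \in r & F i u].
  elim: r => [|i r ih].
    by rewrite (_ : mkset _ = set0)//; apply/seteqP; split=> // u [].
  rewrite (_ : mkset _ = F i `|` [set u | exists2 i, i \in r & F i u]).
    exact: measurableU.
  apply/seteqP; split => u /=.
    by move=> [j]; rewrite inE => /orP[/eqP ->|jr Fj]; [left|right; exists j].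
  by move=> [Fi|[j jr Fj]]; [exists i|exists j]; rewrite ?inE ?eqxx ?jr ?orbT.
elim: s us => [_|i s ih /= /andP[is' us]].
  rewrite big_nil (_ : _ `&` _ = set0) ?/pr ?measure0//.
  by apply/seteqP; split=> // u [_ []].
rewrite big_cons -ih// (@prID _ (F i))//; last exact: measurableI.
congr (pr _ + pr _); apply/seteqP; split=> u.
- by move=> [[]].
- by move=> [Eu Fu]; split=> //; split=> //; exists i; rewrite ?inE ?eqxx.
- move=> [[Eu [j]]]; rewrite inE => /orP[/eqP -> //|js Fj] Fi.
  by split=> //; exists j.
- move=> [Eu [j js Fj]]; split; first by split=> //; exists j; rewrite ?inE ?js ?orbT.
  by move=> Fi; move: is'; rewrite (dF _ _ _ Fi Fj) js.
Qed.

End real_probability.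

(** * Markov property after a waiting time and after the first jump *)

Section chain_law.
Variables (R : realType) (d : nat) (w : env R d) (d_gt0 : (0 < d)%N).
Context dT (T : measurableType dT).
Implicit Types (Q : probability T R) (E : set T) (c h t : R) (x y z : Zd d).
Implicit Types (Y : nat -> T -> Zd d) (S : nat -> T -> R).
Local Notation lam := (exit_rate w).

Definition cyl Y S n (y : nat -> Zd d) (s : nat -> R) :=
  [set u | forall i, (i <= n)%N -> Y i u = y i /\ s i < S i u].

(* The part of the law of the walk carried by the event E, of mass c.  It is the
   inductive version of [walk_law]: it is stable under waiting until time h and
   under making the first jump. *)
Record chain_law Q E c x Y S : Prop := {
  cl_meas : measurable E ;
  cl_skel : skeleton_measurable Y S ;
  cl_total : pr Q E = c ;
  cl_cyl : forall n (y : nat -> Zd d) (s : nat -> R), (forall i, 0 <= s i) ->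
    pr Q (E `&` cyl Y S n y s) =
    c * ((y 0%N == x)%:R * (\prod_(i < n) (w (y i) (y i.+1) / lam (y i))) *
     \prod_(i < n.+1) expR (- (lam (y i) * s i))) }.

Lemma walk_law_chain Q x Y S : skeleton_measurable Y S -> walk_law Y S w x Q ->
  chain_law Q setT 1 x Y S.
Proof.
move=> YS law; split=> // [|n y s s0]; first by rewrite /pr probability_setT.
by rewrite setTI mul1r /pr law.
Qed.

Lemma measurable_gt (S : T -> R) c : measurable_fun setT S ->
  measurable [set u | c < S u].
Proof.
move=> mS; have := mS measurableT `]c, +oo[%classic (measurable_itv _).
by rewrite setTI; congr measurable; apply/seteqP; split=> u /=; rewrite in_itv/= andbT.
Qed.

Lemma measurable_ltc (S : T -> R) c : measurable_fun setT S ->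
  measurable [set u | S u <= c].
Proof.
move=> mS; have := mS measurableT `]-oo, c]%classic (measurable_itv _).
by rewrite setTI; congr measurable; apply/seteqP; split=> u /=; rewrite in_itv.
Qed.

Lemma measurable_cyl Y S n (y : nat -> Zd d) (s : nat -> R) : skeleton_measurable Y S ->
  measurable (cyl Y S n y s).
Proof.
move=> [mY mS].
rewrite (_ : cyl _ _ _ _ _ = \bigcap_(i in [set i | (i <= n)%N])
    (Y i @^-1` [set y i] `&` [set u | s i < S i u])).
  by apply: bigcap_measurableType => i _; apply: measurableI => //; exact: measurable_gt.
by apply/seteqP; split=> u /= H i /H.
Qed.

Lemma cl_start Q E c x Y S : chain_law Q E c x Y S -> forall h, 0 <= h ->
  pr Q (E `&` [set u | Y 0%N u = x /\ h < S 0%N u]) = c * expR (- (lam x * h)).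
Proof.
move=> [mE YS Ec law] h h0; have := law 0%N (fun=> x) (fun=> h) (fun=> h0).
rewrite eqxx big_ord0 big_ord1 !mul1r => <-; congr (pr _ (_ `&` _)).
by apply/seteqP; split=> u /= => [H [|i]//|]; exact.
Qed.

Lemma measurable_start x h Y S : skeleton_measurable Y S ->
  measurable [set u | Y 0%N u = x /\ h < S 0%N u].
Proof.
move=> [mY mS]; rewrite (_ : mkset _ = Y 0%N @^-1` [set x] `&` [set u | h < S 0%N u])//.
by apply: measurableI => //; exact: measurable_gt.
Qed.

Lemma cl_restart Q E c x Y S A : chain_law Q E c x Y S -> measurable A ->
  pr Q (E `&` A) = pr Q (E `&` [set u | Y 0%N u = x /\ 0 < S 0%N u] `&` A).
Proof.
move=> law mA; have [mE YS Ec _] := law.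
have ms := measurable_start x 0 YS.
apply: pr_full => //; [exact: measurableI|].
by rewrite (cl_start law)// mulr0 oppr0 expR0 mulr1.
Qed.

(** Memoryless property: exp(- lam (s + h)) factors, and exp(- lam h) goes into the mass of the new
    event. *)
Lemma chain_law_wait Q E c x Y S h : 0 <= h -> chain_law Q E c x Y S ->
  chain_law Q (E `&` [set u | Y 0%N u = x /\ h < S 0%N u])
    (c * expR (- (lam x * h))) x Y
    (fun i u => if i is 0 then S 0%N u - h else S i u).
Proof.
move=> h0 law; have [mE YS Ec lawc] := law; have [mY mS] := YS.
split=> [|||n y s s0].
- by apply: measurableI => //; exact: measurable_start.
- split=> // -[|n]//; apply: measurable_funB => //; exact: measurable_cst.
- exact: (cl_start law).
have s0' i : 0 <= (if i is 0 then s 0%N + h else s i).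
  by case: i => [|i] //; exact: addr_ge0.
have := lawc n y _ s0'; case: (eqVneq (y 0%N) x) => [y0|y0]; last first.
  rewrite !mul0r !mulr0 => _; rewrite (_ : _ `&` _ = set0) /pr ?measure0//.
  apply/seteqP; split=> // u [[_ [Y0 _]] /(_ 0%N isT)[Y0' _]].
  by move: y0; rewrite -Y0' Y0 eqxx.
rewrite !mul1r !big_ord_recl y0 => eq1.
rewrite [LHS](_ : _ = pr Q (E `&` cyl Y S n y
    (fun i => if i is 0 then s 0%N + h else s i))).
  rewrite eq1 mulrDr opprD expRD.
  have -> : \prod_(i < n) expR (- (lam (y (lift ord0 i)) *
      match (lift ord0 i : nat) with 0%N => s 0%N + h | _.+1 => s (lift ord0 i) end))
    = \prod_(i < n) expR (- (lam (y (lift ord0 i)) * s (lift ord0 i))).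
    by apply: eq_bigr.
  ring.
congr pr; apply/seteqP; split=> u /=.
  move=> [[Eu [Y0 hS]] H]; split=> // -[|i] /H//.
  by move=> [-> ?]; split=> //; lra.
move=> [Eu H]; have [H1 H2] := H 0%N isT; have := s0 0%N => s00.
split; first by split=> //; rewrite H1; split=> //; lra.
by move=> [|i] /H// [-> ?]; split=> //; lra.
Qed.

(** The event 0 < S 0 <= h is a difference of cylinders with first thresholds 0 and h, whence the
    factor 1 - exp(- lam h). Requiring 0 < S 1 places the event inside the shifted cylinder with
    zero thresholds, which yields its mass. *)
Lemma chain_law_jump Q E c x Y S h z : 0 <= h -> chain_law Q E c x Y S ->
  chain_law Q
    (E `&` [set u | [/\ Y 0%N u = x, 0 < S 0%N u <= h, Y 1%N u = z & 0 < S 1%N u]])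
    (c * (1 - expR (- (lam x * h))) * (w x z / lam x)) z
    (fun i => Y i.+1) (fun i => S i.+1).
Proof.
move=> h0 law; have [mE YS Ec lawc] := law; have [mY mS] := YS.
have E1 n (y : nat -> Zd d) (s : nat -> R) : (forall i, 0 <= s i) -> y 0%N = z ->
  pr Q (E `&` [set u | [/\ Y 0%N u = x, 0 < S 0%N u <= h, Y 1%N u = z & 0 < S 1%N u]]
    `&` cyl (fun i => Y i.+1) (fun i => S i.+1) n y s) =
  c * (1 - expR (- (lam x * h))) * (w x z / lam x) *
  ((\prod_(i < n) (w (y i) (y i.+1) / lam (y i))) *
     \prod_(i < n.+1) expR (- (lam (y i) * s i))).
  move=> s0 yz.
  (* The cylinder of the shifted chain is prefixed with the site x and a threshold for the first
     holding time. *)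
  pose y' i := if i is j.+1 then y j else x.
  pose s' h i := if i is j.+1 then s j else h : R.
  have s'0 v : 0 <= v -> forall i, 0 <= s' v i by move=> v0 [|i]; [|exact: s0].
  have := lawc n.+1 y' _ (s'0 0 (lexx _)); have := lawc n.+1 y' _ (s'0 _ h0).
  rewrite /= eqxx mul1r !big_ord_recl /= yz => e1 e2.
  have mc v := measurable_cyl n.+1 y' (s' v) YS.
  have := prID Q (measurableI _ _ mE (mc 0)) (measurable_gt h (mS 0%N)).
  rewrite e2 [X in _ = pr _ X + _](_ : _ = E `&` cyl Y S n.+1 y' (s' h)); last first.
    apply/seteqP; split=> u /=.
      by move=> [[Eu H] hS]; split=> // -[|i] /H//= [].
    move=> [Eu H]; split; last by have [] := H 0%N isT.
    by split=> // -[|i] /H//= [-> ?]; split=> //; lra.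
  rewrite e1 [X in _ = _ + pr _ X](_ : _ = E `&` [set u | [/\ Y 0%N u = x, 0 < S 0%N u <= h,
      Y 1%N u = z & 0 < S 1%N u]] `&` cyl (fun i => Y i.+1) (fun i => S i.+1) n y s); last first.
    apply/seteqP; split=> u /=.
      move=> [[Eu H] /negP hS].
      have [H1 H2] := H 0%N isT; have [H3 H4] := H 1%N isT.
      split; last by move=> i ilen; have [] := H i.+1 ilen.
      by split=> //; split=> //; [rewrite H2/= leNgt|rewrite -yz|exact: le_lt_trans (s0 0%N) H4].
    move=> [[Eu [Y0 /andP[S00 S0h] Y1 S1]] H]; split; last by apply/negP; rewrite -leNgt.
    by split=> // -[|i]//= ilen; have [] := H i ilen.
  rewrite mulr0 oppr0 expR0.
  have -> : \prod_(i < n) (w (y i) (y i.+1) / lam (y i)) =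
      \prod_(i < n) (w (y (0 + i)%N) (y (bump 0 i)) / lam (y (0 + i)%N)) by [].
  lra.
split=> [|||n y s s0].
- apply: measurableI => //.
  rewrite (_ : mkset _ = [set u | Y 0%N u = x /\ 0 < S 0%N u] `&`
     [set u | S 0%N u <= h] `&` (Y 1%N @^-1` [set z] `&` [set u | 0 < S 1%N u])).
    apply: measurableI; apply: measurableI => //.
    + exact: measurable_start.
    + exact: measurable_ltc.
    + exact: measurable_gt.
  apply/seteqP; split=> u /=; first by move=> [? /andP[] *]; do !split.
  by move=> [[[? ?] ?] [? ?]]; split=> //; apply/andP; split.
- by split.
- have := E1 0%N (fun=> z) (fun=> 0) (fun=> lexx _) erefl.
  rewrite big_ord0 big_ord1 mulr0 oppr0 expR0 !mulr1 => <-; congr pr.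
  by apply/esym/setIidl => u [_ [Y0 S0 Y1 S1]] [|i].
- have [yz|yz] := eqVneq (y 0%N) z; first by rewrite E1// !mul1r.
  rewrite !mul0r mulr0 (_ : _ `&` _ = set0) /pr ?measure0//.
  apply/seteqP; split=> // u [[_ [_ _ Y1 _]] /(_ 0%N isT)[Y1' _]].
  by move: yz; rewrite -Y1' Y1 eqxx.
Qed.

End chain_law.

(** * Arrival and departure events and their power series *)

Section jump_events.
Variables (R : realType) (d : nat) (w : env R d) (d_gt0 : (0 < d)%N).
Context dT (T : measurableType dT).
Variables (Q0 : Zd d -> probability T R) (Y0 : nat -> T -> Zd d) (S0 : nat -> T -> R).
Hypothesis law0 : forall x, chain_law w (Q0 x) setT 1 x Y0 S0.
Implicit Types (Q : probability T R) (E : set T) (c h t : R) (x y z : Zd d).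
Implicit Types (Y : nat -> T -> Zd d) (S : nat -> T -> R).
Implicit Types (b : bool) (n m : nat).
Local Notation lam := (exit_rate w).

(* For [b = false] this is the event that the n-th jump, to y, has occurred by
   time t; for [b = true], that moreover y has been left by time t. *)
Definition jump_event Y S b n y t :=
  [set u | Y n u = y /\ jump_time S (n + b) u <= t].

Lemma measurable_jump_time Y S n : skeleton_measurable Y S ->
  measurable_fun [set: T] (jump_time S n).
Proof. by move=> [_ mS]; apply: measurable_sum => i. Qed.

Lemma measurable_jump_event Y S b n y t : skeleton_measurable Y S ->
  measurable (jump_event Y S b n y t).
Proof.
move=> YS; rewrite (_ : jump_event _ _ _ _ _ _ =
  Y n @^-1` [set y] `&` [set u | jump_time S (n + b) u <= t])//.
apply: measurableI; first by have [mY _] := YS.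
by apply: measurable_ltc; exact: (measurable_jump_time _ YS).
Qed.

(** Coefficients of the case n = 0: on x = y, the constant 1 for the arrival and 1 - exp(- lam x t)
    for the departure. *)
Definition hbase b y m x : R :=
  (m == 0%N)%:R * dirac_fun R y x - b%:R * expb lam (dirac_fun R y) m x.

Definition hseries b y n t x := jseries (@nbrs d) w lam (hbase b y) n t x.

Lemma hbase_bounded b y : base_bounded (hbase b y).
Proof.
move=> x; have eb := @expb_bounded R _ lam (dirac_fun R y) x.
under eq_fun do rewrite /hbase -mulNr.
apply: geo_boundedD; last exact: geo_boundedZ.
apply/geo_boundedP; exists `|dirac_fun R y x|, 1; split=> // m.
by rewrite expr1n mulr1 normrM; case: eqP; rewrite ?normr1 ?mul1r// normr0 mul0r.
Qed.

Lemma egf_cst (a : R) t : egf (fun m => (m == 0%N)%:R * a) t = a.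
Proof.
apply/eqP; rewrite -subr_eq0; apply/eqP.
have ga : geo_bounded (fun m => (m == 0%N)%:R * a).
  apply/geo_boundedP; exists `|a|, 1; split=> // m.
  by rewrite expr1n mulr1 normrM; case: eqP; rewrite ?normr1 ?mul1r// normr0 mul0r.
apply: (@linear_ode_unique _ (fun t => egf (fun m => (m == 0%N)%:R * a) t - a) 0) => [|s].
  by rewrite egf0 mul1r subrr.
have d1 := egf_is_derive s ga; have d2 := is_derive_cst a s (1 : R).
have d3 := is_deriveB d1 d2; apply: (is_derive_eq d3).
have e0 : egf (fun m => (m.+1 == 0%N)%:R * a) s = 0.
  rewrite -[RHS](mul0r (egf (fun=> 0) s)) -egfZ; last exact: geo_bounded0.
  by congr egf; apply/funext => m; rewrite !mul0r.
by rewrite e0 subr0 mul0r.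
Qed.

Lemma jseries_expb0 (g : Zd d -> R) t x :
  jseries (@nbrs d) w lam (expb lam g) 0 t x = expR (- (lam x * t)) * g x.
Proof.
apply/eqP; rewrite -subr_eq0; apply/eqP.
apply: (@linear_ode_unique _ (fun t => jseries _ _ _ _ _ t _ - _) (- lam x)) => [|s].
  by rewrite jseries_expb_at0 mulr0 oppr0 expR0 subrr.
have d1 := @jseries_expb_derive R _ (@nbrs d) w lam g 0 s x.
have dc : is_derive s 1 (fun t : R => - (lam x * t)) (- lam x).
  have d' := is_deriveM (is_derive_cst (lam x) s 1) (is_derive_id s 1).
  have d'' := is_deriveN d'; apply: (is_derive_eq d'').
  by rewrite /GRing.scale /=; lra.
have de := @is_derive1_comp _ expR (fun t : R => - (lam x * t)) s _ _
  (is_derive_expR (- (lam x * s))) dc.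
have d2 := is_deriveM de (is_derive_cst (g x) s 1).
have d3 := is_deriveB d1 d2; apply: (is_derive_eq d3).
by rewrite /GRing.scale /=; lra.
Qed.

Lemma hseries0 b y t x :
  hseries b y 0 t x = dirac_fun R y x * (1 - b%:R * expR (- (lam x * t))).
Proof.
have eb : geo_bounded (fun m => expb lam (dirac_fun R y) m x).
  exact: expb_bounded.
rewrite /hseries /jseries; under eq_fun do rewrite jcoef0 /hbase -mulNr.
rewrite egfD ?egf_cst ?egfZ//.
- have := jseries_expb0 (dirac_fun R y) t x; rewrite /jseries.
  by under eq_fun do rewrite jcoef0; move=> ->; ring.
- apply/geo_boundedP; exists `|dirac_fun R y x|, 1; split=> // m.
  by rewrite expr1n mulr1 normrM; case: eqP; rewrite ?normr1 ?mul1r// normr0 mul0r.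
- exact: geo_boundedZ.
Qed.

Lemma hseries_at0 b y n x : hseries b y n.+1 0 x = 0.
Proof. exact: jseries_at0. Qed.

Lemma hseries_sub y n t x :
  hseries false y n t x - hseries true y n t x = njump w n t x y.
Proof.
apply/eqP; rewrite subr_eq addrC -[X in X + _]mul1r -[X in _ + X]mul1r.
have jb b : base_bounded (if b then hbase true y else expb lam (dirac_fun R y)).
  by case: b; [exact: hbase_bounded|exact: expb_bounded].
(* Linearity over a two-element list: the base for arrival is the base for departure plus that of
   [njump]. *)
have := @egf_sum R bool [:: true; false] (fun=> 1) (fun b m =>
  jcoef (@nbrs d) w lam (if b then hbase true y else expb lam (dirac_fun R y)) n m x)
  t (fun b => jcoef_bounded _ _ _ _ _ (jb b)).
rewrite !big_cons !big_nil !addr0 => <-; apply/eqP.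
congr egf; apply/funext => m; rewrite -jcoef_comb; apply: eq_jcoef => k v.
by rewrite !big_cons big_nil /hbase /= mulr0n mulr1n; ring.
Qed.

(** Average of [hseries] over the site reached by the first jump; it is the source towards which
    [hseries] with n.+1 jumps relaxes at rate lam x. *)
Definition hjump b y n t x : R :=
  \sum_(z <- nbrs x) w x z / lam x * hseries b y n t z.

Lemma hseries_derive b y n t x :
  is_derive t 1 (fun t : R => hseries b y n.+1 t x)
    (lam x * (hjump b y n t x - hseries b y n.+1 t x)).
Proof.
have d1 := jseries_derive (@nbrs d) w lam n t x (@hbase_bounded b y).
apply: (is_derive_eq d1); rewrite mulrBr addrC mulNr; congr (_ - _).
rewrite mulr_sumr; apply: eq_bigr => z _; rewrite mulrA; congr (_ * _).
by rewrite mulrCA divff ?mulr1// gt_eqF// exit_rate_gt0.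
Qed.

Definition first_jump Y S x h z : set T :=
  [set u | [/\ Y 0%N u = x, 0 < S 0%N u <= h, Y 1%N u = z & 0 < S 1%N u]].

(** The jump probabilities to the neighbours add up to 1, so the disjoint first-jump events carry
    all the mass of S 0 <= h. *)
Lemma chain_law_split Q E c x Y S h A : 0 <= h -> measurable A ->
  chain_law w Q E c x Y S ->
  pr Q (E `&` [set u | S 0%N u <= h] `&` A) =
  \sum_(z <- nbrs x) pr Q (E `&` first_jump Y S x h z `&` A).
Proof.
move=> h0 mA law; have [mE YS Ec _] := law; have [mY mS] := YS.
pose F z := first_jump Y S x h z.
have lawF z := chain_law_jump z h0 law.
have mF z : measurable (F z).
  rewrite (_ : F z = [set u | Y 0%N u = x /\ 0 < S 0%N u] `&`
     [set u | S 0%N u <= h] `&` (Y 1%N @^-1` [set z] `&` [set u | 0 < S 1%N u])).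
    apply: measurableI; apply: measurableI => //.
    + exact: measurable_start.
    + exact: measurable_ltc.
    + exact: measurable_gt.
  apply/seteqP; split=> u /=; first by move=> [? /andP[] *]; do !split.
  by move=> [[[? ?] ?] [? ?]]; split=> //; apply/andP; split.
have dF i j u : F i u -> F j u -> i = j by move=> [_ _ <- _] [_ _ <- _].
have mh := measurable_ltc h (mS 0%N).
set U := [set u | exists2 z, z \in nbrs x & F z u].
have mU : measurable U.
  rewrite (_ : U = \bigcup_(z in [set` nbrs x]) F z).
    by apply: fin_bigcup_measurable => //; exact: finite_seq.
  by apply/seteqP; split=> u [z zx Fz]; exists z.
have eF : pr Q (E `&` U) = pr Q (E `&` [set u | S 0%N u <= h]).
  rewrite pr_bigcup_seq ?nbrs_uniq// (eq_bigr _ (fun z _ => cl_total (lawF z))).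
  rewrite -mulr_sumr -mulr_suml -exit_rateE divff ?mulr1; last first.
    by rewrite gt_eqF// exit_rate_gt0.
  have := prID Q mE mh; rewrite Ec.
  rewrite (_ : pr Q (E `&` ~` _) = c * expR (- (lam x * h))); first lra.
  rewrite -(cl_start law h0) (cl_restart law); last exact: measurableC.
  rewrite -setIA; congr (pr _ (_ `&` _)); apply/seteqP; split=> u /=.
    by move=> [[-> ?] /negP]; rewrite -ltNge.
  by move=> [-> ?]; split; [split=> //; exact: le_lt_trans h0 _|apply/negP; rewrite -ltNge].
rewrite (@pr_full _ _ _ _ _ (E `&` U))//; [|exact: measurableI|exact: measurableI|]; last first.
  by move=> u [Eu [z _ [_ /andP[]]]].
rewrite setIAC pr_bigcup_seq ?nbrs_uniq//; last exact: measurableI.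
by apply: eq_bigr => z _; rewrite setIAC.
Qed.

Lemma chain_law_first_jump b y n t Q E c x Y S h : 0 <= h -> 0 <= t ->
  (forall Q E c x Y S, chain_law w Q E c x Y S ->
    pr Q (E `&` jump_event Y S b n y t) = c * hseries b y n t x) ->
  chain_law w Q E c x Y S ->
  pr Q (E `&` [set u | S 0%N u <= h] `&`
    jump_event (fun i => Y i.+1) (fun i => S i.+1) b n y t) =
  c * (1 - expR (- (lam x * h))) * hjump b y n t x.
Proof.
move=> h0 t0 ih law; have [_ [mY mS] _ _] := law.
rewrite (chain_law_split h0 _ law); last by apply: measurable_jump_event; split.
rewrite mulr_sumr; apply: eq_bigr => z _; rewrite mulrA.
exact: (ih _ _ _ _ _ _ (chain_law_jump z h0 law)).
Qed.

Lemma measurable_pos S n : (forall i, measurable_fun setT (S i)) ->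
  measurable [set u : T | forall i, (i < n)%N -> 0 < S i u].
Proof.
move=> mS; rewrite (_ : mkset _ = \bigcap_(i in [set i | (i < n)%N]) [set u | 0 < S i u]).
  by apply: bigcap_measurableType => i _; exact: measurable_gt.
by apply/seteqP; split=> u /= H i /H.
Qed.

(** Splitting at the first jump gives, by induction, mass at least c (1 - exp(- lam h)) for every h,
    hence c. *)
Lemma chain_law_pos n Q E c x Y S : chain_law w Q E c x Y S ->
  pr Q (E `&` [set u | forall i, (i < n)%N -> 0 < S i u]) = c.
Proof.
elim: n Q E c x Y S => [|n ih] Q E c x Y S law.
  by have [_ _ <- _] := law; congr pr; apply: setIidl.
have [mE YS Ec _] := law; have [mY mS] := YS.
have lam0 := exit_rate_gt0 w x d_gt0.
set p := pr _ _; have pc : p <= c.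
  rewrite -Ec; apply: le_pr => //; first by apply: measurableI => //; exact: measurable_pos.
have c0 : 0 <= c by rewrite -Ec pr_ge0.
have ple h : 0 <= h -> c * (1 - expR (- (lam x * h))) <= p.
  move=> h0; pose A := [set u : T | forall i, (i < n)%N -> 0 < S i.+1 u].
  have mA : measurable A by exact: (measurable_pos _ (fun i => mS i.+1)).
  have : pr Q (E `&` [set u | S 0%N u <= h] `&` A) = c * (1 - expR (- (lam x * h))).
    rewrite (chain_law_split h0 mA law).
    rewrite (eq_bigr _ (fun z _ => ih _ _ _ _ _ _ (chain_law_jump z h0 law))).
    by rewrite -mulr_sumr -mulr_suml -exit_rateE divff ?mulr1// gt_eqF.
  move=> <-; rewrite -setIA (cl_restart law); last first.
    by apply: measurableI => //; exact: measurable_ltc.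
  apply: le_pr.
  - apply: measurableI; first by apply: measurableI => //; exact: measurable_start.
    by apply: measurableI => //; exact: measurable_ltc.
  - by apply: measurableI => //; exact: measurable_pos.
  - by move=> u [[Eu [_ S0u]] [_ Au]]; split=> // -[|i]//= /Au.
apply/eqP; rewrite eq_le pc /= leNgt; apply/negP => pltc.
have D0 : 0 < c - p by rewrite subr_gt0.
have cD : 0 <= c / (c - p) by rewrite divr_ge0// ltW.
(* At this h, exp(lam h) >= 1 + c / (c - p), so exp(lam h) (c - p) > c, which contradicts the
   bound. *)
have := ple (c / (c - p) / lam x) (divr_ge0 cD (ltW lam0)).
rewrite mulrCA divff ?gt_eqF// mulr1 expRN.
have := expR_ge1Dx (c / (c - p)); set e := expR _ => e1.
have e0 : 0 < e by exact: expR_gt0.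
have : c < e * (c - p).
  apply: (@lt_le_trans _ _ ((1 + c / (c - p)) * (c - p))).
    by rewrite mulrDl mul1r divfK ?gt_eqF// ltrDr.
  by rewrite ler_wpM2r// ltW.
rewrite -ltr_pdivrMl// mulrC; lra.
Qed.

End jump_events.

(** Since g >= a, the function exp(lam (s - t)) (M s - a) is nondecreasing on the time step. *)
Lemma exp_relax_ge (R : realType) (M g : R -> R) (lam a t h : R) :
  0 <= lam -> 0 <= h ->
  (forall s : R, is_derive s 1 M (lam * (g s - M s))) ->
  (forall s, t <= s <= t + h -> a <= g s) ->
  (1 - expR (- (lam * h))) * a <= M (t + h) - expR (- (lam * h)) * M t.
Proof.
move=> lam0 h0 dM ga; pose D s : R := expR (lam * (s - t)) * (M s - a).
have dD (s : R) : is_derive s 1 D (expR (lam * (s - t)) * (lam * (g s - a))).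
  have dl : is_derive s 1 (fun s : R => lam * (s - t)) lam.
    have dd := is_deriveB (is_derive_id s 1) (is_derive_cst t s 1).
    have d' := is_deriveM (is_derive_cst lam s 1) dd.
    by apply: (is_derive_eq d'); rewrite /GRing.scale /=; ring.
  have de := @is_derive1_comp _ expR _ s _ _ (is_derive_expR _) dl.
  have d2 := is_deriveB (dM s) (is_derive_cst a s 1).
  have d3 := is_deriveM de d2; apply: (is_derive_eq d3).
  by rewrite -[(M - cst a) s]/(M s - a) /GRing.scale /=; ring.
have tth : t <= t + h by rewrite lerDl.
have [|c cth DE] := @MVT_segment _ D _ t (t + h) tth (fun s _ => dD s).
  by apply: derivable_within_continuous => s _; case: (dD s).
have : D t <= D (t + h).
  rewrite -subr_ge0 DE addrAC subrr add0r mulr_ge0// mulr_ge0 ?expR_ge0//.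
  by rewrite mulr_ge0// subr_ge0 ga//; move: cth; rewrite in_itv.
rewrite /D subrr mulr0 expR0 mul1r addrAC subrr add0r => Dle.
have := ler_wpM2l (expR_ge0 (- (lam * h))) Dle.
by rewrite mulrA -expRD addNr expR0 mul1r; lra.
Qed.

Lemma exp_relax_le (R : realType) (M g : R -> R) (lam a t h : R) :
  0 <= lam -> 0 <= h ->
  (forall s : R, is_derive s 1 M (lam * (g s - M s))) ->
  (forall s, t <= s <= t + h -> g s <= a) ->
  M (t + h) - expR (- (lam * h)) * M t <= (1 - expR (- (lam * h))) * a.
Proof.
move=> lam0 h0 dM ga.
have dN (s : R) : is_derive s 1 (- M) (lam * ((- g) s - (- M) s)).
  have dn := is_deriveN (dM s); apply: (is_derive_eq dn).
  by rewrite -[(- g) s]/(- g s) -[(- M) s]/(- M s); ring.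
have := exp_relax_ge lam0 h0 dN (a := - a) (t := t).
rewrite -[(- M) (t + h)]/(- M (t + h)) -[(- M) t]/(- M t) => H.
have : (1 - expR (- (lam * h))) * - a <= - M (t + h) - expR (- (lam * h)) * - M t.
  by apply: H => s /ga; rewrite -[(- g) s]/(- g s) lerN2.
lra.
Qed.

(** * The power series are the probabilities of the jump events *)

Section jump_law.
Variables (R : realType) (d : nat) (w : env R d) (d_gt0 : (0 < d)%N).
Context dT (T : measurableType dT).
Variables (Q0 : Zd d -> probability T R) (Y0 : nat -> T -> Zd d) (S0 : nat -> T -> R).
Hypothesis law0 : forall x, chain_law w (Q0 x) setT 1 x Y0 S0.
Implicit Types (Q : probability T R) (E : set T) (c h t : R) (x y z : Zd d).
Implicit Types (Y : nat -> T -> Zd d) (S : nat -> T -> R).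
Implicit Types (b : bool) (n m k : nat).
Local Notation lam := (exit_rate w).
Local Notation hseries := (hseries w).
Local Notation hjump := (hjump w).

Let lam_gt0 x : 0 < lam x. Proof. exact: exit_rate_gt0. Qed.

Lemma expR_lam_le1 x h : 0 <= h -> expR (- (lam x * h)) <= 1.
Proof. by move=> h0; rewrite expR_le1 oppr_le0 mulr_ge0// ltW. Qed.

Section step.
Variables (b : bool) (y : Zd d) (n : nat).
Hypothesis ih : forall t, 0 <= t -> forall Q E c x Y S, chain_law w Q E c x Y S ->
  pr Q (E `&` jump_event Y S b n y t) = c * hseries b y n t x.

(** By the induction hypothesis [hjump] is, up to a positive factor, the probability of an event
    that grows with t. The value h = 1 only serves to make this factor positive. *)
Lemma hjump_homo x t (u : R) : 0 <= t -> t <= u -> hjump b y n t x <= hjump b y n u x.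
Proof.
move=> t0 tu; have u0 := le_trans t0 tu.
have [mE YS _ _] := law0 x; have [mY mS] := YS.
have e1 : 0 < 1 * (1 - expR (- (lam x * 1))).
  by rewrite mul1r subr_gt0 mulr1 expR_lt1 oppr_lt0.
rewrite -(ler_pM2l e1).
rewrite -!(chain_law_first_jump d_gt0 ler01 _ (ih _) (law0 x))//.
have YS1 : skeleton_measurable (fun i => Y0 i.+1) (fun i => S0 i.+1) by split.
apply: le_pr => [||v [? [? ?]]]; last by split=> //; split=> //; exact: le_trans tu.
  by apply: measurableI; [apply: measurableI => //; exact: measurable_ltc|
    exact: measurable_jump_event].
by apply: measurableI; [apply: measurableI => //; exact: measurable_ltc|
    exact: measurable_jump_event].
Qed.

Lemma hjump_ge0 x t : 0 <= t -> 0 <= hjump b y n t x.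
Proof.
move=> t0; have e1 : 0 < 1 * (1 - expR (- (lam x * 1))).
  by rewrite mul1r subr_gt0 mulr1 expR_lt1 oppr_lt0.
rewrite -(pmulr_rge0 _ e1) -(chain_law_first_jump d_gt0 ler01 _ (ih _) (law0 x))//.
exact: pr_ge0.
Qed.

(** Split according to whether the first jump occurs by time h. If it does not, the chain has merely
    waited; if it does, the time left for the other jumps lies between t and t + h. *)
Lemma jump_event_step Q E c x Y S t h : chain_law w Q E c x Y S ->
  0 <= t -> 0 <= h ->
  forall p, p = pr Q (E `&` [set u | Y 0%N u = x /\ h < S 0%N u] `&`
    jump_event Y (fun i u => if i is 0 then S 0%N u - h else S i u) b n.+1 y t) ->
  c * (1 - expR (- (lam x * h))) * hjump b y n t x <=
    pr Q (E `&` jump_event Y S b n.+1 y (t + h)) - p <=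
  c * (1 - expR (- (lam x * h))) * hjump b y n (t + h) x.
Proof.
move=> law t0 h0 p pE; have th0 : 0 <= t + h by exact: addr_ge0.
have [mE YS _ _] := law; have [mY mS] := YS.
have YS1 : skeleton_measurable (fun i => Y i.+1) (fun i => S i.+1) by split.
have mh := measurable_ltc h (mS 0%N).
have mJ := measurable_jump_event b n.+1 y (t + h) YS.
have mJ1 (u : R) := measurable_jump_event b n y u YS1.
rewrite -!(chain_law_first_jump d_gt0 h0 _ (ih _) law)//.
have JE S' v : jump_time S' (n.+1 + b) v =
    S' 0%N v + jump_time (fun i => S' i.+1) (n + b) v.
  by rewrite /jump_time addSn big_ord_recl.
rewrite (prID Q (measurableI _ _ mE mJ) mh).
have -> : pr Q (E `&` jump_event Y S b n.+1 y (t + h) `&` ~` [set u | S 0%N u <= h]) = p.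
  rewrite pE -setIA (cl_restart law); last by apply: measurableI => //; exact: measurableC.
  congr pr; apply/seteqP; split=> v /=.
    move=> [[Ev [Yv Sv]] [[YS' JS] /negP]]; rewrite -ltNge => hS.
    by split=> //; split=> //; move: JS; rewrite !JE; lra.
  move=> [[Ev [Yv hS]] [YS' JS]].
  split; first by split=> //; split=> //; exact: le_lt_trans h0 hS.
  split; last by apply/negP; rewrite -ltNge.
  by split=> //; move: JS; rewrite !JE; lra.
rewrite addrK; apply/andP; split.
  apply: le_pr => [||v [[Ev Sv] [Yv Jv]]].
  - by apply: measurableI => //; exact: measurableI.
  - by apply: measurableI => //; exact: measurableI.
  - by split=> //; split=> //; split=> //; move: Sv Jv; rewrite JE /=; lra.
rewrite -[X in pr _ X <= _]setIA [leLHS](cl_restart law); last exact: measurableI.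
apply: le_pr => [||v [[Ev [_ Sv]] [[Yv Jv] Sh]]].
- apply: measurableI; last exact: measurableI.
  by apply: measurableI => //; exact: measurable_start.
- by apply: measurableI => //; exact: measurableI.
- by split=> //; split=> //; move: Jv Sv; rewrite JE; lra.
Qed.

Lemma jump_event_at0 Q E c x Y S : chain_law w Q E c x Y S ->
  pr Q (E `&` jump_event Y S b n.+1 y 0) = 0.
Proof.
move=> law; have [mE YS Ec _] := law; have [mY mS] := YS.
rewrite (@pr_full _ _ _ _ _ (E `&` [set u | forall i, (i < n.+1 + b)%N -> 0 < S i u]))//.
- rewrite (_ : _ `&` _ = set0) /pr ?measure0//.
  apply/seteqP; split=> // u [[_ pos] [_]]; apply/negP; rewrite -ltNge.
  rewrite /jump_time addSn big_ord_recl ltr_pwDl ?pos// sumr_ge0// => i _.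
  by apply/ltW/pos; rewrite lift0 addSn ltnS.
- exact: measurable_jump_event.
- by apply: measurableI => //; exact: measurable_pos.
- by rewrite (chain_law_pos d_gt0 _ law).
Qed.

(* Over a time step h, both sides differ from their common recursion by at most
   c (1 - exp(- lam h)) times the increment of the nondecreasing function
   [hjump]; these errors telescope over the grid. *)
Lemma jump_event_grid k Q E c x Y S h : chain_law w Q E c x Y S -> 0 <= h ->
  `|pr Q (E `&` jump_event Y S b n.+1 y (h *+ k)) - c * hseries b y n.+1 (h *+ k) x|
  <= c * (1 - expR (- (lam x * h))) * hjump b y n (h *+ k) x.
Proof.
move=> + h0; have e1 := expR_lam_le1 x h0.
(* The induction hypothesis is used after waiting h, which changes the event, its mass and the first
   holding time. *)
elim: k E c S => [|k ihk] E c S law.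
  have [mE YS Ec _] := law; have c0 : 0 <= c by rewrite -Ec pr_ge0.
  rewrite mulr0n (jump_event_at0 law) hseries_at0 mulr0 subrr normr0.
  by rewrite !mulr_ge0 ?hjump_ge0 ?subr_ge0.
have [mE YS Ec _] := law; have c0 : 0 <= c by rewrite -Ec pr_ge0.
have t0 : 0 <= h *+ k by rewrite mulrn_wge0.
have := jump_event_step law t0 h0 erefl; have := ihk _ _ _ (chain_law_wait h0 law).
rewrite mulrSr; set t := h *+ k; set e := expR _; set p := pr _ _.
set A := pr _ _; set m1 := hseries _ _ _ (t + h) _; set m0 := hseries _ _ _ t _.
set G0 := hjump _ _ _ t _; set G1 := hjump _ _ _ (t + h) _ => /= P1 /andP[P2 P3].
have G00 : 0 <= G0 by exact: hjump_ge0.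
have D s := hseries_derive w d_gt0 b y n s x.
have Q1 : (1 - e) * G0 <= m1 - e * m0.
  apply: (exp_relax_ge (ltW (lam_gt0 x)) h0 D) => s /andP[ts _].
  exact: hjump_homo.
have Q2 : m1 - e * m0 <= (1 - e) * G1.
  apply: (exp_relax_le (ltW (lam_gt0 x)) h0 D) => s /andP[ts st].
  by apply: hjump_homo => //; exact: le_trans ts.
have := ler_wpM2l c0 Q1; have := ler_wpM2l c0 Q2.
have : 0 <= c * (1 - e) * G0 * (1 - e) by rewrite !mulr_ge0// subr_ge0.
move: P1; rewrite ler_norml => /andP[P1 P1'] Q3 Q4 Q5.
rewrite ler_norml; apply/andP; split; nra.
Qed.

(** With mesh t / (k + 1) and 1 - exp(- v) <= v, the grid error is at most B / (k + 1) for a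
    constant B, so a positive gap is impossible. *)
Lemma jump_event_hseries_step t Q E c x Y S : 0 <= t -> chain_law w Q E c x Y S ->
  pr Q (E `&` jump_event Y S b n.+1 y t) = c * hseries b y n.+1 t x.
Proof.
move=> t0 law; apply/eqP; rewrite -subr_eq0 -normr_le0 leNgt; apply/negP => D0.
have [mE YS Ec _] := law; have c0 : 0 <= c by rewrite -Ec pr_ge0.
set D := `|_| in D0; pose B := c * (lam x * t) * hjump b y n t x.
have B0 : 0 <= B by rewrite !mulr_ge0 ?hjump_ge0// ltW.
have DB k : D *+ k.+1 <= B.
  have h0 : 0 <= t / k.+1%:R by rewrite divr_ge0.
  have := jump_event_grid k.+1 law h0.
  have -> : (t / k.+1%:R) *+ k.+1 = t by rewrite -mulr_natr divfK.
  rewrite -/D => /le_trans H.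
  rewrite -mulr_natr -ler_pdivlMr ?ltr0Sn//; apply: H.
  rewrite (_ : B / _ = c * (lam x * (t / k.+1%:R) * hjump b y n t x)); last first.
    by rewrite /B; ring.
  rewrite -mulrA ler_wpM2l// ler_wpM2r ?hjump_ge0//.
  by set v := lam x * (t / _); have := expR_ge1Dx (- v); lra.
have [k kB] : exists k, B < D * k%:R.
  exists (Num.truncn (B / D)).+1; rewrite -ltr_pdivrMl// mulrC.
  exact: truncnS_gt.
have := DB k; rewrite -mulr_natr mulrSr mulrDr mulr1; lra.
Qed.

End step.

Lemma jump_event_hseries b y n t Q E c x Y S : 0 <= t -> chain_law w Q E c x Y S ->
  pr Q (E `&` jump_event Y S b n y t) = c * hseries b y n t x.
Proof.
elim: n t Q E c x Y S => [|n ih] t Q E c x Y S t0 law; last first.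
  by apply: jump_event_hseries_step => // *; exact: ih.
have [mE YS Ec _] := law; have [mY mS] := YS; rewrite hseries0.
rewrite (cl_restart law); last exact: measurable_jump_event.
have [xy|xy] := eqVneq x y; last first.
  rewrite /dirac_fun (negPf xy) mul0r mulr0 (_ : _ `&` _ = set0) /pr ?measure0//.
  by apply/seteqP; split=> // u [[_ [Yx _]] [Yy _]]; move: xy; rewrite -Yx Yy eqxx.
rewrite -xy /dirac_fun eqxx mul1r; case: b; last first.
  rewrite mul0r subr0 mulr1 setIidl; first by rewrite (cl_start law)// mulr0 oppr0 expR0 mulr1.
  by move=> u [_ [Yu _]]; split=> //; rewrite /jump_time big_ord0.
have := prID Q mE (measurable_start x t YS); rewrite Ec (cl_start law t0).
rewrite (cl_restart law); last by apply: measurableC; exact: measurable_start.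
rewrite mul1r => e1; rewrite [LHS](_ : _ = pr Q (E `&`
  [set u | Y 0%N u = x /\ 0 < S 0%N u] `&` ~` [set u | Y 0%N u = x /\ t < S 0%N u])).
  by lra.
congr pr; apply/seteqP; split=> u [[Eu [Yu Su]]].
  move=> [_]; rewrite /jump_time big_ord1 => St; split=> // -[_].
  by apply/negP; rewrite -leNgt.
move=> N; split=> //; split=> //; rewrite /jump_time big_ord1 leNgt.
by apply/negP => St; apply: N.
Qed.

Lemma pr_njump y n t Q E c x Y S : 0 <= t -> chain_law w Q E c x Y S ->
  pr Q (E `&` [set u | Y n u = y /\ jump_time S n u <= t < jump_time S n.+1 u]) =
  c * njump w n t x y.
Proof.
move=> t0 law; have [mE YS Ec _] := law; have [mY mS] := YS.
rewrite -hseries_sub mulrBr -!(jump_event_hseries _ _ _ t0 law).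
have mJ b := measurable_jump_event b n y t YS.
have := prID Q (measurableI _ _ mE (mJ false)) (mJ true).
rewrite (_ : E `&` _ `&` ~` _ = E `&` [set u | Y n u = y /\
  jump_time S n u <= t < jump_time S n.+1 u]); last first.
  apply/seteqP; split=> u /=; rewrite /jump_event/= addn0 addn1.
    move=> [[Eu [Yu Ju]] N]; split=> //; split=> //; rewrite Ju/= ltNge.
    by apply/negP => J1; apply: N.
  by move=> [Eu [Yu /andP[J1 J2]]]; split=> // -[_]; apply/negP; rewrite -ltNge.
move=> ->; rewrite -setIA -addrA [X in _ = _ + X]addrC.
(* Departure implies arrival only where the holding time S n is nonnegative, so the comparison is
   made on the event of full mass where holding times are positive. *)
suff -> : pr Q (E `&` (jump_event Y S false n y t `&` jump_event Y S true n y t)) =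
  pr Q (E `&` jump_event Y S true n y t) by lra.
have mpos := measurable_pos n.+1 mS.
have eqp : pr Q (E `&` [set u | forall i, (i < n.+1)%N -> 0 < S i u]) = pr Q E.
  by rewrite (chain_law_pos d_gt0 _ law).
have mEp := measurableI _ _ mE mpos.
rewrite (pr_full _ mE mEp _ eqp)//; last exact: measurableI.
rewrite [RHS](pr_full _ mE mEp _ eqp)//.
congr pr; apply/seteqP; split=> u [[Eu pos]]; first by move=> [].
move=> [Yu Ju]; split=> //; split=> //; split=> //.
move: Ju; rewrite addn0 addn1 /jump_time big_ord_recr/=.
by have := pos n (ltnSn n); lra.
Qed.

End jump_law.

(** * Transition kernel of the walk *)

Section transition_kernel.
Variables (R : realType) (d : nat) (d_gt0 : (0 < d)%N).
Context dT (T : measurableType dT).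
Variables (Y : nat -> T -> Zd d) (S : nat -> T -> R).
Hypothesis YS_meas : skeleton_measurable Y S.
Variable Pw : env R d -> Zd d -> probability T R.
Hypothesis Pw_law : forall w x, walk_law Y S w x (Pw w x).
Implicit Types (w : env R d) (x y z a : Zd d) (n m k : nat) (t s : R).

Let law w x : chain_law w (Pw w x) setT 1 x Y S.
Proof. exact: walk_law_chain. Qed.

Let mY : forall n y, measurable (Y n @^-1` [set y]) := YS_meas.1.
Let mS : forall n, measurable_fun setT (S n) := YS_meas.2.

Lemma njump_ge0 w n t x y : 0 <= t -> 0 <= njump w n t x y.
Proof.
move=> t0; rewrite -[leRHS]mul1r.
by rewrite -(pr_njump d_gt0 (law w) y n t0 (law w x)) pr_ge0.
Qed.

Definition tker w t x y : \bar R := \esum_(n in [set: nat]) (njump w n t x y)%:E.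

Lemma tker_ge0 w t x y : 0 <= t -> (0 <= tker w t x y)%E.
Proof. by move=> t0; apply: esum_ge0 => n _; rewrite lee_fin njump_ge0. Qed.

Lemma tker_shift w a t x y : tker (eshift a w) t x y = tker w t (a + x) (a + y).
Proof. by apply: eq_esum => n _; rewrite njump_shift. Qed.

Lemma tker_sym w t x y : tker w t x y = tker w t y x.
Proof. by apply: eq_esum => n _; rewrite njump_sym. Qed.

Lemma measurable_tker t x y : 0 <= t ->
  measurable_fun [set: Omega R d] (fun w => tker w t x y).
Proof.
move=> t0; apply: emeasurable_esum => [n|n w]; last by rewrite lee_fin njump_ge0.
by apply/measurable_EFinP; exact: measurable_njump.
Qed.

(** Cauchy product of the identities at fixed numbers of jumps; all terms are nonnegative, so the
    sums may be exchanged. *)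
Lemma tker_CK w t s x y : 0 <= t -> 0 <= s ->
  tker w (t + s) x y = (\esum_(z in [set: Zd d]) (tker w t x z * tker w s z y))%E.
Proof.
move=> t0 s0.
transitivity (\esum_(n in [set: nat]) (\sum_(k < n.+1)
  \esum_(z in [set: Zd d]) (njump w k t x z * njump w (n - k) s z y)%:E)%E).
  apply: eq_esum => n _; rewrite [njump _ _ _ _ _]jkernel_CK -sumEFin.
  apply: eq_bigr => k _; rewrite -sumEFin; apply/esym/esum_seq.
  - exact: undup_uniq.
  - by move=> z; rewrite lee_fin mulr_ge0// njump_ge0.
  - by move=> z; rewrite mem_undup => /jkernel_out zx; rewrite /njump zx mul0r.
rewrite (esum_cauchy (a := fun k m =>
  \esum_(z in [set: Zd d]) (njump w k t x z * njump w m s z y)%:E)); last first.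
  by move=> k m; apply: esum_ge0 => z _; rewrite lee_fin mulr_ge0// njump_ge0.
under eq_esum => k _.
  rewrite esum_swap => [|m z]; last by rewrite lee_fin mulr_ge0// njump_ge0.
  under eq_esum => z _.
    under eq_esum => m _ do rewrite EFinM.
    rewrite esumZl ?lee_fin ?njump_ge0// => [|m]; last by rewrite lee_fin njump_ge0.
    over.
  over.
rewrite esum_swap => [|k z]; last first.
  by rewrite mule_ge0 ?lee_fin ?njump_ge0// esum_ge0// => m _; rewrite lee_fin njump_ge0.
apply: eq_esum => z _; under eq_esum do rewrite muleC.
rewrite esumZl 1?muleC// => [k|]; first by rewrite lee_fin njump_ge0.
exact: tker_ge0.
Qed.

(** Positivity of the holding times is built in so that these events are disjoint everywhere and not
    merely up to null sets. *)
Definition sojourn n y t : set T :=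
  [set u | forall i, (i < n.+1)%N -> 0 < S i u] `&`
  [set u | Y n u = y /\ jump_time S n u <= t < jump_time S n.+1 u].

Lemma measurable_sojourn n y t : measurable (sojourn n y t).
Proof.
apply: measurableI; first exact: measurable_pos.
rewrite (_ : mkset _ = Y n @^-1` [set y] `&` ([set u | jump_time S n u <= t] `&`
  [set u | t < jump_time S n.+1 u])); last first.
  by apply/seteqP; split=> u /=; [move=> [? /andP[]]|move=> [? [? ?]]; split=> //; apply/andP].
apply: measurableI => //; apply: measurableI.
  by apply: measurable_ltc; exact: measurable_jump_time YS_meas.
by apply: measurable_gt; exact: measurable_jump_time YS_meas.
Qed.

Lemma jump_time_le n m u : (n <= m)%N ->
  (forall i, (i < m)%N -> 0 < S i u) -> jump_time S n u <= jump_time S m u.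
Proof.
move=> nm pos; rewrite /jump_time -(big_mkord xpredT (fun i => S i u)).
rewrite -(big_mkord xpredT (fun i => S i u)) (big_cat_nat _ nm)//=.
rewrite lerDl big_nat_cond sumr_ge0// => i /andP[/andP[_ im] _].
exact/ltW/pos.
Qed.

Lemma sojourn_inj n y n' y' t u : sojourn n y t u -> sojourn n' y' t u ->
  n = n' /\ y = y'.
Proof.
have lt_false k l z z' : (k < l)%N -> sojourn k z t u -> sojourn l z' t u -> False.
  move=> kl [_ [_ /andP[_ J1]]] [pos [_ /andP[J2 _]]].
  have : jump_time S k.+1 u <= jump_time S l u.
    by apply: jump_time_le => // i il; apply: pos; exact: ltnW.
  by move=> /le_trans/(_ J2); rewrite leNgt J1.
move=> G G'; have nn : n = n'.
  case: (ltngtP n n') => // nn; first by have := lt_false _ _ _ _ nn G G'.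
  by have := lt_false _ _ _ _ nn G' G.
by split=> //; move: G G' => [_ [<- _]] [_ [<- _]]; rewrite nn.
Qed.

Lemma sojourn_njump w x n y t : 0 <= t ->
  Pw w x (sojourn n y t) = (njump w n t x y)%:E.
Proof.
move=> t0; rewrite prE; last exact: measurable_sojourn.
congr EFin; rewrite -[RHS]mul1r -(pr_njump d_gt0 (law w) y n t0 (law w x)).
rewrite setTI; apply/esym; rewrite -[X in pr _ X = _]setTI.
apply: pr_full => //.
- have mG := measurable_sojourn n y t.
  rewrite (_ : mkset _ = jump_event Y S false n y t `\` jump_event Y S true n y t).
    by apply: measurableD; exact: measurable_jump_event.
  rewrite /jump_event addn0 addn1; apply/seteqP; split=> u /=.
    by move=> [Yu /andP[J1 J2]]; split=> // -[_]; rewrite leNgt J2.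
  by move=> [[Yu J1] N]; split=> //; rewrite J1 ltNge; apply/negP => J2; exact: N.
- exact: measurable_pos.
- by rewrite -[X in pr _ X]setTI (chain_law_pos d_gt0 _ (law w x)) /pr probability_setT.
Qed.

Lemma tker_le1 w t x : 0 <= t -> (\esum_(y in [set: Zd d]) tker w t x y <= 1)%E.
Proof.
move=> t0; rewrite /tker esum_esum => [|y n _ _]; last by rewrite lee_fin njump_ge0.
pose F (p : Zd d * nat) := sojourn p.2 p.1 t.
have mF p : measurable (F p) by exact: measurable_sojourn.
have dF p p' u : F p u -> F p' u -> p = p'.
  by case: p p' => [y n] [y' n'] G G'; have [/= -> ->] := sojourn_inj G G'.
have <- : Pw w x (\bigcup_p F p) = \esum_(k in [set: Zd d] `*`` (fun=> [set: nat]))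
    (njump w k.2 t x k.1)%:E.
  rewrite measure_esum// (_ : _ `*`` _ = setT); last by apply/seteqP; split.
  by apply: eq_esum => p _; exact: sojourn_njump.
apply: probability_le1; rewrite (_ : \bigcup_p F p = \bigcup_n
   (if pickle_inv n is Some p then F p else set0)).
  by apply: bigcupT_measurable => k; case: (pickle_inv k).
apply/seteqP; split=> u [i _ Fi].
  by exists (pickle i) => //; rewrite pickleK_inv.
by case E : (pickle_inv i) Fi => [j|] // Fj; exists j.
Qed.

(* The position at time t is chosen measurably: [walk] itself need not be
   measurable on the null set where some holding time is nonpositive. *)
Definition mwalk t u := xget (Y 0%N u) [set y | exists n, sojourn n y t u].

Lemma mwalk_sojourn n y t u : sojourn n y t u -> mwalk t u = y.
Proof.
move=> G; rewrite /mwalk; case: xgetP => [z _ [m G']|/(_ y)[]]; last by exists n.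
by have [_ ->] := sojourn_inj G G'.
Qed.

Lemma measurable_mwalk t y : measurable (mwalk t @^-1` [set y]).
Proof.
pose U z := \bigcup_n sojourn n z t.
have mU z : measurable (U z).
  by apply: bigcupT_measurable => n; exact: measurable_sojourn.
rewrite (_ : _ @^-1` _ = U y `|` (Y 0%N @^-1` [set y] `\`
   \bigcup_k (if pickle_inv k is Some z then U z else set0))).
  apply: measurableU => //; apply: measurableD => //.
  by apply: bigcupT_measurable => k; case: (pickle_inv k).
apply/seteqP; split=> u /=.
  rewrite /mwalk; case: xgetP => [z _ [n G] <-|no Yu]; first by left; exists n.
  right; split=> // -[k _]; case: (pickle_inv k) => // z [n _ G].
  by apply: (no z); exists n.
move=> [[n _ G]|[Yu no]]; first exact: mwalk_sojourn G.
rewrite /mwalk; case: xgetP => // z _ [n G]; exfalso; apply: no.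
by exists (pickle z) => //; rewrite pickleK_inv; exists n.
Qed.

Lemma walk_sojourn w x t : 0 <= t -> no_explosion S (Pw w x) ->
  {ae Pw w x, forall u, walk Y S t u = mwalk t u /\
    exists n, sojourn n (mwalk t u) t u}.
Proof.
move=> t0; have pos : {ae Pw w x, forall u, forall i, 0 < S i u}.
  apply/ae_foralln => i; exists (~` [set u | forall j, (j < i.+1)%N -> 0 < S j u]).
  split.
  - by apply: measurableC; exact: measurable_pos.
  - apply: (eq_trans (probability_setC (Pw w x) (measurable_pos i.+1 mS))).
    rewrite prE; last exact: measurable_pos.
    by rewrite -[X in pr _ X]setTI (chain_law_pos d_gt0 _ (law w x)) subee.
  - by move=> u /= Si H; apply: Si; exact: H.
rewrite /no_explosion; move=> nex; near=> u.
have posu : forall i, 0 < S i u by near: u.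
have Ju : jump_time S n u @[n --> \oo] --> +oo by near: u.
have [N tN] : exists n, t < jump_time S n u.
  have /cvgryPgt/(_ t) [N _ HN] := Ju.
  by exists N; apply: HN; rewrite /=.
have ex : exists n, t < jump_time S n u by exists N.
(* The least index whose jump time exceeds t is not 0, as [jump_time] starts at 0; its predecessor n
   is the number of jumps made. *)
case: (ex_minnP ex) => -[|n].
  by rewrite /jump_time big_ord0 ltNge t0.
move=> tn nmin; have nt : jump_time S n u <= t.
  by rewrite leNgt; apply/negP => /nmin; rewrite ltnn.
have G : sojourn n (Y n u) t u by split=> [i _|]; [exact: posu|split=> //; apply/andP].
have -> := mwalk_sojourn G; split; last by exists n.
rewrite /walk; case: xgetP => [m _ mt|/(_ n)[]]; last by apply/andP.
have G' : sojourn m (Y m u) t u by split=> [i _|]; [exact: posu|].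
by have [_ ->] := sojourn_inj G G'.
Unshelve. all: by end_near. Qed.

Lemma tker_mwalk w x y t : 0 <= t -> no_explosion S (Pw w x) ->
  Pw w x (mwalk t @^-1` [set y]) = tker w t x y.
Proof.
move=> t0 nex; have [N [mN N0 NP]] := walk_sojourn t0 nex.
have mU : measurable (\bigcup_n sojourn n y t).
  by apply: bigcupT_measurable => n; exact: measurable_sojourn.
transitivity (Pw w x (\bigcup_n sojourn n y t)).
  apply/eqP; rewrite eq_le; apply/andP; split; last first.
    apply: le_measure; rewrite ?inE//; first exact: measurable_mwalk.
    by move=> u [n _ G]; exact: mwalk_sojourn G.
  rewrite -[leRHS]adde0 -N0; apply: le_trans (measureU2 _ _ _) => //.
  apply: le_measure; rewrite ?inE//; first exact: measurable_mwalk.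
    exact: measurableU.
  move=> u uy; have [|Nu] := pselect (N u); [by right|left].
  have [_ [n G]] := contrapT (contra_not (@NP u) Nu).
  by exists n => //; rewrite -uy.
rewrite measure_esum; first by apply: eq_esum => n _; exact: sojourn_njump.
- by move=> n; exact: measurable_sojourn.
- by move=> n m u G G'; have [] := sojourn_inj G G'.
Qed.

End transition_kernel.

(** * The environment viewed by the particle *)

Section environment_semigroup.
Variables (R : realType) (d : nat) (d_gt0 : (0 < d)%N).
Variables (P : probability (Omega R d) R) (P_inv : shift_invariant P).
Context dT (T : measurableType dT).
Variables (Y : nat -> T -> Zd d) (S : nat -> T -> R).
Hypothesis YS_meas : skeleton_measurable Y S.
Variable Pw : env R d -> Zd d -> probability T R.
Hypothesis Pw_law : forall w x, walk_law Y S w x (Pw w x).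
Hypothesis Pw_noexpl :
  {ae P, forall w : Omega R d, forall x, no_explosion S (Pw w x)}.
Implicit Types (w : Omega R d) (x y z a : Zd d) (t s : R).
Implicit Types (f g : Omega R d -> R) (F G : Omega R d -> \bar R).

Let tk_ge0 w t x y : 0 <= t -> (0 <= tker w t x y)%E.
Proof. exact: (tker_ge0 d_gt0 YS_meas Pw_law). Qed.

Local Notation mwalk := (mwalk Y S).
Local Notation L2 := (Lfun P 2%:E).
Local Notation sqint := (sqint P).

(** The semigroup on nonnegative extended functions, where sums and integrals commute freely and no
    finiteness has to be checked. *)
Definition envop t F w : \bar R :=
  (\esum_(y in [set: Zd d]) (tker w t 0 y * F (eshift y w)))%E.

Lemma envop_ge0 t F w : 0 <= t -> (forall w, 0 <= F w)%E -> (0 <= envop t F w)%E.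
Proof. by move=> t0 F0; apply: esum_ge0 => y _; rewrite mule_ge0 ?tk_ge0. Qed.

Lemma measurable_fun_shift F a : measurable_fun setT F ->
  measurable_fun setT (fun w => F (eshift a w)).
Proof. by move=> mF; apply: (measurableT_comp mF); exact: measurable_shift. Qed.

Lemma measurable_envop t F : 0 <= t -> measurable_fun setT F ->
  (forall w, 0 <= F w)%E -> measurable_fun setT (envop t F).
Proof.
move=> t0 mF F0; apply: emeasurable_esum => [y|y w]; last by rewrite mule_ge0 ?tk_ge0.
apply: emeasurable_funM; last exact: measurable_fun_shift.
exact: (measurable_tker d_gt0 YS_meas Pw_law).
Qed.

Lemma integral_shift F a : measurable_fun setT F -> (forall w, 0 <= F w)%E ->
  (\int[P]_w F (eshift a w) = \int[P]_w F w)%E.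
Proof.
move=> mF F0; have ms := @measurable_shift R d a.
transitivity (\int[pushforward P (eshift a : Omega R d -> Omega R d)]_w F w)%E.
  by rewrite (ge0_integral_pushforward ms).
by apply: eq_measure_integral => A mA _; exact: P_inv.
Qed.

(** Shift invariance turns the integral of [tker w 0 y * F (eshift y w)] into that of
    [tker w (- y) 0 * F w]; by symmetry of the kernel the sum over y has total weight at most 1. *)
Lemma integral_envop_le t F : 0 <= t -> measurable_fun setT F ->
  (forall w, 0 <= F w)%E -> (\int[P]_w envop t F w <= \int[P]_w F w)%E.
Proof.
move=> t0 mF F0.
have mtk x y : measurable_fun [set: Omega R d] (fun w => tker w t x y).
  exact: (measurable_tker d_gt0 YS_meas Pw_law).
have -> : (\int[P]_w envop t F w =
    \int[P]_w \esum_(y in [set: Zd d]) (tker w t y 0 * F w))%E.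
  rewrite ge0_integral_esum => [|y|y w]; last by rewrite mule_ge0 ?tk_ge0.
    rewrite ge0_integral_esum => [|y|y w]; last by rewrite mule_ge0 ?tk_ge0.
      rewrite (esum_bij _ (e := fun y => - y)); last by exists (fun y => - y); exact: opprK.
      apply: eq_esum => y _.
      rewrite -(@integral_shift (fun w => tker w t y 0 * F w)%E (- y)) => [||w].
      - apply: eq_integral => w _; rewrite tker_shift.
        by rewrite addNr addr0.
      - exact: emeasurable_funM.
      - by rewrite mule_ge0 ?tk_ge0.
    exact: emeasurable_funM.
  apply: emeasurable_funM => //; exact: measurable_fun_shift.
apply: ge0_le_integral => //.
- by move=> w _; apply: esum_ge0 => y _; rewrite mule_ge0 ?tk_ge0.
- apply: emeasurable_esum => [y|y w]; last by rewrite mule_ge0 ?tk_ge0.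
  exact: emeasurable_funM.
- move=> w _; under eq_esum do rewrite muleC.
  rewrite esumZl// => [|y]; last exact: tk_ge0.
  rewrite -[leRHS]mule1 lee_wpmul2l//.
  under eq_esum do rewrite tker_sym.
  exact: (tker_le1 d_gt0 YS_meas Pw_law).
Qed.

Lemma envop_semigroup t s F w : 0 <= t -> 0 <= s -> (forall w, 0 <= F w)%E ->
  envop (t + s) F w = envop t (envop s F) w.
Proof.
move=> t0 s0 F0; rewrite /envop.
transitivity (\esum_(y in [set: Zd d]) \esum_(z in [set: Zd d])
    (tker w t 0 z * (tker w s z y * F (eshift y w)))%E).
  apply: eq_esum => y _; rewrite (tker_CK d_gt0 YS_meas Pw_law)// muleC -esumZl//.
    by apply: eq_esum => z _; rewrite muleC muleA.
  by move=> z; rewrite mule_ge0 ?tk_ge0.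
rewrite esum_swap => [|y z]; last by rewrite !mule_ge0 ?tk_ge0.
apply: eq_esum => z _; rewrite esumZl ?tk_ge0// => [|y]; last first.
  by rewrite mule_ge0 ?tk_ge0.
congr (_ * _)%E; rewrite (esum_bij _ (e := fun y => z + y)); last first.
  by exists (fun y => - z + y) => y; rewrite addrA ?addNr ?addrN add0r.
by apply: eq_esum => y _; rewrite tker_shift addr0 shift_comp.
Qed.

Lemma ae_shift (A : Omega R d -> Prop) : {ae P, forall w, A w} ->
  {ae P, forall w, forall y, A (eshift y w)}.
Proof.
move=> [N [mN N0 NA]].
have Ay y : {ae P, forall w, A (eshift y w)}.
  exists ((eshift y : Omega R d -> Omega R d) @^-1` N); split.
  - by rewrite -[X in measurable X]setTI; exact: measurable_shift.
  - by rewrite P_inv.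
  - by move=> w /= nA; exact: NA.
have : {ae P, forall w : Omega R d, forall k : nat,
    if pickle_inv k is Some y then A (eshift y w) else True}.
  by apply: ae_foralln => k; case: (pickle_inv k) => [y|]; [exact: Ay|exact: aeW].
by apply: filterS => w H y; have := H (pickle y); rewrite pickleK_inv.
Qed.

Lemma envop_ae t F G : {ae P, forall w, F w = G w} ->
  {ae P, forall w, envop t F w = envop t G w}.
Proof.
move=> /ae_shift; apply: filterS => w FG.
by apply: eq_esum => y _; rewrite FG.
Qed.

Lemma tker0 w x y : tker w 0 x y = ((x == y)%:R)%:E.
Proof.
rewrite /tker (@esum_seq _ _ [:: 0%N])//.
- by rewrite big_seq1 /njump jkernel_at0.
- by move=> n; rewrite /njump jkernel_at0 lee_fin.
- by move=> [|n]//= _; rewrite /njump jkernel_at0.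
Qed.

Lemma envop0 F w : (forall w, 0 <= F w)%E -> envop 0 F w = F w.
Proof.
move=> F0; rewrite /envop (@esum_seq _ _ [:: 0])//.
- by rewrite big_seq1 tker0 eqxx mul1e env_shift0.
- by move=> y; rewrite mule_ge0 ?tk_ge0.
- by move=> y; rewrite inE tker0 eq_sym => /negPf ->; rewrite mul0e.
Qed.

Lemma integral_mwalk w t F : 0 <= t -> no_explosion S (Pw w 0) ->
  (forall w, 0 <= F w)%E ->
  (\int[Pw w 0]_u F (eshift (mwalk t u) w) = envop t F w)%E.
Proof.
move=> t0 nex F0.
rewrite (integral_discrete (Pw w 0) (X := mwalk t)
  (F := fun y => F (eshift y w)))//; last by move=> y; exact: measurable_mwalk.
apply: eq_esum => y _; rewrite muleC; congr (_ * _)%E.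
exact: (tker_mwalk d_gt0 YS_meas Pw_law).
Qed.

Lemma measurable_mwalk_fun t (h : Zd d -> R) :
  measurable_fun setT (fun u => h (mwalk t u)).
Proof.
move=> _ B mB; rewrite setTI.
rewrite (_ : _ @^-1` _ = \bigcup_k (if pickle_inv k is Some y then
   if `[< B (h y) >] then mwalk t @^-1` [set y] else set0 else set0)).
  apply: bigcupT_measurable => k; case: (pickle_inv k) => // y.
  by case: ifPn => // _; exact: measurable_mwalk.
apply/seteqP; split=> u /=.
  by move=> Bu; exists (pickle (mwalk t u)) => //; rewrite pickleK_inv asboolT.
by move=> [k _]; case: (pickle_inv k) => // y; case: ifPn => // /asboolP By /= Xu; rewrite Xu.
Qed.

(* A measurable version of [evolve]: they agree on the environments for which the
   walk does not explode. *)
Definition envsg t f w : R :=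
  fine (envop t (EFin \o f)^\+ w - envop t (EFin \o f)^\- w)%E.

Lemma envsgE t f w : 0 <= t -> no_explosion S (Pw w 0) ->
  envsg t f w = \int[Pw w 0]_u f (eshift (mwalk t u) w).
Proof.
move=> t0 nex; rewrite /envsg /Rintegral integralE.
rewrite -!integral_mwalk//; congr (fine (_ - _)%E).
  by apply: eq_integral => u _; rewrite !funeposE.
by apply: eq_integral => u _; rewrite !funenegE.
Qed.

Lemma evolve_mwalk t f w : 0 <= t -> no_explosion S (Pw w 0) ->
  evolve Y S Pw t f w = \int[Pw w 0]_u f (eshift (mwalk t u) w).
Proof.
move=> t0 nex; apply: Rintegral_ae.
  exact: (@measurable_mwalk_fun t (fun y => f (eshift y w))).
have := walk_sojourn d_gt0 YS_meas Pw_law t0 nex.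
by apply: filterS => u [-> _].
Qed.

Let noexpl : {ae P, forall w, no_explosion S (Pw w 0)}.
Proof. by apply: filterS Pw_noexpl => w; exact. Qed.

Lemma evolve_envsg t f : 0 <= t ->
  {ae P, forall w, evolve Y S Pw t f w = envsg t f w}.
Proof.
by move=> t0; apply: filterS noexpl => w nex; rewrite evolve_mwalk// envsgE.
Qed.

Lemma measurable_envsg t f : 0 <= t -> measurable_fun setT f ->
  measurable_fun setT (envsg t f).
Proof.
move=> t0 mf; have mef : measurable_fun setT (EFin \o f) by exact/measurable_EFinP.
apply: (measurableT_comp (f := fine)); first exact: fine_measurable.
apply: emeasurable_funB; apply: measurable_envop => //.
- exact: measurable_funepos.
- exact: measurable_funeneg.
Qed.

(** This is nonnegativity of the variance, once the second moment is finite. *)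
Lemma sqr_Rintegral_le (Q : probability T R) (X : T -> R) : measurable_fun setT X ->
  (((\int[Q]_u X u) ^+ 2)%:E <= \int[Q]_u (X u ^+ 2)%:E)%E.
Proof.
move=> mX; have [fin|] := ltP (\int[Q]_u (X u ^+ 2)%:E)%E +oo%E; last first.
  by rewrite leye_eq => /eqP ->; rewrite leey.
have XL : X \in Lfun Q 2%:E by apply/Lfun2P.
have Qfin : Q setT \is a fin_num by exact: fin_num_measure.
have X1 := expectation_fin_num (Lfun_subset12 Qfin XL).
have EX : 'E_Q[X]%E = (\int[Q]_u X u)%:E.
  by move: X1; rewrite unlock /Rintegral => X1; rewrite fineK.
have := variance_ge0 Q X; rewrite (varianceE XL) EX -EFin_expe sube_ge0//.
by rewrite unlock.
Qed.

Lemma envsg_sqr_le t f w : 0 <= t -> no_explosion S (Pw w 0) ->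
  (((envsg t f w) ^+ 2)%:E <= envop t (fun w => ((f w) ^+ 2)%:E) w)%E.
Proof.
move=> t0 nex; rewrite envsgE// -integral_mwalk// => [|v]; last first.
  by rewrite lee_fin sqr_ge0.
apply: sqr_Rintegral_le.
exact: (@measurable_mwalk_fun t (fun y => f (eshift y w))).
Qed.

(** Jensen's inequality under the law of the walk, followed by [integral_envop_le] for f^2. *)
Lemma sqint_envsg t f : 0 <= t -> f \in L2 -> (sqint (envsg t f) <= sqint f)%E.
Proof.
move=> t0 /Lfun2P[mf ff].
have mf2 : measurable_fun setT (fun w => ((f w) ^+ 2)%:E).
  by apply/measurable_EFinP; exact: measurable_funX.
have f20 w : (0 <= ((f w) ^+ 2)%:E)%E by rewrite lee_fin sqr_ge0.
apply: le_trans (integral_envop_le t0 mf2 f20).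
apply: ae_ge0_le_integral => //.
- by move=> w _; rewrite lee_fin sqr_ge0.
- by apply/measurable_EFinP; apply: measurable_funX; exact: measurable_envsg.
- by move=> w _; exact: envop_ge0.
- exact: measurable_envop.
- by apply: filterS noexpl => w nex _; exact: envsg_sqr_le.
Qed.

Lemma envsg_L2 t f : 0 <= t -> f \in L2 -> envsg t f \in L2.
Proof.
move=> t0 fL; have /Lfun2P[mf ff] := fL; apply/Lfun2P; split.
  exact: measurable_envsg.
exact: le_lt_trans (sqint_envsg t0 fL) ff.
Qed.

Lemma envsg_ae t f g : 0 <= t -> {ae P, forall w, f w = g w} ->
  {ae P, forall w, envsg t f w = envsg t g w}.
Proof.
move=> t0 fg.
have h1 : {ae P, forall w, (EFin \o f)^\+%E w = (EFin \o g)^\+%E w}.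
  by apply: filterS fg => w; rewrite !funeposE /= => ->.
have h2 : {ae P, forall w, (EFin \o f)^\-%E w = (EFin \o g)^\-%E w}.
  by apply: filterS fg => w; rewrite !funenegE /= => ->.
have := envop_ae t h2; apply: filterS2 (envop_ae t h1) => w e1 e2.
by rewrite /envsg e1 e2.
Qed.

(** The integral of [envop t] applied to f^2 is finite, so for almost every environment f has a
    second moment along the walk. This makes the difference of positive and negative parts in
    [envsg] meaningful. *)
Lemma integrable_mwalk t f : 0 <= t -> f \in L2 ->
  {ae P, forall w, (Pw w 0).-integrable setT
    (fun u => (f (eshift (mwalk t u) w))%:E)}.
Proof.
move=> t0 /Lfun2P[mf ff].
have mf2 : measurable_fun setT (fun w => ((f w) ^+ 2)%:E).
  by apply/measurable_EFinP; exact: measurable_funX.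
have f20 w : (0 <= ((f w) ^+ 2)%:E)%E by rewrite lee_fin sqr_ge0.
have fin : {ae P, forall w, (envop t (fun w => ((f w) ^+ 2)%:E) w < +oo)%E}.
  have int : P.-integrable setT (envop t (fun w => ((f w) ^+ 2)%:E)).
    apply/integrableP; split; first exact: measurable_envop.
    under eq_integral do rewrite gee0_abs ?envop_ge0//.
    exact: le_lt_trans (integral_envop_le t0 mf2 f20) ff.
  have := integrable_ae measurableT int; apply: filterS => w /(_ I).
  by rewrite fin_numElt => /andP[].
apply: filterS2 noexpl fin => w nex fin.
have mX := @measurable_mwalk_fun t (fun y => f (eshift y w)).
apply/Lfun1_integrable/Lfun_subset12; first exact: fin_num_measure.
apply/Lfun2P; split=> //; apply: le_lt_trans fin.
by rewrite -(integral_mwalk t0 nex f20).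
Qed.

Lemma envsg_linear t (a : R) f g : 0 <= t -> f \in L2 -> g \in L2 ->
  {ae P, forall w, envsg t (fun w => a * f w + g w) w =
    a * envsg t f w + envsg t g w}.
Proof.
move=> t0 fL gL.
apply: filterS3 noexpl (integrable_mwalk t0 fL) (integrable_mwalk t0 gL).
move=> w nex fi gi; rewrite !envsgE//.
have afi : (Pw w 0).-integrable setT (EFin \o (fun u => a * f (eshift (mwalk t u) w))).
  have := integrableZl measurableT a fi; congr integrable.
rewrite -[in RHS]RintegralZl// -RintegralD//.
Qed.

Lemma envsg_ge0 t f w : 0 <= t -> (forall w, 0 <= f w) ->
  envsg t f w = fine (envop t (EFin \o f) w).
Proof.
move=> t0 f0; rewrite /envsg.
have -> : (EFin \o f)^\+%E = EFin \o f.
  by apply/funext => v; rewrite funeposE /= max_l ?lee_fin.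
have -> : envop t (EFin \o f)^\-%E w = 0%E.
  apply: esum1 => y _; rewrite funenegE /= max_r ?mule0//.
  by rewrite lee_fin oppr_le0.
by rewrite sube0.
Qed.

Lemma envsg_semigroup_ge0 t s f : 0 <= t -> 0 <= s -> f \in L2 ->
  (forall w, 0 <= f w) ->
  {ae P, forall w, envsg (t + s) f w = envsg t (envsg s f) w}.
Proof.
move=> t0 s0 fL f0; have fs0 w : 0 <= envsg s f w.
  by rewrite envsg_ge0// fine_ge0// envop_ge0// => v; rewrite lee_fin.
have fin : {ae P, forall w, (EFin \o envsg s f) w = envop s (EFin \o f) w}.
  apply: filterS2 noexpl (integrable_mwalk s0 fL) => w nex fi.
  rewrite /= envsg_ge0// fineK// -integral_mwalk//.
  exact: integrable_fin_num fi.
apply: filterS (envop_ae t fin) => w e.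
by rewrite envsg_ge0 ?addr_ge0// envsg_ge0// e -envop_semigroup.
Qed.

Lemma envsg_sub t f g : 0 <= t -> f \in L2 -> g \in L2 ->
  {ae P, forall w, envsg t (fun w => f w - g w) w = envsg t f w - envsg t g w}.
Proof.
move=> t0 fL gL; have -> : (fun w => f w - g w) = (fun w => -1 * g w + f w).
  by apply/funext => v; rewrite mulN1r addrC.
by apply: filterS (envsg_linear (-1) t0 gL fL) => w ->; rewrite mulN1r addrC.
Qed.

(** [envop_semigroup] concerns nonnegative functions; f is split into positive and negative parts,
    which stay in L^2(P), and linearity reassembles them. *)
Lemma envsg_semigroup t s f : 0 <= t -> 0 <= s -> f \in L2 ->
  {ae P, forall w, envsg (t + s) f w = envsg t (envsg s f) w}.
Proof.
move=> t0 s0 fL; have /Lfun2P[mf ff] := fL.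
pose fp w := Num.max (f w) 0; pose fn w : R := Num.max (- f w) 0.
have fp0 w : 0 <= fp w by rewrite le_max lexx orbT.
have fn0 w : 0 <= fn w by rewrite le_max lexx orbT.
have half (h : Omega R d -> R) : measurable_fun setT h -> (forall w, h w ^+ 2 <= f w ^+ 2) -> h \in L2.
  move=> mh hf; apply/Lfun2P; split=> //; apply: le_lt_trans ff.
  apply: ge0_le_integral => //.
  - by move=> w _; rewrite lee_fin sqr_ge0.
  - by apply/measurable_EFinP; exact: measurable_funX.
  - by apply/measurable_EFinP; exact: measurable_funX.
  - by move=> w _; rewrite lee_fin.
have fpL : fp \in L2.
  apply: half => [|w]; first by apply: measurable_maxr => //; exact: measurable_cst.
  by rewrite /fp maxEle; case: ifP => _; rewrite ?expr0n ?sqr_ge0.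
have fnL : fn \in L2.
  apply: half => [|w].
    by apply: measurable_maxr; [exact: measurable_funN|exact: measurable_cst].
  by rewrite /fn maxEle; case: ifP => _; rewrite ?expr0n ?sqrrN ?sqr_ge0.
have fE : f = fun w => fp w - fn w.
  by apply/funext => w; rewrite /fp /fn !maxEle; case: ifP; case: ifP; lra.
have ts0 : 0 <= t + s by exact: addr_ge0.
have e1 := envsg_sub ts0 fpL fnL; have e2 := envsg_ae t0 (envsg_sub s0 fpL fnL).
have e3 := envsg_sub t0 (envsg_L2 s0 fpL) (envsg_L2 s0 fnL).
have e4 := envsg_semigroup_ge0 t0 s0 fpL fp0.
have e5 := envsg_semigroup_ge0 t0 s0 fnL fn0.
have trans (a b c e m l : R) : a = b - c -> e = m - l -> b = m -> c = l -> a = e.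
  by move=> -> -> -> ->.
have e23 : {ae P, forall w, envsg t (envsg s f) w =
    envsg t (envsg s fp) w - envsg t (envsg s fn) w}.
  by rewrite fE; apply: filterS2 e2 e3 => w; exact: etrans.
rewrite -fE in e1.
have e45 : {ae P, forall w, envsg (t + s) fp w = envsg t (envsg s fp) w /\
    envsg (t + s) fn w = envsg t (envsg s fn) w}.
  by apply: filterS2 e4 e5 => w h4 h5; exact: conj h4 h5.
apply: filterS3 e1 e23 e45 => w h1 h2 [h4 h5].
exact: (trans _ _ _ _ _ _ h1 h2 h4 h5).
Qed.

Lemma envsg0 f w : envsg 0 f w = f w.
Proof.
rewrite /envsg !envop0//; have := funeposneg (EFin \o f).
by move=> /(congr1 (fun h => h w)) /= <-.
Qed.

End environment_semigroup.

(** * Identification of the semigroup with the spectral exponential *)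

Section semigroup_functional_calculus.
Variables (R : realType) (d : nat) (d_gt0 : (0 < d)%N).
Variables (P : probability (Omega R d) R) (P_inv : shift_invariant P).
Context dT (T : measurableType dT).
Variables (Y : nat -> T -> Zd d) (S : nat -> T -> R).
Hypothesis YS_meas : skeleton_measurable Y S.
Variable Pw : env R d -> Zd d -> probability T R.
Hypothesis Pw_law : forall w x, walk_law Y S w x (Pw w x).
Hypothesis Pw_noexpl :
  {ae P, forall w : Omega R d, forall x, no_explosion S (Pw w x)}.
Variable Phi : (R -> R) -> (Omega R d -> R) -> Omega R d -> R.
Hypothesis Phi_fc : functional_calculus P (evolve Y S Pw) Phi.
Implicit Types (w : Omega R d) (t s : R) (f g : Omega R d -> R).
Implicit Types (psi phi : R -> R) (x y : L2type P).

Local Notation L2 := (Lfun P 2%:E).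
Local Notation n := (@L2norm _ _ _ P).
Local Notation ip := (L2ip P).

Local Notation fun_of := (@L2fun _ _ _ P).

Definition fcalc psi x : L2type P := L2of P (Phi psi (fun_of x)).

Definition aeqv x y := n (x - y) = 0.
Local Notation "x =~ y" := (aeqv x y) (at level 70).

Let n_tri := @L2norm_tri _ _ _ P.
Let n_hom := @L2norm_hom _ _ _ P.
Let trans := eqv_trans n_tri n_hom.
Let sym := eqv_sym n_hom.
Let addv := eqvD n_tri n_hom.
Let subv := eqvB n_tri n_hom.
Let scalev := eqvZ n_hom.
Let refl := eqv_refl n_hom.

Lemma fcalcE psi x : bounded_continuous psi ->
  fun_of (fcalc psi x) = Phi psi (fun_of x).
Proof. by move=> bp; rewrite L2ofK// (fc_L2 Phi_fc)// L2funP. Qed.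

Lemma aeqvP x y : fun_of x = fun_of y %[ae P] -> x =~ y.
Proof. by move=> xy; apply: L2norm_ae; apply: filterS xy => w; exact. Qed.

Lemma aeqv_fun x y : x =~ y -> fun_of x = fun_of y %[ae P].
Proof. by move=> /L2norm_eq0; apply: filterS. Qed.

Lemma fcalc_ext psi phi x y : bounded_continuous psi -> bounded_continuous phi ->
  (forall l, 0 <= l -> psi l = phi l) -> x =~ y -> fcalc psi x =~ fcalc phi y.
Proof.
move=> bp bq pq xy; apply: aeqvP; rewrite !fcalcE//.
by apply: (fc_ext Phi_fc) => //; [exact: L2funP|exact: L2funP|exact: aeqv_fun].
Qed.

Lemma fcalc_linear psi a x y : bounded_continuous psi ->
  fcalc psi (a *: x + y) =~ (a *: fcalc psi x + fcalc psi y).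
Proof.
move=> bp; apply: aeqvP; rewrite fcalcE//.
have -> : fun_of (a *: fcalc psi x + fcalc psi y) =
    (fun w => a * fun_of (fcalc psi x) w + fun_of (fcalc psi y) w) by [].
by rewrite !fcalcE//; apply: (fc_linear Phi_fc) => //; exact: L2funP.
Qed.

Lemma fcalc_lincomb a psi phi x : bounded_continuous psi -> bounded_continuous phi ->
  fcalc (fun l => a * psi l + phi l) x =~ (a *: fcalc psi x + fcalc phi x).
Proof.
move=> bp bq; apply: aeqvP; rewrite fcalcE; last exact: bc_lincomb.
have -> : fun_of (a *: fcalc psi x + fcalc phi x) =
    (fun w => a * fun_of (fcalc psi x) w + fun_of (fcalc phi x) w) by [].
by rewrite !fcalcE//; apply: (fc_lincomb Phi_fc) => //; exact: L2funP.
Qed.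

Lemma fcalc_subZ a psi phi x : bounded_continuous psi -> bounded_continuous phi ->
  fcalc (fun l => - a * psi l + phi l) x =~ (fcalc phi x - a *: fcalc psi x).
Proof.
move=> bp bq; have -> : fcalc phi x - a *: fcalc psi x =
    (- a) *: fcalc psi x + fcalc phi x by rewrite scaleNr addrC.
exact: fcalc_lincomb.
Qed.

Lemma fcalc_mul psi phi x : bounded_continuous psi -> bounded_continuous phi ->
  fcalc (fun l => psi l * phi l) x =~ fcalc psi (fcalc phi x).
Proof.
move=> bp bq; apply: aeqvP; rewrite !fcalcE//; last exact: bc_mul.
by apply: (fc_mul Phi_fc) => //; exact: L2funP.
Qed.

Lemma fcalc_one x : fcalc (fun=> 1) x =~ x.
Proof.
apply: aeqvP; rewrite fcalcE; last exact: bc_cst.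
by apply: (fc_one Phi_fc); exact: L2funP.
Qed.

(** The axioms evaluate only the constant 1, so a is written (a - 1) * 1 + 1 to fit
    [fcalc_lincomb]. *)
Lemma fcalc_cst a x : fcalc (fun=> a) x =~ (a *: x).
Proof.
have b1 : bounded_continuous (fun=> 1 : R) by exact: bc_cst.
apply: (@trans (fcalc (fun l : R => (a - 1) * 1 + 1) x)).
  by apply: fcalc_ext => [|||]; [exact: bc_cst|exact: bc_lincomb|move=> l _; ring|exact: refl].
apply: (trans (fcalc_lincomb (a - 1) x b1 b1)).
have -> : a *: x = (a - 1) *: x + x by rewrite scalerBl scale1r subrK.
exact: (addv (scalev _ (fcalc_one x)) (fcalc_one x)).
Qed.

Let ipv x y := ip (fun_of x) (fun_of y).

Let ipv_linear a x y z : ipv (a *: x + y) z = a * ipv x z + ipv y z.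
Proof. by apply: L2ip_linear; exact: L2funP. Qed.

Let ipv_ae x y z : x =~ y -> ipv x z = ipv y z.
Proof. by move=> /aeqv_fun; apply: L2ip_ae; exact: L2funP. Qed.

Let ipv_fcalc psi x y : bounded_continuous psi ->
  ipv (fcalc psi x) y = ipv x (fcalc psi y).
Proof.
move=> bp; rewrite /ipv !fcalcE//.
by apply: (fc_sym Phi_fc) => //; exact: L2funP.
Qed.

Lemma fcalc_norm_sq psi x : bounded_continuous psi ->
  n (fcalc psi x) ^+ 2 = ipv (fcalc (fun l => psi l * psi l) x) x.
Proof.
move=> bp; rewrite -L2ip_sq -/(ipv _ _) -ipv_fcalc//; apply: ipv_ae.
by apply: sym; exact: fcalc_mul.
Qed.

(* M^2 - psi^2 is the square of a bounded continuous function, so that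
   M^2 - psi(- gen)^2 is nonnegative. *)
Lemma fcalc_norm_le psi M x : bounded_continuous psi -> 0 <= M ->
  (forall l, 0 <= l -> `|psi l| <= M) -> n (fcalc psi x) <= M * n x.
Proof.
move=> bp M0 pM; pose chi l := -1 * (psi l * psi l) + M ^+ 2.
have bpp := bc_mul bp bp; have bM := bc_cst (M ^+ 2).
have bchi : bounded_continuous chi := bc_lincomb (-1) bpp bM.
have chi0 l : 0 <= l -> 0 <= chi l.
  move=> l0; rewrite /chi mulN1r addrC subr_ge0 -expr2 -real_normK ?num_real//.
  by rewrite lerXn2r// ?nnegrE// pM.
have bphi := bc_sqrt bchi.
rewrite -(@ler_pXn2r _ 2)// ?nnegrE ?mulr_ge0 ?L2norm_ge0// fcalc_norm_sq// exprMn.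
have := sqr_ge0 (n (fcalc (fun l => Num.sqrt (chi l)) x)); rewrite fcalc_norm_sq//.
rewrite (@ipv_ae _ (fcalc chi x)); last first.
  apply: fcalc_ext; [exact: bc_mul|exact: bchi| |exact: refl].
  by move=> l l0; rewrite -expr2 sqr_sqrtr// chi0.
rewrite (ipv_ae _ (fcalc_lincomb (-1) x bpp bM)) ipv_linear.
rewrite (ipv_ae _ (fcalc_cst _ _)) -[M ^+ 2 *: x]addr0 ipv_linear.
have -> : ipv 0 x = 0.
  by have := ipv_linear 1 0 0 x; rewrite scale1r addr0 mul1r; lra.
by rewrite -L2ip_sq -/(ipv x x); lra.
Qed.

(** [J] is the resolvent, [U] the spectral exponential and [V] the probabilistic semigroup, taken in
    its measurable version so as to act on L^2(P). *)
Let J x := fcalc (fun l => (1 + l)^-1) x.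
Let U t x := fcalc (fun l => expR (- (t * l))) x.
Let V t x := L2of P (envsg t (fun_of x)).

Lemma fcalc_contractive psi : bounded_continuous psi ->
  (forall l, 0 <= l -> `|psi l| <= 1) -> contractive_map n (fcalc psi).
Proof.
move=> bp p1; split=> [a x y|x]; first exact: fcalc_linear.
by rewrite -[leRHS]mul1r; exact: fcalc_norm_le.
Qed.

Let cJ : contractive_map n J.
Proof.
apply: fcalc_contractive => [|l l0]; first exact: bc_inv.
by rewrite ger0_norm ?invr_ge0 ?addr_ge0// invf_le1 ?ltr_wpDr// lerDl.
Qed.

Let cU t : 0 <= t -> contractive_map n (U t).
Proof.
move=> t0; apply: fcalc_contractive => [|l l0]; first exact: bc_exp.
by rewrite ger0_norm ?expR_ge0// expR_le1 oppr_le0 mulr_ge0.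
Qed.

Let VE t x : 0 <= t -> fun_of (V t x) = envsg t (fun_of x).
Proof.
move=> t0; rewrite L2ofK//.
exact: (envsg_L2 d_gt0 P_inv YS_meas Pw_law Pw_noexpl t0 (L2funP x)).
Qed.

Let cV t : 0 <= t -> contractive_map n (V t).
Proof.
move=> t0; split=> [a x y|x].
  apply: L2norm_ae; rewrite VE//.
  have := envsg_linear d_gt0 P_inv YS_meas Pw_law Pw_noexpl a t0 (L2funP x) (L2funP y).
  apply: filterS => w H; apply: (eq_trans H).
  by rewrite -!VE.
rewrite -[leRHS]mul1r; apply: L2norm_le => //; rewrite VE// expr1n mul1e.
exact: (sqint_envsg d_gt0 P_inv YS_meas Pw_law Pw_noexpl t0 (L2funP x)).
Qed.

Let V0 x : V 0 x =~ x.
Proof.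
apply: L2norm_ae; rewrite VE//; apply: aeW => w.
exact: (envsg0 d_gt0 YS_meas Pw_law).
Qed.

Let U0 x : U 0 x =~ x.
Proof.
apply: (@trans (fcalc (fun=> 1) x)); last exact: fcalc_one.
apply: fcalc_ext; [exact: bc_exp|exact: bc_cst| |exact: refl].
by move=> l _; rewrite mul0r oppr0 expR0.
Qed.

Let VD t s x : 0 <= t -> 0 <= s -> V (t + s) x =~ V t (V s x).
Proof.
move=> t0 s0; apply: L2norm_ae; rewrite !VE ?addr_ge0//.
exact: (envsg_semigroup d_gt0 P_inv YS_meas Pw_law Pw_noexpl t0 s0 (L2funP x)).
Qed.

Let UD t s x : 0 <= t -> 0 <= s -> U (t + s) x =~ U t (U s x).
Proof.
move=> t0 s0; apply: (trans _ (fcalc_mul x (bc_exp t0) (bc_exp s0))).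
apply: fcalc_ext; [exact/bc_exp/addr_ge0|apply: bc_mul; exact: bc_exp| |exact: refl].
by move=> l _; rewrite -expRD mulrDl opprD.
Qed.

Let UJ t x : 0 <= t -> U t (J x) =~ J (U t x).
Proof.
move=> t0; have bi := bc_inv R; have be := bc_exp t0.
apply: (trans (sym (fcalc_mul x be bi))); apply: (trans _ (fcalc_mul x bi be)).
apply: fcalc_ext; [exact: bc_mul|exact: bc_mul| |exact: refl].
by move=> l _; rewrite mulrC.
Qed.

(** J x lies in the domain of [gen] and gen (J x) = J x - x, so this is the L^2 derivative at 0 from
    [gen_dom], with [evolve] replaced by its measurable version. *)
Let V_gen x e : 0 < e -> exists2 r0, 0 < r0 &
  forall r, 0 < r < r0 -> n (V r (J x) - J x - r *: (J x - x)) <= e * r.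
Proof.
move=> e0; have [] := fc_resolvent_r Phi_fc (L2funP x).
rewrite -(fcalcE x (bc_inv R)) -/(J x) => -[_ _ lim] Jx.
have e20 : 0 < e ^+ 2 by exact: exprn_gt0.
have /= := lim [set y | (y < (e ^+ 2)%:E)%E].
move=> /(_ (@nbhs_open_ereal_lt _ 0 (fun=> e ^+ 2) e20))[r0 /= r00 H].
exists r0 => // r /andP[rpos rr0]; have rge0 := ltW rpos.
have /= := H r; rewrite sub0r normrN gtr0_norm// => /(_ rr0 rpos) lt_e.
pose z := r^-1 *: (V r (J x) - J x) - (J x - x).
have -> : V r (J x) - J x - r *: (J x - x) = r *: z.
  by rewrite /z [RHS]scalerBr scalerA divff ?gt_eqF// scale1r.
rewrite n_hom gtr0_norm// mulrC ler_pM2r//.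
rewrite -(@ler_pXn2r _ 2)// ?nnegrE ?L2norm_ge0 ?(ltW e0)// -lee_fin L2norm_sq.
apply: le_trans (ltW lt_e); rewrite le_eqVlt; apply/orP; left; apply/eqP/esym.
apply: sqint_ae; first by have /Lfun2P[] := L2funP z.
have := evolve_envsg d_gt0 YS_meas Pw_law Pw_noexpl (fun_of (J x)) rge0.
apply: filterS2 Jx => w /(_ I) Jxw Ew.
have -> : fun_of z w = r^-1 * (fun_of (V r (J x)) w - fun_of (J x) w) -
  (fun_of (J x) w - fun_of x w) by [].
by rewrite VE// Ew -Jxw; ring.
Qed.

(** The multiplier is (1 + l)^-2 (exp(- r l) - 1 + r l), at most (r l)^2 / (1 + l)^2 <= r^2. One
    resolvent would leave a factor growing with l; two give the constant 1. *)
Let U_gen x r : 0 <= r ->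
  n (U r (J (J x)) - J (J x) - r *: (J (J x) - J x)) <= 1 * r ^+ 2 * n x.
Proof.
move=> r0; have bi := bc_inv R; have be := bc_exp r0.
have bii := bc_mul bi bi; have beii := bc_mul be bii.
(* The multiplier is assembled in the shape a psi + phi required by the linearity axiom: p1 for J J
   - J, p2 for U J J - J J, p3 for the whole. *)
pose p1 l : R := -1 * (1 + l)^-1 + (1 + l)^-1 * (1 + l)^-1.
pose p2 l : R := -1 * ((1 + l)^-1 * (1 + l)^-1) + expR (- (r * l)) * ((1 + l)^-1 * (1 + l)^-1).
pose p3 l : R := - r * p1 l + p2 l.
have b1 : bounded_continuous p1 by exact: bc_lincomb.
have b2 : bounded_continuous p2 by exact: bc_lincomb.
have b3 : bounded_continuous p3 by exact: bc_lincomb.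
have JJ : fcalc (fun l => (1 + l)^-1 * (1 + l)^-1) x =~ J (J x) by exact: fcalc_mul.
have e1 : fcalc p1 x =~ (J (J x) - J x).
  apply: (trans (fcalc_subZ 1 x bi bii)); rewrite scale1r.
  exact: (subv JJ (refl _)).
have e2 : fcalc p2 x =~ (U r (J (J x)) - J (J x)).
  apply: (trans (fcalc_subZ 1 x bii beii)); rewrite scale1r.
  apply: (subv _ JJ); apply: (trans (fcalc_mul x be bii)).
  exact: fcalc_ext.
have e3 : fcalc p3 x =~ (U r (J (J x)) - J (J x) - r *: (J (J x) - J x)).
  apply: (trans (fcalc_subZ r x b1 b2)).
  exact: (subv e2 (scalev _ e1)).
rewrite -(eqv_seminorm n_tri n_hom e3) mul1r; apply: fcalc_norm_le => //.
  exact: exprn_ge0.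
move=> l l0; have /andP[h1 h2] := expRN_taylor (mulr_ge0 r0 l0).
have l1 : 0 < 1 + l by rewrite ltr_wpDr.
set k := (1 + l)^-1; have k0 : 0 < k by rewrite invr_gt0.
have kl : k * (1 + l) = 1 by rewrite mulVf// gt_eqF.
have -> : p3 l = k * k * (expR (- (r * l)) - 1 + r * l).
  rewrite /p3 /p1 /p2 -/k; set E := expR _.
  have -> : - r * (-1 * k + k * k) = k * r * (k * (1 + l)) - r * k * k by rewrite kl; ring.
  ring.
rewrite ger0_norm ?mulr_ge0 ?(ltW k0)//.
have lk : l * k <= 1 by lra.
apply: (@le_trans _ _ (k * k * (r * l) ^+ 2)); first by rewrite ler_wpM2l ?mulr_ge0 ?(ltW k0).
rewrite (_ : k * k * _ = r ^+ 2 * (l * k) ^+ 2); last by ring.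
rewrite -[leRHS]mulr1 ler_wpM2l ?exprn_ge0// exprn_ile1// mulr_ge0// ltW//.
Qed.

Theorem evolve_fcalc t f : 0 < t -> f \in L2 ->
  {ae P, forall w, evolve Y S Pw t f w = Phi (fun l => expR (- (t * l))) f w}.
Proof.
move=> t0 fL; have tge0 := ltW t0.
have VU := semigroup_eq n_tri n_hom cV cU cJ V0 U0 VD UD UJ V_gen U_gen (L2of P f) t0.
have := aeqv_fun VU; rewrite VE// fcalcE; last exact: bc_exp.
rewrite L2ofK// => H.
have := evolve_envsg d_gt0 YS_meas Pw_law Pw_noexpl f tge0.
by apply: filterS2 H => w /(_ I) <- ->.
Qed.

Lemma sqint_evolve t f : 0 < t -> f \in L2 ->
  sqint P (evolve Y S Pw t f) =
  (\int[P]_w (Phi (fun l => expR (- (t * l)) * expR (- (t * l))) f w * f w)%:E)%E.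
Proof.
move=> t0 fL; have be := bc_exp (ltW t0); have bee := bc_mul be be.
have gL := fc_L2 Phi_fc be fL; have hL := fc_L2 Phi_fc bee fL.
rewrite (sqint_ae _ (evolve_fcalc t0 fL)); last exact: L2_measurable gL.
have fE : fun_of (L2of P f) = f by rewrite L2ofK.
have := fcalc_norm_sq (L2of P f) be; rewrite /ipv fcalcE// fE => e1.
have -> : sqint P (Phi (fun l => expR (- (t * l))) f) =
    (n (fcalc (fun l => expR (- (t * l))) (L2of P f)) ^+ 2)%:E.
  by rewrite L2norm_sq fcalcE// fE.
rewrite e1 /L2ip /Rintegral fineK//.
exact: (integrable_fin_num measurableT (L2ip_integrable hL fL)).
Qed.

End semigroup_functional_calculus.

Theorem theorem2p4 (R : realType) (d : nat) (d_gt0 : (0 < d)%N)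
  (P : probability (Omega R d) R)
  (P_inv : shift_invariant P)
  (P_ge1 : forall x y : Zd d, nbr x y ->
     {ae P, forall w : Omega R d, 1 <= rate w x y})
  (dT : measure_display) (T : measurableType dT)
  (Y : nat -> T -> Zd d) (S : nat -> T -> R)
  (YS_meas : skeleton_measurable Y S)
  (Pw : env R d -> Zd d -> probability T R)
  (Pw_law : forall w x, walk_law Y S w x (Pw w x))
  (Pw_noexpl : {ae P, forall w : Omega R d, forall x, no_explosion S (Pw w x)})
  (Phi : (R -> R) -> (Omega R d -> R) -> Omega R d -> R)
  (Phi_fc : functional_calculus P (evolve Y S Pw) Phi)
  (alpha : R) (alpha_gt1 : 1 < alpha)
  (f : Omega R d -> R) (f_L2 : f \in Lfun P 2%:E)
  (e : {measure set (measurableTypeR R) -> \bar R})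
  (e_f : spectral_measure P Phi f e) :
  (exists C : R, 0 < C /\ forall t : R, 0 < t ->
     (\int[P]_w ((evolve Y S Pw t f w) ^+ 2)%:E <= (C / t `^ alpha)%:E)%E)
  <->
  (exists C : R, 0 < C /\ forall delta : R, 0 < delta ->
     (\int[e]_(l in `[0%R, delta]) (l%:E)^-1
        <= (C * delta `^ (alpha - 1))%:E)%E).
Proof.
have alpha_gt0 : 0 < alpha by exact: lt_trans alpha_gt1.
(* The square of exp(- t l) is kept as a product, the form produced by symmetry and multiplicativity
   of the calculus. *)
have laplace t : 0 < t -> (\int[P]_w ((evolve Y S Pw t f w) ^+ 2)%:E =
    \int[e]_(l in `[0%R, +oo[) (expR (- (t * l)) * expR (- (t * l)))%:E)%E.
  move=> t0; have be := bc_exp (ltW t0).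
  rewrite -(e_f _ (bc_mul be be)).
  exact: (sqint_evolve d_gt0 P_inv YS_meas Pw_law Pw_noexpl Phi_fc t0 f_L2).
split=> -[C [C0 H]].
  have {}H t : 0 < t ->
      (\int[e]_(l in `[0%R, +oo[) (expR (- (t * l)) * expR (- (t * l)))%:E
        <= (C / t `^ alpha)%:E)%E.
    by move=> t0; rewrite -laplace//; exact: H.
  have mass := ball_mass_of_laplace C0 H.
  have K0 : 0 <= expR 2 * C by rewrite mulr_ge0 ?expR_ge0// ltW.
  (* One minus the ratio of the dyadic geometric series; positive because alpha > 1. *)
  pose s : R := 1 - (2 `^ (alpha - 1))^-1.
  have s0 : 0 < s.
    rewrite subr_gt0 invf_lt1 ?powR_gt0//.
    have := @gt0_ltr_powR R (alpha - 1) _ 1 2; rewrite powR1; apply.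
    - by rewrite subr_gt0.
    - by rewrite nnegrE.
    - by rewrite nnegrE.
    - by rewrite ltr1n.
  exists (2 * (expR 2 * C) / s); split.
    by rewrite divr_gt0// !mulr_gt0// expR_gt0.
  move=> delta d0; rewrite mulrAC.
  exact: (integral_of_ball_mass alpha_gt1 K0 mass d0).
have mass := ball_mass_of_integral H.
have e1 : 0 < 1 - expR (- 1) :> R by rewrite subr_gt0 expR_lt1 oppr_lt0 ltr01.
(* The mass bound holds with the same C; alpha^alpha exp(1) comes from bounding (k + 1)^alpha, and 1
   - exp(- 1) from the geometric series. *)
exists (C * alpha `^ alpha * expR 1 / (1 - expR (- 1))); split.
  by rewrite divr_gt0// !mulr_gt0 ?expR_gt0 ?powR_gt0.
move=> t t0; rewrite laplace// mulrAC.
exact: (laplace_of_ball_mass alpha_gt0 (ltW C0) mass t0).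
Qed.
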